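(* Let $m\ge1$ be an integer, let $p_i(\cdot)\in LH\cap\mathcal P$ for $i=1,\dots,m$, put $\frac1{p(\cdot)}=\sum_{i=1}^m\frac1{p_i(\cdot)}$, and let $\alpha$ be a constant and $q(\cdot)\in\mathcal P_0$ an exponent with $\frac{\alpha}{n}=\frac1{p(\cdot)}-\frac1{q(\cdot)}\in(0,m)$. Let $\mathscr T_\alpha$ be either $\mathscr M_\alpha$ or $\mathscr I_\alpha$. Then there is a constant $C>0$ such that for every $\vec b=(b_1,\dots,b_m)\in(\mathrm{BMO}(\mathbb R^n))^m$, $$\|\mathscr T_{\alpha,\Pi\vec b}\|_{L^{p_1(\cdot)}\times\cdots\times L^{p_m(\cdot)}\to L^{q(\cdot)}}\le C\prod_{i=1}^m\|b_i\|_{\mathrm{BMO}}.$$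
   Context: Exponents: for a measurable $p:\mathbb R^n\to(0,\infty)$ put $p_-=\operatorname{ess\,inf}p$, $p_+=\operatorname{ess\,sup}p$. $\mathcal P$ is the set of measurable $p(\cdot)$ with $1<p_-\le p_+<\infty$; $\mathcal P_0$ the set of measurable $p(\cdot)$ with $0<p_-\le p_+<\infty$. $p(\cdot)\in LH$ (globally log-Hölder continuous) means there are $C>0$ and $p_\infty>0$ with $|p(x)-p(y)|\le\frac{C}{-\log|x-y|}$ whenever $|x-y|<\frac12$, and $|p(x)-p_\infty|\le\frac{C}{\log(e+|x|)}$ for all $x\in\mathbb R^n$. For $p(\cdot)\in\mathcal P_0$, $L^{p(\cdot)}=L^{p(\cdot)}(\mathbb R^n)$ has $\|f\|_{L^{p(\cdot)}}=\inf\{\lambda>0:\int_{\mathbb R^n}(|f(x)|/\lambda)^{p(x)}dx\le1\}$. $\|b\|_{\mathrm{BMO}}=\sup_B\frac1{|B|}\int_B|b(x)-b_B|dx$, $b_B=\frac1{|B|}\int_Bb$, supremum over balls $B\subseteq\mathbb R^n$. Operators, for $0<\alpha<mn$ and $\vec f=(f_1,\dots,f_m)$: $$\mathscr M_\alpha(\vec f)(x)=\sup_{r>0}\frac1{|B(x,r)|^{m-\frac{\alpha}{n}}}\prod_{i=1}^m\int_{B(x,r)}|f_i(y_i)|\,dy_i,$$ $$\mathscr I_\alpha(\vec f)(x)=\int_{(\mathbb R^n)^m}\frac{f_1(y_1)\cdots f_m(y_m)}{(|x-y_1|+\cdots+|x-y_m|)^{mn-\alpha}}\,dy_1\cdots dy_m.$$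 The iterated commutator is $$\mathscr T_{\alpha,\Pi\vec b}(\vec f)(x)=\mathscr T_\alpha\big((b_1(x)-b_1)f_1,\dots,(b_m(x)-b_m)f_m\big)(x),$$ where $x$ is frozen in $b_j(x)$ when $\mathscr T_\alpha$ is applied. The operator norm of an operator $T$ is the least $C$ with $\|T(\vec f)\|_{L^{q(\cdot)}}\le C\prod_i\|f_i\|_{L^{p_i(\cdot)}}$ for all $f_i\in L^{p_i(\cdot)}$. *)

(* Defs.v *)
From HB Require Import structures.
From mathcomp Require Import all_boot all_order all_algebra.
From mathcomp Require Import all_classical all_reals all_analysis.
From mathcomp Require Import ess_sup_inf.

Set Implicit Arguments.
Unset Strict Implicit.
Unset Printing Implicit Defensive.

Import Order.TTheory GRing.Theory Num.Theory.
Import numFieldNormedType.Exports.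

Local Open Scope classical_set_scope.
Local Open Scope ring_scope.

Definition tcons (T : Type) (k : nat) (z : T * k.-tuple T) : k.+1.-tuple T :=
  [tuple of z.1 :: z.2].

Definition tuncons (T : Type) (k : nat) (t : k.+1.-tuple T) : T * k.-tuple T :=
  (thead t, [tuple of behead t]).

Lemma tconsK (T : Type) (k : nat) : cancel (@tcons T k) (@tuncons T k).
Proof. by move=> [x t]; congr pair; apply/val_inj. Qed.

Section measure_power_succ.
Context (d : measure_display) (T : measurableType d) (R : realType) (k : nat).

Lemma measurable_tcons : measurable_fun [set: T * k.-tuple T] (@tcons T k).
Proof. exact: measurable_cons. Qed.

HB.instance Definition _ := isMeasurableFun.Build _ _ _ _ _ measurable_tcons.

Lemma measurable_tuncons :
  measurable_fun [set: k.+1.-tuple T] (@tuncons T k).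
Proof.
by apply: measurable_fun_pair => /=;
  [exact: measurable_tnth|exact: measurable_behead].
Qed.

Variable mu : {sigma_finite_measure set T -> \bar R}.
Variable muk : {sigma_finite_measure set (k.-tuple T) -> \bar R}.

Definition measure_power_succ : set (k.+1.-tuple T) -> \bar R :=
  pushforward (mu \x muk)%E (@tcons T k).

Let mu1_0 : measure_power_succ set0 = 0%E.
Proof. exact: measure0. Qed.

Let mu1_ge0 A : (0 <= measure_power_succ A)%E.
Proof. exact: measure_ge0. Qed.

Let mu1_sigma_additive : semi_sigma_additive measure_power_succ.
Proof. exact: measure_semi_sigma_additive. Qed.

HB.instance Definition _ := isMeasure.Build _ _ _ measure_power_succ
  mu1_0 mu1_ge0 mu1_sigma_additive.

(* The sigma-finite instance of [mu \x muk] is shadowed in the library by the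
   one for subprobabilities, hence the explicit exhaustion by rectangles. *)
Let mu1_sigma_finite : sigma_finite setT measure_power_succ.
Proof.
have /sigma_finiteP[F [FT ndF Foo]] := sigma_finiteT mu.
have /sigma_finiteP[G [GT ndG Goo]] := sigma_finiteT muk.
exists (fun j => @tuncons T k @^-1` (F j `*` G j)).
  rewrite -preimage_bigcup [X in _ @^-1` X](_ : _ = setT) ?preimage_setT//.
  apply/seteqP; split=> // -[x t] _.
  have [i _ Fx] : (\bigcup_i F i) x by rewrite -FT.
  have [j _ Gt] : (\bigcup_j G j) t by rewrite -GT.
  exists (maxn i j) => //; split=> /=.
  - by move: x Fx; exact/subsetPset/ndF/leq_maxl.
  - by move: t Gt; exact/subsetPset/ndG/leq_maxr.
move=> j; have [mF Fj] := Foo j; have [mG Gj] := Goo j; split.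
  rewrite -[X in measurable X]setTI; apply: measurable_tuncons => //.
  exact: measurableX.
rewrite /measure_power_succ /pushforward -comp_preimage.
rewrite (_ : _ \o _ = id) ?preimage_id; last first.
  by apply/funext => z; exact: tconsK.
by rewrite product_measure1E// lte_mul_pinfty// ge0_fin_numE.
Qed.

HB.instance Definition _ := Measure_isSigmaFinite.Build _ _ _
  measure_power_succ mu1_sigma_finite.

End measure_power_succ.

Fixpoint measure_power (d : measure_display) (T : measurableType d)
    (R : realType) (mu : {sigma_finite_measure set T -> \bar R}) (k : nat) :
    {sigma_finite_measure set (k.-tuple T) -> \bar R} :=
  if k is k'.+1 then measure_power_succ mu (measure_power mu k')
  else \d_([tuple] : 0.-tuple T).

Notation Rn R n := (n.-tuple (measurableTypeR R)).

Definition leb (R : realType) (n : nat) :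
    {sigma_finite_measure set (Rn R n) -> \bar R} :=
  measure_power (@lebesgue_measure R) n.
Arguments leb {R} n.

Section variable_exponent.
Context (R : realType) (n : nat).
Implicit Types (x y : Rn R n) (p q b : Rn R n -> R).

(* Not the distance of the library's normed structure on 'rV[R]_n, which comes
   from the sup norm. *)
Definition euclid_dist x y : R :=
  Num.sqrt (\sum_(i < n) ((tnth x i : R) - tnth y i) ^+ 2).

Definition euclid_norm x : R := Num.sqrt (\sum_(i < n) (tnth x i : R) ^+ 2).

Definition eball x (r : R) : set (Rn R n) := [set y | euclid_dist x y < r].

Definition eball_volume x (r : R) : R := fine (leb n (eball x r)).

(* The sigma-algebra of [Rn R n] is the Borel one; Lebesgue measurability is
   measurability for its completion. *)
Definition lebesgue_measurable (f : Rn R n -> R) : Prop :=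
  exists2 g : Rn R n -> R, measurable_fun setT g & {ae leb n, forall x, f x = g x}.

Definition ess_lower p : \bar R := ess_inf (leb n) (EFin \o p).

Definition ess_upper p : \bar R := ess_sup (leb n) (EFin \o p).

Definition exponent p : Prop := lebesgue_measurable p /\ forall x, 0 < p x.

Definition exponent_P p : Prop :=
  [/\ exponent p, (1 < ess_lower p)%E & (ess_upper p < +oo)%E].

Definition exponent_P0 p : Prop :=
  [/\ exponent p, (0 < ess_lower p)%E & (ess_upper p < +oo)%E].

(* For x = y the right-hand side of the local condition is 0, as [ln 0 = 0]. *)
Definition log_Holder p : Prop :=
  exists C pinf : R, [/\ 0 < C, 0 < pinf,
    forall x y, euclid_dist x y < 2^-1 -> `|p x - p y| <= C / - ln (euclid_dist x y) &
    forall x, `|p x - pinf| <= C / ln (expR 1 + euclid_norm x)].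

(* [f] is extended-real-valued because operators may take infinite values;
   a finite norm forces [f] to be finite almost everywhere. *)
Definition Lvar_norm p (f : Rn R n -> \bar R) : \bar R :=
  ereal_inf [set lambda%:E | lambda in [set lambda : R | 0 < lambda /\
    (\int[leb n]_x (poweR (`|f x| * (lambda^-1)%:E) (p x)) <= 1)%E]].

Definition in_Lvar p (f : Rn R n -> R) : Prop :=
  lebesgue_measurable f /\ (Lvar_norm p (EFin \o f) < +oo)%E.

Definition ball_average b x (r : R) : R :=
  (eball_volume x r)^-1 * fine (\int[leb n]_(y in eball x r) (b y)%:E)%E.

Definition BMO_norm b : \bar R :=
  ereal_sup [set ((eball_volume B.1 B.2)^-1%:E *
      \int[leb n]_(y in eball B.1 B.2) `|b y - ball_average b B.1 B.2|%:E)%E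
    | B in [set B : Rn R n * R | 0 < B.2]].

Definition in_BMO b : Prop :=
  [/\ lebesgue_measurable b,
      forall x r, 0 < r -> (\int[leb n]_(y in eball x r) `|b y|%:E < +oo)%E &
      (BMO_norm b < +oo)%E].

Definition multi_operator (m : nat) : Type :=
  ('I_m -> Rn R n -> R) -> Rn R n -> \bar R.

Definition fractional_maximal (m : nat) (alpha : R) : multi_operator m :=
  fun f x => ereal_sup
    [set ((eball_volume x r `^ (m%:R - alpha / n%:R))^-1%:E *
          \prod_(i < m) \int[leb n]_(y in eball x r) `|f i y|%:E)%E
    | r in [set r : R | 0 < r]].

(* The integrand is 0 on the diagonal y_1 = ... = y_m = x, a null set.  Since
   +oo - oo = -oo in [\bar R], the integral is finite exactly when it converges
   absolutely. *)
Definition fractional_integral (m : nat) (alpha : R) : multi_operator m :=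
  fun f x => (\int[measure_power (leb n) m]_y
    ((\prod_(i < m) f i (tnth y i)) /
     (\sum_(i < m) euclid_dist x (tnth y i)) `^ (m%:R * n%:R - alpha))%:E)%E.

Definition iterated_commutator (m : nat) (T : multi_operator m)
    (b : 'I_m -> Rn R n -> R) : multi_operator m :=
  fun f x => T (fun i y => (b i x - b i y) * f i y) x.

Definition operator_norm (m : nat) (p : 'I_m -> Rn R n -> R) q
    (T : multi_operator m) : \bar R :=
  ereal_inf [set C%:E | C in [set C : R | 0 <= C /\
    forall f : 'I_m -> Rn R n -> R, (forall i, in_Lvar (p i) (f i)) ->
      (Lvar_norm q (T f) <=
        C%:E * \prod_(i < m) Lvar_norm (p i) (EFin \o f i))%E]].

End variable_exponent.

Arguments fractional_maximal {R n}.
Arguments fractional_integral {R n}.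

(* Main.v *)
(* The proof avoids maximal theorems and extrapolation and works with averages
   over half-open cubes.  Both operators are dominated pointwise by the sum over
   dyadic scales h of h^alpha times the product of the averages of
   |b_i(x) - b_i| |f_i| over the cubes of side 3h around x.  By John-Nirenberg
   for cubes, b_i deviates from a cell constant c_i(h, .) with all moments
   bounded, at the cost of a factor 1 + |b_i(x) - c_i(h, x)|.  Let U_h be the
   averages of u = sum_i f_i^(p_i / a) + weight, where a > 1 and a^2 <= p_i, and
   the weight decays polynomially.  By log-Hoelder continuity, taking p_i(x) as
   the exponent at small scales and p_i(oo) at large ones, the product at scale h
   is at most (h^(-n) t_h^(1 + delta))^(1 / q) with t_h = h^n U_h^a bounded.
   The sum over h is comparable to a single near-maximal term, so its q-th power
   is at most the sum of the h^(-n) t_h^(1 + delta / 4), whose integrals add up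
   to a multiple of the integral of u^a; the factors coming from b_i only enter
   through their averages over cells, where the other factor is constant. *)
Require Import Defs.
From HB Require Import structures.
From mathcomp Require Import all_boot all_order all_algebra.
From mathcomp Require Import all_classical all_reals all_analysis.
From mathcomp Require Import ess_sup_inf measurable_realfun.
From mathcomp Require Import zify ring lra.

Set Implicit Arguments.
Unset Strict Implicit.
Unset Printing Implicit Defensive.

Import Order.TTheory GRing.Theory Num.Theory.
Import numFieldNormedType.Exports.

Local Open Scope classical_set_scope.
Local Open Scope ring_scope.

(** * Lower integrals and powers of a measure *)

(** As [q] varies and may fall below 1, neither the triangle inequality nor duality is at hand for
    the sum over scales; comparison with one near-maximal term works for every positive exponent.
    The gain [delta = alpha * q1 / n] stems from h^alpha: together with U_h^(a alpha / n) it is the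
    power alpha / n of h^n U_h^a, a bounded quantity. A quarter of the gain raises the power of the
    averages strictly above [a], so that their integrals can be summed over all scales by cutting u
    at height h^(-n/a). The near-maximal index sits at half the gain, which leaves geometric decay
    on both sides; this decay also pays for the polynomial growth in |j - k| of the factors coming
    from b. The two factors in a^2 <= p_i have separate uses: one turns the modulars of the f_i into
    the integral of u^a, the other leaves an exponent above 1 for the Young inequality that
    separates |b_i(x) - b_i(y)| from f_i(y). At large scales the estimate carries q(oo) but the
    modular carries q(x); the exchange costs one term with the weight, which is integrable and
    constant on unit cells. *)

Section lower_integral.
Local Open Scope ereal_scope.
Context d (T : measurableType d) (R : realType).
Variable mu : {measure set T -> \bar R}.
Implicit Types (f g : T -> \bar R) (D : set T).

Import HBNNSimple.

(* The integral of an arbitrary nonnegative function is its lower integral, so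
   it is monotone without any measurability assumption. *)
Lemma ge0_ae_le_lower_integral f g : (forall x, 0 <= f x) ->
  (forall x, 0 <= g x) -> {ae mu, forall x, f x <= g x} ->
  \int[mu]_x f x <= \int[mu]_x g x.
Proof.
move=> f0 g0 [N [mN muN fgN]].
rewrite !ge0_integralTE//; apply: ge_ereal_sup => _ [h /= hf <-].
(* [h] is set to 0 on the null set [N], the only place where it may exceed [g]; its integral does
   not change. *)
pose h' := proj_nnsfun h (measurableC mN).
apply: ereal_sup_ge; exists (sintegral mu h').
  exists h' => //= x; rewrite mindicE.
  have [xN|xN] := boolP (x \in ~` N); last by rewrite mulr0.
  rewrite mulr1; apply: le_trans (hf x) _; apply: contrapT => fg.
  by move: xN; rewrite inE; apply; exact: fgN.
rewrite -!integralT_nnsfun/=.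
rewrite (ge0_negligible_integral mN _ _ _ muN)//=; last 2 first.
- by apply/measurable_EFinP.
- by move=> x _; rewrite lee_fin.
rewrite setTD integral_mkcond le_eqVlt; apply/orP; left; apply/eqP.
apply: eq_integral => x _; rewrite patchE/= mindicE.
by case: ifPn => xN; rewrite ?mulr1 ?mulr0.
Qed.

Lemma ge0_le_lower_integral f g : (forall x, 0 <= f x) ->
  (forall x, f x <= g x) -> \int[mu]_x f x <= \int[mu]_x g x.
Proof.
move=> f0 fg; apply: ge0_ae_le_lower_integral => //.
  by move=> x; exact: le_trans (fg x).
by apply: aeW.
Qed.

Lemma ge0_ae_le_lower_integral_in D f g : (forall x, 0 <= f x) ->
  (forall x, 0 <= g x) -> {ae mu, forall x, f x <= g x} ->
  \int[mu]_(x in D) f x <= \int[mu]_(x in D) g x.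
Proof.
move=> f0 g0 fg; rewrite (integral_mkcond D) (integral_mkcond D g).
apply: ge0_ae_le_lower_integral => [x|x|].
- by rewrite patchE; case: ifP.
- by rewrite patchE; case: ifP.
- by apply: filterS fg => x; rewrite !patchE; case: ifP.
Qed.

(** Lower integrals need not be additive, so the positive and negative parts are not summed: each is
    at most |f|, and two nonnegative numbers below c differ by at most c. *)
Lemma abse_lower_integral f : `|\int[mu]_x f x| <= \int[mu]_x `|f x|.
Proof.
have fp x : f^\+ x <= `|f x|.
  by rewrite funeposE ge_max abse_ge0 lee_abs.
have fn x : f^\- x <= `|f x|.
  by rewrite funenegE ge_max abse_ge0 -abseN lee_abs.
have key (a b c : \bar R) : 0 <= a -> 0 <= b -> a <= c -> b <= c -> `|a - b| <= c.
  move: c => [c| |]; [|by rewrite !leey|by move=> + _ + _; case: a].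
  move: a b => [a| |] [b| |]//; rewrite ?lee_fin => a0 b0 ac bc.
  by rewrite ler_norml; apply/andP; split; lra.
rewrite integralE; apply: key.
- by apply: integral_ge0 => x _; exact: funepos_ge0.
- by apply: integral_ge0 => x _; exact: funeneg_ge0.
- by apply: ge0_le_lower_integral => // x; exact: funepos_ge0.
- by apply: ge0_le_lower_integral => // x; exact: funeneg_ge0.
Qed.

End lower_integral.

Section measure_power_integral.
Local Open Scope ereal_scope.
Context d (T : measurableType d) (R : realType).
Variable mu : {sigma_finite_measure set T -> \bar R}.

Lemma emeasurable_prod d' (X : measurableType d') (I : Type) (s : seq I)
    (P : pred I) (h : I -> X -> \bar R) :
  (forall i, measurable_fun setT (h i)) ->
  measurable_fun setT (fun x => \prod_(i <- s | P i) h i x).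
Proof.
move=> mh; elim: s => [|i s ih].
  by under eq_fun do rewrite big_nil; exact: measurable_cst.
under eq_fun do rewrite big_cons; case: (P i) => //.
exact: emeasurable_funM.
Qed.

(** Tonelli, one coordinate at a time, along the recursion that defines [measure_power]. *)
Lemma integral_measure_power_prod k (phi : 'I_k -> T -> \bar R) :
  (forall i, measurable_fun setT (phi i)) -> (forall i x, 0 <= phi i x) ->
  \int[measure_power mu k]_t (\prod_(i < k) phi i (tnth t i)) =
  \prod_(i < k) \int[mu]_x phi i x.
Proof.
elim: k phi => [|k ih] phi mphi phi0.
  rewrite big_ord0; under eq_integral do rewrite big_ord0.
  by rewrite integral_cst// mul1e; exact: diracT.
pose F (z : T * k.-tuple T) := phi ord0 z.1 * \prod_(i < k) phi (lift ord0 i) (tnth z.2 i).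
have mP : measurable_fun [set: k.-tuple T]
    (fun t => \prod_(i < k) phi (lift ord0 i) (tnth t i)).
  apply: emeasurable_prod => i; apply: measurableT_comp => //.
  exact: measurable_tnth.
have P0 (t : k.-tuple T) : 0 <= \prod_(i < k) phi (lift ord0 i) (tnth t i).
  by apply: prode_ge0 => i _.
have mF : measurable_fun setT F.
  by apply: emeasurable_funM; [apply: measurableT_comp|apply: measurableT_comp mP _].
rewrite /= /measure_power_succ ge0_integral_pushforward//; first last.
- by move=> y _; apply: prode_ge0 => i _.
- apply: emeasurable_prod => i; apply: measurableT_comp => //.
  exact: measurable_tnth.
rewrite preimage_setT.
transitivity (\int[mu \x measure_power mu k]_z F z).
  apply: eq_integral => -[x t] _; rewrite /F /= big_ord_recl.
  by congr (_ * _); apply: eq_bigr => i _; rewrite tnthS.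
rewrite fubini_tonelli1//; last by move=> z; apply: mule_ge0.
rewrite big_ord_recl -ih// -ge0_integralZr//; last exact: integral_ge0.
by apply: eq_integral => x _; rewrite /fubini_F /F /= ge0_integralZl.
Qed.

Lemma measure_power_box k (I : 'I_k -> set T) : (forall i, measurable (I i)) ->
  measurable [set t : k.-tuple T | forall i, I i (tnth t i)] /\
  measure_power mu k [set t | forall i, I i (tnth t i)] = \prod_(i < k) mu (I i).
Proof.
move=> mI; pose B := [set t : k.-tuple T | forall i, I i (tnth t i)].
have mB : measurable B.
  rewrite (_ : B = \bigcap_(i in [set: 'I_k]) ((@tnth _ T ^~ i) @^-1` I i)).
    apply: fin_bigcap_measurable => // i _.
    by rewrite -[X in measurable X]setTI; exact: measurable_tnth.
  by apply/seteqP; split=> [t Bt i _|t Bt i]; exact: Bt.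
split=> //; rewrite -/B -[LHS]mul1e -integral_cst//.
have -> : \int[measure_power mu k]_(x in B) cst 1 x =
    \int[measure_power mu k]_x (\1_B x)%:E.
  rewrite integral_mkcond; apply: eq_integral => t _.
  by rewrite patchE indicE; case: ifP.
transitivity (\int[measure_power mu k]_t (\prod_(i < k) (\1_(I i) (tnth t i))%:E)).
  apply: eq_integral => t _; rewrite prodEFin; congr EFin.
  have [tB|tB] := pselect (B t).
    by rewrite indicE mem_set//= big1// => i _; rewrite indicE mem_set//; exact: (tB i).
  have /existsNP[i Ii] := tB.
  rewrite indicE memNset//= (bigD1 i)//= indicE memNset//=.
  by rewrite mul0r.
rewrite (@integral_measure_power_prod _ (fun i x => (\1_(I i) x)%:E)).
- by apply: eq_bigr => i _; rewrite integral_indic// setIT.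
- by move=> i; exact/measurable_EFinP/measurable_indic.
- by move=> i x; rewrite lee_fin.
Qed.

(** The exceptional set is covered by k boxes, each with one null side and all other sides full;
    such a box is null because 0 * +oo = 0. *)
Lemma ae_measure_power k (P : T -> Prop) : {ae mu, forall x, P x} ->
  {ae measure_power mu k, forall t, forall i, P (tnth t i)}.
Proof.
move=> [N [mN muN PN]].
pose I (i j : 'I_k) : set T := if j == i then N else setT.
have mI i j : measurable (I i j) by rewrite /I; case: ifP.
pose A i := [set t : k.-tuple T | forall j, I i j (tnth t j)].
have mA i : measurable (A i) by have [] := measure_power_box (mI i).
have A0 i : measure_power mu k (A i) = 0.
  have [_ ->] := measure_power_box (mI i).
  by rewrite (bigD1 i)//= /I eqxx muN mul0e.
apply: (@filter_forall _ _ (fun i t => P (tnth t i))) => i.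
exists (A i); split=> //= t Pt j; rewrite /I; case: eqP => // ->.
exact: PN.
Qed.

End measure_power_integral.

(** * Averages over cubes *)

Section cubes.
Context {R : realType} {n : nat}.
Implicit Types (x y : Rn R n) (h r : R) (c : nat).

Definition cell_index h x (i : 'I_n) : int := Num.floor ((tnth x i : R) / h).

(** For c = 0 this is the half-open cell of the grid of mesh h that contains x, for c = 1 the block
    of 3^n cells around it. It depends on x only through the cell of x, so averages over it are
    constant on cells. *)
Definition cube c h x : set (Rn R n) :=
  [set y | forall i, `|cell_index h y i - cell_index h x i| <= c%:Z].

Lemma cubexx c h x : cube c h x x.
Proof. by move=> i; rewrite subrr normr0. Qed.

Lemma cube_sym c h x y : cube c h x y -> cube c h y x.
Proof. by move=> xy i; rewrite distrC. Qed.

Lemma cube0P h x y : cube 0 h x y <-> cell_index h y = cell_index h x.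
Proof.
split=> [xy|xy i]; last by rewrite xy subrr normr0.
by apply/funext => i; have := xy i; lia.
Qed.

Lemma cube0_trans c h x y z : cube 0 h x y -> cube c h y z -> cube c h x z.
Proof. by move=> /cube0P xy yz i; have := yz i; rewrite xy. Qed.

Lemma cube0_eq c h x y : cube 0 h x y -> cube c h x = cube c h y.
Proof. by move=> /cube0P xy; rewrite /cube xy. Qed.

Lemma cube01 h x : cube 0 h x `<=` cube 1 h x.
Proof. by move=> y xy i; have := xy i; lia. Qed.

(** The grids are nested: with a = floor(t / 2h), floor(t / h) is 2a or 2a + 1, so cells of side h
    that coincide or touch lie in cells of side 2h that coincide or touch. *)
Lemma cube_double c h x : 0 < h -> (c <= 1)%N -> cube c h x `<=` cube c (2 * h) x.
Proof.
move=> h0 c1 y xy i.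
have A (t : R) : let a := Num.floor (t / (2 * h)) in
    a * 2 <= Num.floor (t / h) <= a * 2 + 1.
  move=> a.
  have -> : t / h = t / (2 * h) * 2 by field; lra.
  set s := t / (2 * h); have /andP[s1 s2] : a%:~R <= s < (a + 1)%:~R.
    by rewrite floor_le floorD1_gt.
  apply/andP; split; first by rewrite floor_ge_int rmorphM/= ler_wpM2r.
  rewrite -ltzD1 floor_lt_int (_ : a * 2 + 1 + 1 = (a + 1) * 2); last by lia.
  by rewrite rmorphM/= ltr_pM2r.
have := A (tnth x i); have := A (tnth y i); have := xy i.
rewrite /cell_index; lia.
Qed.

Let slab c h (z : int) : set R := [set t | `|Num.floor (t / h) - z| <= c%:Z].

Let slabE c h z : 0 < h ->
  slab c h z = `[(z - c%:Z)%:~R * h, (z + c%:Z + 1)%:~R * h[%classic.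
Proof.
move=> h0; apply/seteqP; split=> t; rewrite /slab/= in_itv/=.
  rewrite ler_norml => /andP[t1 t2]; rewrite -ler_pdivlMr// -ltr_pdivrMr//.
  rewrite -floor_ge_int -floor_lt_int; move: (Num.floor _) t1 t2; clear; lia.
rewrite -ler_pdivlMr// -ltr_pdivrMr// -floor_ge_int -floor_lt_int.
by move: (Num.floor _); clear; lia.
Qed.

Lemma measurable_cube c h x : 0 < h -> measurable (cube c h x).
Proof.
move=> h0; have [] // := @measure_power_box _ (measurableTypeR R) R lebesgue_measure n
  (fun i => slab c h (cell_index h x i)).
by move=> i; rewrite slabE//; exact: measurable_itv.
Qed.

Lemma leb_cube c h x : 0 < h -> leb n (cube c h x) = (((2 * c + 1)%:R * h) ^+ n)%:E.
Proof.
move=> h0; have [] := @measure_power_box _ (measurableTypeR R) R lebesgue_measure n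
  (fun i => slab c h (cell_index h x i)).
  by move=> i; rewrite slabE//; exact: measurable_itv.
move=> _ E; rewrite [LHS]E.
have slab_measure i : lebesgue_measure (slab c h (cell_index h x i)) =
    ((2 * c + 1)%:R * h)%:E.
  rewrite slabE// lebesgue_measure_itv/= lte_fin ltr_pM2r// ltr_int.
  rewrite ifT; last by lia.
  rewrite -EFinB -mulrBl -intrB; congr EFin; congr ( _ * _).
  by rewrite (_ : _ - _ = (2 * c + 1)%N%:Z)//; lia.
transitivity (\prod_(i < n) ((2 * c + 1)%:R * h)%:E)%E.
  by apply: eq_bigr => i _; rewrite -(slab_measure i).
by rewrite prodEFin prodr_const card_ord.
Qed.

Lemma measurable_cell_index h i : 0 < h ->
  measurable_fun setT (fun x => (cell_index h x i)%:~R : R).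
Proof.
move=> h0; apply: (@measurableT_comp _ _ _ _ _ _
  (fun t : R => (Num.floor (t / h))%:~R : R) _ (fun x => tnth x i)); last first.
  exact: measurable_tnth.
apply: nondecreasing_measurable => // s t st; rewrite ler_int.
by apply: le_floor; rewrite ler_pM2r ?invr_gt0.
Qed.

Lemma measurable_cube_graph c h : 0 < h ->
  measurable [set z : Rn R n * Rn R n | cube c h z.1 z.2].
Proof.
move=> h0; rewrite (_ : [set _ | _] = \bigcap_(i in [set: 'I_n])
    ((fun z : Rn R n * Rn R n => `|(cell_index h z.2 i)%:~R - (cell_index h z.1 i)%:~R| : R)
      @^-1` `]-oo, c%:R])).
  apply: fin_bigcap_measurable => // i _; rewrite -[X in measurable X]setTI.
  have : measurable_fun setT (fun z : Rn R n * Rn R n =>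
      `|(cell_index h z.2 i)%:~R - (cell_index h z.1 i)%:~R| : R).
    apply: measurableT_comp => //; apply: measurable_funB.
      exact: (measurableT_comp (measurable_cell_index i h0)).
    exact: (measurableT_comp (measurable_cell_index i h0)).
  by apply => //; exact: measurable_itv.
apply/seteqP; split=> -[x y] /= xy i.
  by move=> _; rewrite /= in_itv/= -intrB -intr_norm -[c%:R]/(c%:Z%:~R) ler_int; exact: xy.
by have := xy i I; rewrite /= in_itv/= -intrB -intr_norm -[c%:R]/(c%:Z%:~R) ler_int.
Qed.

End cubes.

Section averages.
Local Open Scope ereal_scope.
Context {R : realType} {n : nat}.
Implicit Types (x y : Rn R n) (h r : R) (c : nat) (f g w : Rn R n -> \bar R).

(* For c = 1 this is [3 ^ n] times the average over the cube. *)
Definition cube_average c h g x : \bar R :=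
  (h ^- n)%:E * \int[leb n]_(y in cube c h x) g y.

Definition cube_constant h w := forall x y, cube 0 h x y -> w x = w y.

Lemma cube_average_ge0 c h g x : (0 < h)%R -> (forall y, 0 <= g y) ->
  0 <= cube_average c h g x.
Proof.
move=> h0 g0; apply: mule_ge0; first by rewrite lee_fin invr_ge0 exprn_ge0// ltW.
by apply: integral_ge0.
Qed.

Lemma ae_le_cube_average c h f g x : (0 < h)%R -> (forall y, 0 <= f y) ->
  (forall y, 0 <= g y) -> {ae leb n, forall y, f y <= g y} ->
  cube_average c h f x <= cube_average c h g x.
Proof.
move=> h0 f0 g0 fg; apply: lee_wpmul2l.
  by rewrite lee_fin invr_ge0 exprn_ge0// ltW.
exact: ge0_ae_le_lower_integral_in.
Qed.

Lemma le_cube_average c h f g x : (0 < h)%R -> (forall y, 0 <= f y) ->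
  (forall y, 0 <= g y) -> (forall y, cube c h x y -> f y <= g y) ->
  cube_average c h f x <= cube_average c h g x.
Proof.
move=> h0 f0 g0 fg; apply: lee_wpmul2l.
  by rewrite lee_fin invr_ge0 exprn_ge0// ltW.
rewrite (integral_mkcond (cube c h x)) (integral_mkcond (cube c h x) g).
apply: ge0_le_lower_integral => y; rewrite !patchE; case: ifPn => //.
by rewrite inE; exact: fg.
Qed.

Lemma cube_average_cst c h (a : \bar R) x : (0 < h)%R ->
  cube_average c h (cst a) x = (2 * c + 1)%:R%:E ^+ n * a.
Proof.
move=> h0; rewrite /cube_average; set I := integral _ _ _.
have -> : I = a * (((2 * c + 1)%:R * h) ^+ n)%:E.
  by rewrite /I integral_cst; [congr (_ * _); exact: leb_cube|exact: measurable_cube].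
rewrite muleCA -EFinM muleC; congr (_ * _).
by rewrite exprMn mulrCA mulVf ?mulr1 ?EFin_expe// expf_neq0// gt_eqF.
Qed.

Lemma cube_average_constant c h g : cube_constant h (cube_average c h g).
Proof. by move=> x y xy; rewrite /cube_average (cube0_eq c xy). Qed.

Let kernel c h (z : Rn R n * Rn R n) : \bar R :=
  (h ^- n)%:E * (\1_[set z : Rn R n * Rn R n | cube c h z.1 z.2] z)%:E.

Let measurable_kernel c h : (0 < h)%R -> measurable_fun setT (kernel c h).
Proof.
move=> h0; apply: emeasurable_funM => //.
apply/measurable_EFinP; apply: measurable_indic; exact: measurable_cube_graph.
Qed.

Let kernel_ge0 c h z : (0 < h)%R -> 0 <= kernel c h z.
Proof. by move=> h0; rewrite mule_ge0 ?lee_fin// invr_ge0 exprn_ge0// ltW. Qed.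

Let cube_averageE c h g x : (0 < h)%R -> measurable_fun setT g -> (forall y, 0 <= g y) ->
  cube_average c h g x = \int[leb n]_y (kernel c h (x, y) * g y).
Proof.
move=> h0 mg g0; rewrite /cube_average -ge0_integralZl.
- rewrite integral_mkcond; apply: eq_integral => y _; rewrite patchE /kernel indicE.
  have [xy|xy] := boolP (y \in _).
    by rewrite mem_set ?mule1//; rewrite inE in xy.
  by rewrite memNset ?mule0 ?mul0e//= => xy'; move: xy; rewrite mem_set.
- exact: measurable_cube.
- exact: measurable_funTS.
- by move=> y _.
- by rewrite lee_fin invr_ge0 exprn_ge0// ltW.
Qed.

Lemma measurable_cube_average c h g : (0 < h)%R -> measurable_fun setT g ->
  (forall y, 0 <= g y) -> measurable_fun setT (cube_average c h g).
Proof.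
move=> h0 mg g0; rewrite (_ : cube_average c h g =
  fun x => \int[leb n]_y (kernel c h (x, y) * g y)); last first.
  by apply/funext => x; rewrite cube_averageE.
apply: (@measurable_fun_fubini_tonelli_F _ _ _ _ _ (leb n) (fun z => kernel c h z * g z.2)).
  by apply: emeasurable_funM; [exact: measurable_kernel|exact: measurableT_comp].
by move=> z; rewrite mule_ge0 ?kernel_ge0.
Qed.

(** Averaging is an integral operator whose kernel is symmetric by [cube_sym]; the rest is
    Tonelli. *)
Lemma cube_average_adjoint c h f g : (0 < h)%R -> measurable_fun setT f ->
  measurable_fun setT g -> (forall y, 0 <= f y) -> (forall y, 0 <= g y) ->
  \int[leb n]_x (cube_average c h f x * g x) =
  \int[leb n]_x (f x * cube_average c h g x).
Proof.
move=> h0 mf mg f0 g0.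
pose F (z : Rn R n * Rn R n) := kernel c h z * f z.2 * g z.1.
have mF : measurable_fun setT F.
  by apply: emeasurable_funM; [apply: emeasurable_funM; [exact: measurable_kernel|]|];
    exact: measurableT_comp.
have F0 z : 0 <= F z by apply: mule_ge0 => //; apply: mule_ge0 => //; exact: kernel_ge0.
transitivity (\int[leb n]_x \int[leb n]_y F (x, y)).
  apply: eq_integral => x _; rewrite cube_averageE// -ge0_integralZr//.
  - apply: emeasurable_funM => //.
    exact: measurableT_comp (measurable_kernel c h0) _.
  - by move=> y _; rewrite mule_ge0 ?kernel_ge0.
rewrite (@fubini_tonelli _ _ _ _ _ (leb n) (leb n) F mF F0).
apply: eq_integral => y _; rewrite cube_averageE// -ge0_integralZl//.
- apply: eq_integral => x _; rewrite /F /kernel/=.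
  rewrite [X in _ = _ * (_ * X%:E * _)](_ : _ = \1_[set z | cube c h z.1 z.2] (x, y)).
    by rewrite [X in X * _ = _]muleC -muleA.
  by rewrite !indicE; congr ((nat_of_bool _)%:R); apply/idP/idP; rewrite !inE => /cube_sym.
- apply: emeasurable_funM => //.
  exact: measurableT_comp (measurable_kernel c h0) _.
- by move=> x _; rewrite mule_ge0 ?kernel_ge0.
Qed.

End averages.

Section averages_theory.
Local Open Scope ereal_scope.
Context {R : realType} {n : nat}.
Implicit Types (x y : Rn R n) (h r : R) (c : nat) (f g w : Rn R n -> \bar R).

Lemma expn_inv_ge0 h k : (0 < h)%R -> 0 <= (h ^- k)%:E.
Proof. by move=> h0; rewrite lee_fin invr_ge0 exprn_ge0// ltW. Qed.

Lemma ge0_le_integral_subset (A B : set (Rn R n)) f g : A `<=` B ->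
  (forall y, 0 <= f y) -> (forall y, 0 <= g y) -> (forall y, A y -> f y <= g y) ->
  \int[leb n]_(y in A) f y <= \int[leb n]_(y in B) g y.
Proof.
move=> AB f0 g0 fg; rewrite (integral_mkcond A) (integral_mkcond B).
apply: ge0_le_lower_integral => y; rewrite !patchE; first by case: ifP.
case: ifPn => [|_]; last by case: ifP.
by rewrite inE => Ay; rewrite mem_set ?fg//; exact: AB.
Qed.

Lemma cube_average01 h g x : (0 < h)%R -> (forall y, 0 <= g y) ->
  cube_average 0 h g x <= cube_average 1 h g x.
Proof.
move=> h0 g0; apply: lee_wpmul2l; first exact: expn_inv_ge0.
by apply: ge0_le_integral_subset => //; exact: cube01.
Qed.

Lemma cube_average_double c h g x : (0 < h)%R -> (c <= 1)%N -> (forall y, 0 <= g y) ->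
  cube_average c h g x <= (2 ^+ n)%:E * cube_average c (2 * h) g x.
Proof.
move=> h0 c1 g0; rewrite /cube_average muleA -EFinM exprMn invfM mulrA.
rewrite divff ?expf_neq0// mul1r; apply: lee_wpmul2l; first exact: expn_inv_ge0.
by apply: ge0_le_integral_subset => //; exact: cube_double.
Qed.

Lemma cube_averageD c h f g x : (0 < h)%R -> measurable_fun setT f ->
  measurable_fun setT g -> (forall y, 0 <= f y) -> (forall y, 0 <= g y) ->
  cube_average c h (fun y => f y + g y) x =
  cube_average c h f x + cube_average c h g x.
Proof.
move=> h0 mf mg f0 g0; rewrite /cube_average ge0_integralD//.
- by rewrite ge0_muleDr//; apply: integral_ge0.
- exact: measurable_cube.
- exact: measurable_funTS.
- exact: measurable_funTS.
Qed.

Lemma cube_averageZ c h (k : \bar R) g x : (0 < h)%R -> measurable_fun setT g ->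
  (forall y, 0 <= g y) -> 0 <= k ->
  cube_average c h (fun y => k * g y) x = k * cube_average c h g x.
Proof.
move=> h0 mg g0 k0; rewrite /cube_average ge0_integralZl//.
- by rewrite muleCA.
- exact: measurable_cube.
- exact: measurable_funTS.
Qed.

Lemma cube_average0_constant h w x : (0 < h)%R -> cube_constant h w ->
  cube_average 0 h w x = w x.
Proof.
move=> h0 cw; transitivity (cube_average 0 h (cst (w x)) x).
  congr (_ * _); apply: eq_integral => y; rewrite inE => xy.
  exact/esym/cw.
by rewrite cube_average_cst// -EFin_expe expr1n mul1e.
Qed.

(** A function constant on cells is its own cell average, and self-adjointness moves the average
    onto [g]. This is the defining property of the conditional expectation on the grid. *)
Lemma integral_cube_constant h w g : (0 < h)%R -> measurable_fun setT w ->
  measurable_fun setT g -> (forall y, 0 <= w y) -> (forall y, 0 <= g y) ->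
  cube_constant h w ->
  \int[leb n]_x (w x * g x) = \int[leb n]_x (w x * cube_average 0 h g x).
Proof.
move=> h0 mw mg w0 g0 cw; rewrite -cube_average_adjoint//.
by apply: eq_integral => x _; rewrite cube_average0_constant.
Qed.

Lemma integral_cube_constant_set h (A : set (Rn R n)) g : (0 < h)%R ->
  measurable A -> measurable_fun setT g -> (forall y, 0 <= g y) ->
  (forall x y, cube 0 h x y -> A x -> A y) ->
  \int[leb n]_(x in A) g x = \int[leb n]_(x in A) cube_average 0 h g x.
Proof.
move=> h0 mA mg g0 cA.
have E k : \int[leb n]_(x in A) k x = \int[leb n]_x ((\1_A x)%:E * k x).
  rewrite integral_mkcond; apply: eq_integral => x _; rewrite patchE indicE.
  by case: ifP => _; rewrite ?mul1e ?mul0e.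
rewrite !E; apply: integral_cube_constant => //.
- by apply/measurable_EFinP/measurable_indic.
- move=> x y xy; rewrite !indicE; congr ((nat_of_bool _)%:R%:E).
  by apply/idP/idP; rewrite !inE; apply: cA => //; exact: cube_sym.
Qed.

(** The block of side 3h is a union of cells, so on it [g] may be replaced by its cell averages. *)
Lemma cube_average1_le h g (B : \bar R) x : (0 < h)%R -> measurable_fun setT g ->
  (forall y, 0 <= g y) -> 0 <= B ->
  (forall y, cube 1 h x y -> cube_average 0 h g y <= B) ->
  cube_average 1 h g x <= (3 ^+ n)%:E * B.
Proof.
move=> h0 mg g0 B0 gB.
rewrite -[X in _ <= X * _]/((2 * 1 + 1)%:R ^+ n)%:E EFin_expe -(@cube_average_cst _ _ 1 h B x h0).
apply: lee_wpmul2l; first exact: expn_inv_ge0.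
rewrite (integral_cube_constant_set h0)//.
- apply: ge0_le_integral_subset => // y; first exact: cube_average_ge0.
- exact: measurable_cube.
- by move=> y z yz xy; apply/cube_sym/(cube0_trans (cube_sym yz))/cube_sym.
Qed.

End averages_theory.

(** * Approximation of measurable sets by unions of dyadic cells *)

Section density.
Local Open Scope ereal_scope.
Context {R : realType} {n : nat}.
Variables (h : R) (h0 : (0 < h)%R).
Implicit Types (x y : Rn R n) (A B Q : set (Rn R n)).

Let s (j : nat) : R := (h / 2 ^+ j)%R.

Let s0 j : (0 < s j)%R. Proof. by rewrite divr_gt0// exprn_gt0. Qed.

Let sS j : (2 * s j.+1 = s j)%R.
Proof. by rewrite /s exprS; field; rewrite expf_neq0. Qed.

Lemma cube0_halve i j x : (i <= j)%N -> cube 0 (s j) x `<=` cube 0 (s i) x.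
Proof.
move=> ij; rewrite -(subnK ij); elim: (j - i)%N => // k ih y; rewrite addSn => xy.
by apply: ih; rewrite -sS; exact: cube_double.
Qed.

Let level j A := forall x y, cube 0 (s j) x y -> A x -> A y.

Let level_le i j A : (i <= j)%N -> level i A -> level j A.
Proof. by move=> ij lA x y /(cube0_halve ij); exact: lA. Qed.

Variables (Q : set (Rn R n)) (mQ : measurable Q) (Qfin : leb n Q < +oo).

(** The sets that can be approximated inside [Q] by unions of dyadic cells form a sigma-algebra
    containing the generators of the Borel one, so every measurable set is among them. *)
Let approx A := measurable A /\ forall e : R, (0 < e)%R -> exists j B,
  [/\ measurable B, level j B & leb n (Q `&` (A `+` B)) <= e%:E].

Let approx_level j B : measurable B -> level j B -> approx B.
Proof.
move=> mB lB; split=> // e e0; exists j, B; split=> //.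
by rewrite setYK setI0 measure0 lee_fin ltW.
Qed.

Let approxC A : approx A -> approx (~` A).
Proof.
move=> [mA aA]; split=> [|e e0]; first exact: measurableC.
have [j [B [mB lB AB]]] := aA _ e0; exists j, (~` B); split=> //.
- exact: measurableC.
- move=> x y xy; apply: contra_not; apply: lB; exact: cube_sym.
- suff -> : ~` A `+` ~` B = A `+` B by [].
  by rewrite !setY_def !setDE !setCK setUC; congr (_ `|` _); rewrite setIC.
Qed.

Let leb_finQ A : measurable A -> leb n (Q `&` A) < +oo.
Proof.
move=> mA; apply: le_lt_trans Qfin; apply: le_measure; rewrite ?inE//.
exact: measurableI.
Qed.

Let approxU A B : approx A -> approx B -> approx (A `|` B).
Proof.
move=> [mA aA] [mB aB]; split=> [|e e0]; first exact: measurableU.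
have e20 : (0 < e / 2)%R by rewrite divr_gt0.
have [i [A' [mA' lA' AA']]] := aA _ e20; have [j [B' [mB' lB' BB']]] := aB _ e20.
exists (maxn i j), (A' `|` B'); split.
- exact: measurableU.
- by move=> x y xy [] => [/(level_le (leq_maxl i j) lA' xy)|/(level_le (leq_maxr i j) lB' xy)];
    [left|right].
have mY C D : measurable C -> measurable D -> measurable (Q `&` (C `+` D)).
  by move=> mC mD; rewrite setY_def; apply: measurableI => //;
    apply: measurableU; exact: measurableD.
apply: (@le_trans _ _ (leb n (Q `&` (A `+` A') `|` Q `&` (B `+` B')))).
  apply: le_measure; rewrite ?inE; [|apply: measurableU|]; [|exact: mY..|].
    by apply: mY; exact: measurableU.
  rewrite -setIUr; apply: setIS; rewrite !setY_def => x.
  by have [] := pselect (A x); have [] := pselect (A' x); have [] := pselect (B x);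
    have [] := pselect (B' x); rewrite /setU /setD /=; tauto.
apply: (le_trans (measureU2 _ _ _)); [exact: mY..|].
by rewrite [in leRHS](splitr e) EFinD leeD.
Qed.

(** What the first k sets leave of the union decreases to the empty set and has finite measure
    inside [Q], hence falls below e / 2; the finite union is approximated within the other half. *)
Let approx_bigcup (F : (set (Rn R n))^nat) : (forall i, approx (F i)) ->
  approx (\bigcup_i F i).
Proof.
move=> aF; have mF i : measurable (F i) by have [] := aF i.
split=> [|e e0]; first exact: bigcup_measurable.
have aU k : approx (\big[setU/set0]_(i < k) F i).
  elim: k => [|k ih]; last by rewrite big_ord_recr; exact: approxU.
  by rewrite big_ord0; apply: (@approx_level 0%N).
pose G k := Q `&` (\bigcup_i F i `\` \big[setU/set0]_(i < k) F i).
have mG k : measurable (G k).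
  apply: measurableI => //; apply: measurableD; first exact: bigcup_measurable.
  by have [] := aU k.
have G0 : leb n \o G @ \oo --> leb n (\bigcap_k G k).
  apply: nonincreasing_cvg_mu => //.
  - by rewrite /G; apply: leb_finQ; apply: measurableD; [exact: bigcup_measurable|have [] := aU 0%N].
  - exact: bigcap_measurable.
  - move=> i j ij; apply/subsetPset; apply: setIS; apply: setDS.
    exact: subset_bigsetU.
have GE : \bigcap_k G k = set0.
  rewrite -subset0 => x Gx; have [_ [[i _ Fi] _]] := Gx 0%N I.
  have [_ [_]] := Gx i.+1 I; apply; rewrite -bigcup_mkord.
  by exists i => //=.
rewrite GE measure0 in G0.
have e20 : (0 < e / 2)%R by rewrite divr_gt0.
have /G0[k _ kG] : nbhs (0 : \bar R) [set y | y < (e / 2)%:E].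
  by apply: open_ereal_lt'; rewrite lte_fin.
have [_ /(_ _ e20)[j [B [mB lB UB]]]] := aU k.
exists j, B; split=> //.
have mU : measurable (\big[setU/set0]_(i < k) F i) by have [] := aU k.
have mY C D : measurable C -> measurable D -> measurable (Q `&` (C `+` D)).
  by move=> mC mD; rewrite setY_def; apply: measurableI => //;
    apply: measurableU; exact: measurableD.
apply: (@le_trans _ _ (leb n (G k `|` Q `&` (\big[setU/set0]_(i < k) F i `+` B)))).
  apply: le_measure; rewrite ?inE; [|apply: measurableU|]; [|exact: mG|exact: mY|].
    by apply: mY => //; exact: bigcup_measurable.
  rewrite -setIUr; apply: setIS; rewrite !setY_def => x.
  have kU : \big[setU/set0]_(i < k) F i `<=` \bigcup_i F i.
    by rewrite -bigcup_mkord; apply: bigcup_sub => i _; exact: bigcup_sup.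
  have := kU x; rewrite /setU /setD /=.
  by have [] := pselect ((\bigcup_i F i) x); have [] := pselect (B x);
    have [] := pselect ((\big[setU/set0]_(i < k) F i) x); tauto.
apply: (le_trans (measureU2 _ _ _)); [exact: mG|exact: mY|].
by rewrite [in leRHS](splitr e) EFinD leeD// ltW//; apply: (kG k) => /=.
Qed.

Let approx_measurable A : measurable A -> approx A.
Proof.
move=> mA; apply: (mA approx); split.
  split; first by apply: (@approx_level 0%N).
  - by move=> B; rewrite setTD; exact: approxC.
  - exact: approx_bigcup.
(* The generators are coordinate preimages of Borel sets, and the Borel sets are in turn generated
   by the rays ]-oo, a[. *)
move=> B; rewrite -bigcup_seq => -[/= i _ [C mC <-]]; rewrite setTI.
rewrite RGenInftyO.measurableE in mC; move: mC.
move=> /(_ (fun C => approx ((@tnth _ _ ^~ i) @^-1` C))); apply; split.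
  split.
  - by rewrite preimage_set0; apply: (@approx_level 0%N).
  - by move=> D; rewrite setTD preimage_setC; exact: approxC.
  - by move=> F aF; rewrite preimage_bigcup; exact: approx_bigcup.
move=> D [a ->].
(* [L j] collects the cells of side [s j] whose upper end in coordinate i is at most a; half-open
   cells stay strictly below that end. *)
pose L j : set (Rn R n) := [set y | (cell_index (s j) y i + 1)%:~R * s j <= a]%R.
rewrite (_ : _ @^-1` _ = \bigcup_j L j).
  apply: approx_bigcup => j; apply: (@approx_level j).
    rewrite -[L j]setTI; have : measurable_fun setT
        (fun y => ((cell_index (s j) y i)%:~R + 1) * s j : R)%R.
      apply: measurable_funM => //; apply: measurable_funD => //.
      exact: measurable_cell_index.
    move=> /(_ measurableT _ (measurable_itv `]-oo, a])).
    congr measurable; congr (_ `&` _); apply/funext => y.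
    by rewrite /L/= in_itv/= intrD.
  by move=> x y /cube0P xy; rewrite /L/= xy.
apply/seteqP; split=> [y/=|y [j _]].
  rewrite in_itv/= => ya.
  have d0 : (0 < a - tnth y i)%R by rewrite subr_gt0.
  (* Since 2^j > j > h / (a - y_i), a cell of this generation is no longer than the gap between y_i
     and a. *)
  exists (Num.truncn (h / (a - tnth y i))).+1 => //; rewrite /L/=.
  set j := _.+1; have sj : (s j <= a - tnth y i)%R.
    rewrite /s ler_pdivrMr ?exprn_gt0// mulrC -ler_pdivrMr//.
    apply: le_trans (ltW (truncnS_gt _)) _; rewrite -/j -natrX ler_nat.
    exact/ltnW/ltn_expl.
  rewrite intrD mulrDl mul1r -lerBrDr; apply: (@le_trans _ _ (tnth y i)).
    by rewrite -ler_pdivlMr// floor_le.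
  by rewrite lerBrDr -lerBrDl.
rewrite /L/= in_itv/=; apply: lt_le_trans.
by rewrite -ltr_pdivrMr// floorD1_gt.
Qed.

Lemma measurable_cube_approx A (e : R) : measurable A -> (0 < e)%R ->
  exists j B, [/\ measurable B,
    forall x y, cube 0 (h / 2 ^+ j) x y -> B x -> B y &
    leb n (Q `&` (A `+` B)) <= e%:E].
Proof. by move=> /approx_measurable[_ +]; exact. Qed.

End density.

(** * Differentiation along dyadic cells *)

Section differentiation.
Local Open Scope ereal_scope.
Context {R : realType} {n : nat}.
Variables (h : R) (h0 : (0 < h)%R) (x0 : Rn R n).
Implicit Types (x y : Rn R n) (A B E : set (Rn R n)).

Let s (j : nat) : R := (h / 2 ^+ j)%R.

Let s0 j : (0 < s j)%R. Proof. by rewrite divr_gt0// exprn_gt0. Qed.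

Let Q := cube 0 h x0.

Let mQ : measurable Q. Proof. exact: measurable_cube. Qed.

Let Qfin : leb n Q < +oo. Proof. by rewrite leb_cube// ltry. Qed.

Let Q_level j x y : cube 0 (s j) x y -> Q x -> Q y.
Proof.
move=> xy Qx; apply: (cube0_trans Qx).
by have := @cube0_halve _ _ _ h0 0 j x (leq0n j) y xy; rewrite expr0 divr1.
Qed.

(** Approximation takes the place of a covering theorem. If the averages of 1_E were at most 1 - eta
    on E, a union B of cells that differs from E by at most e would give |E| <= (1 - eta) (|E| + e)
    + e, which fails for e = eta |E| / 4. *)
Lemma cube_density_point E (eta : R) : measurable E -> E `<=` Q ->
  (0 < eta < 1)%R -> 0 < leb n E ->
  exists y j, E y /\ (1 - eta)%:E < cube_average 0 (s j) (EFin \o \1_E) y.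
Proof.
move=> mE EQ /andP[eta0 eta1] E0; apply: contrapT => noE.
have Efin : leb n E \is a fin_num.
  by rewrite ge0_fin_numE//; apply: le_lt_trans Qfin; apply: le_measure; rewrite ?inE.
pose M := fine (leb n E); have ME : leb n E = M%:E by rewrite fineK.
have M0 : (0 < M)%R by rewrite -lte_fin -ME.
have mE1 : measurable_fun setT (EFin \o \1_E : Rn R n -> \bar R).
  by apply/measurable_EFinP; exact: measurable_indic.
have E1_ge0 y : 0 <= (EFin \o \1_E : Rn R n -> \bar R) y by rewrite /= lee_fin.
(* A cell that misses [E] has average 0, so the bound holds everywhere and not only on [E]. *)
have avgE j y : cube_average 0 (s j) (EFin \o \1_E) y <= (1 - eta)%:E.
  have [[z [yz Ez]]|yE] := pselect (exists z, cube 0 (s j) y z /\ E z).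
    rewrite (cube_average_constant 0 (EFin \o \1_E) yz) leNgt; apply/negP => zE.
    by apply: noE; exists z, j.
  rewrite /cube_average integral0_eq ?mule0 ?lee_fin ?subr_ge0 1?ltW// => z yz.
  by rewrite /= indicE memNset// => Ez; apply: yE; exists z.
have e0 : (0 < eta * M / 4)%R by rewrite divr_gt0// mulr_gt0.
have [j [B [mB lB]]] := measurable_cube_approx h0 mQ Qfin mE e0.
set e := (eta * M / 4)%R => EB.
have mQB : measurable (Q `&` B) by exact: measurableI.
have mEB : measurable (E `&` B) by exact: measurableI.
have mY : measurable (Q `&` (E `+` B)).
  by rewrite setY_def; apply: measurableI => //; apply: measurableU; exact: measurableD.
have avgB : leb n (E `&` B) <= (1 - eta)%:E * leb n (Q `&` B).
  have -> : leb n (E `&` B) = \int[leb n]_(x in Q `&` B) (\1_E x)%:E.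
    by rewrite integral_indic// setIA (setIidl EQ).
  rewrite (integral_cube_constant_set (s0 j))//; last first.
    by move=> x y xy [Qx Bx]; split; [exact: Q_level xy _|exact: lB xy _].
  rewrite -integral_cst//; apply: ge0_le_integral_subset => // y.
  - exact: cube_average_ge0.
  - by rewrite lee_fin subr_ge0 ltW.
have QB : leb n (Q `&` B) <= (M + e)%:E.
  apply: (@le_trans _ _ (leb n (E `|` Q `&` (E `+` B)))).
    apply: le_measure; rewrite ?inE//; first exact: measurableU.
    move=> y [Qy By]; have [Ey|Ey] := pselect (E y); [by left|right].
    by rewrite setY_def; split=> //; right.
  by apply: (le_trans (measureU2 _ _ _)) => //; rewrite EFinD; apply: leeD => //; rewrite -ME.
have EM : M%:E <= leb n (E `&` B) + e%:E.
  rewrite -ME; apply: (@le_trans _ _ (leb n (E `&` B `|` Q `&` (E `+` B)))).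
    apply: le_measure; rewrite ?inE//; first exact: measurableU.
    move=> y Ey; have [By|By] := pselect (B y); [by left|right].
    by rewrite setY_def; split; [exact: EQ|left].
  by apply: (le_trans (measureU2 _ _ _)) => //; rewrite leeD.
have : M%:E <= (1 - eta)%:E * (M + e)%:E + e%:E.
  apply: (le_trans EM); rewrite leeD2r//; apply: (le_trans avgB).
  by apply: lee_wpmul2l => //; rewrite lee_fin subr_ge0 ltW.
rewrite -EFinM -EFinD lee_fin /e.
have : (0 < eta * M)%R by rewrite mulr_gt0.
have : (0 < eta * (eta * M))%R by rewrite !mulr_gt0.
nra.
Qed.

(** If g >= lambda + d on a subset of A of positive measure, some cell around one of its points has
    density above lambda / (lambda + d) = 1 - eta, and there the average of g exceeds lambda. *)
Lemma cube_average_differentiation A (g : Rn R n -> R) (lambda : R) :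
  measurable A -> A `<=` Q -> measurable_fun setT g -> (forall y, 0 <= g y)%R ->
  (0 < lambda)%R ->
  (forall y j, A y -> cube_average 0 (s j) (EFin \o g) y <= lambda%:E) ->
  {ae leb n, forall y, A y -> (g y <= lambda)%R}.
Proof.
move=> mA AQ mg g0 lambda0 gA.
pose E (k : nat) := A `&` [set y | (lambda + k.+1%:R^-1 <= g y)%R].
have mE k : measurable (E k).
  apply: measurableI => //; rewrite -[X in measurable X]setTI.
  have := mg measurableT _ (measurable_itv `[(lambda + k.+1%:R^-1)%R, +oo[).
  congr measurable; congr (_ `&` _); apply/funext => y.
  by rewrite /= in_itv/= andbT.
have E0 k : leb n (E k) = 0.
  apply/eqP; rewrite eq_le measure_ge0 andbT leNgt; apply/negP => Epos.
  set d : R := k.+1%:R^-1%R; have d0 : (0 < d)%R by rewrite invr_gt0.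
  have eta01 : (0 < d / (lambda + d) < 1)%R.
    by rewrite divr_gt0 ?addr_gt0//= ltr_pdivrMr ?addr_gt0// mul1r ltrDr.
  have EQ : E k `<=` Q by move=> y [/AQ].
  have [y [j [[Ay gy]]]] := cube_density_point (mE k) EQ eta01 Epos.
  apply/negP; rewrite -leNgt.
  have : (lambda + d)%:E * cube_average 0 (s j) (EFin \o \1_(E k)) y <= lambda%:E.
    rewrite -cube_averageZ//; last 3 first.
    - by apply/measurable_EFinP; exact: measurable_indic.
    - by move=> z; rewrite /= lee_fin.
    - by rewrite lee_fin addr_ge0 ?ltW.
    apply: le_trans (gA y j Ay); apply: le_cube_average => // [z|z _].
      by rewrite /= mule_ge0// lee_fin// addr_ge0 ?ltW.
    rewrite /= -EFinM lee_fin indicE.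
    have [Ez|_] := boolP (z \in E k); last by rewrite mulr0.
    by rewrite mulr1; move: Ez; rewrite inE => -[].
  rewrite -lee_pdivlMl ?addr_gt0// => H; apply: le_trans H _.
  rewrite -EFinM lee_fin.
  by rewrite le_eqVlt; apply/orP; left; apply/eqP; field; rewrite gt_eqF// addr_gt0.
have : (leb n).-negligible (\bigcup_k E k).
  by apply: negligible_bigcup => k; exists (E k); split; [exact: mE|exact: E0|].
move=> [N [mN N0 EN]]; exists N; split=> // y /= /not_implyP[Ay /negP].
rewrite -ltNge => gy; apply: EN.
have d0 : (0 < g y - lambda)%R by rewrite subr_gt0.
exists (Num.truncn (g y - lambda)^-1) => //; split=> //=.
rewrite -lerBrDl -[leRHS]invrK lef_pV2 ?posrE ?invr_gt0//.
exact/ltW/truncnS_gt.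
Qed.

End differentiation.

(** * The John-Nirenberg inequality for cubes *)

Section power_inequalities.
Context {R : realType}.

Lemma exprD_le (u v : R) r : 0 <= u -> 0 <= v ->
  (u + v) ^+ r <= 2 ^+ r * (u ^+ r + v ^+ r).
Proof.
wlog uv : u v / u <= v => [H u0 v0|u0 v0].
  by have [/H|/ltW/H] := leP u v; [|rewrite addrC [_ ^+ r + _]addrC]; exact.
apply: (@le_trans _ _ ((2 * v) ^+ r)).
  by rewrite lerXn2r ?nnegrE ?addr_ge0 ?mulr_ge0// mulrDl mul1r lerD2r.
by rewrite exprMn ler_wpM2l ?exprn_ge0// lerDr exprn_ge0.
Qed.

End power_inequalities.

Section john_nirenberg.
Local Open Scope ereal_scope.
Context {R : realType} {n : nat}.
Variables (b : Rn R n -> R) (c : R -> Rn R n -> R).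
Hypothesis mb : measurable_fun setT b.
Hypothesis c_constant : forall h, (0 < h)%R -> cube_constant h (EFin \o c h).
Hypothesis osc : forall h x, (0 < h)%R ->
  cube_average 1 h (fun y => `|b y - c h x|%:E) x <= 1.
Implicit Types (h : R) (x y : Rn R n).

Let mbB (a : R) : measurable_fun setT (fun y => `|b y - a|%R).
Proof. by apply: measurableT_comp => //; exact: measurable_funB. Qed.

Let mbBE (a : R) : measurable_fun setT (fun y => `|b y - a|%:E).
Proof. exact/measurable_EFinP. Qed.

Let dist_le_average h x (a1 a2 : R) : (0 < h)%R -> `|a1 - a2|%:E <=
  cube_average 0 h (fun y => `|b y - a1|%:E) x + cube_average 0 h (fun y => `|b y - a2|%:E) x.
Proof.
move=> h0; rewrite -cube_averageD//.
have <- : cube_average 0 h (cst `|a1 - a2|%:E) x = `|a1 - a2|%:E.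
  by rewrite cube_average0_constant.
apply: le_cube_average => //= [y|y _].
  by rewrite adde_ge0.
by rewrite -EFinD lee_fin (distrC (b y) a1) ler_distD.
Qed.

Let osc0 h x : (0 < h)%R -> cube_average 0 h (fun y => `|b y - c h x|%:E) x <= 1.
Proof. by move=> h0; apply: le_trans (osc x h0); exact: cube_average01. Qed.

(** Both constants are compared with [b] on the small cell; passing to the average over the doubled
    cell costs 2^n. *)
Lemma mean_double h x : (0 < h)%R -> (`|c h x - c (2 * h) x| <= 1 + 2 ^+ n)%R.
Proof.
move=> h0; rewrite -lee_fin; apply: (le_trans (@dist_le_average h x _ _ h0)).
rewrite EFinD leeD ?osc0//; apply: le_trans (cube_average_double _ _ _ _) _ => //.
by rewrite -[leRHS]mule1 lee_wpmul2l ?lee_fin ?exprn_ge0// osc0 ?mulr_gt0.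
Qed.

Variable r : nat.

(** The stopping height satisfies lambda^-1 * 2^r = 1/2, so that the moments on the stopped cells
    can be absorbed. [jump] bounds the change of the constant between the initial cell and a stopped
    one. *)
Let lambda : R := (2 ^+ r.+1)%R.
Let jump : R := (1 + 2 ^+ n * lambda)%R.

Let lambda_ge1 : (1 <= lambda)%R. Proof. by rewrite exprn_ege1// ler1n. Qed.

Let jump_ge0 : (0 <= jump)%R.
Proof. by rewrite addr_ge0// mulr_ge0// (le_trans _ lambda_ge1). Qed.

(** Truncation at L makes the supremum [S L] of the moments finite, as absorption requires; L tends
    to infinity at the end. *)
Let phi (L : nat) (t : R) : R := (Num.min t L%:R ^+ r)%R.

Let phi_ge0 L t : (0 <= t)%R -> (0 <= phi L t)%R.
Proof. by move=> t0; rewrite exprn_ge0// le_min t0/=. Qed.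

Let phi_le L t : (0 <= t)%R -> (phi L t <= L%:R ^+ r)%R.
Proof. by move=> t0; rewrite lerXn2r ?nnegrE ?le_min ?t0//= ge_min lexx orbT. Qed.

Let phi_mono L : {in Num.nneg &, {homo phi L : s t / (s <= t)%R}}.
Proof.
move=> s t; rewrite !nnegrE => s0 t0 st; rewrite lerXn2r ?nnegrE ?le_min ?s0 ?t0 ?ler0n//=.
by rewrite !ge_min st lexx orbT.
Qed.

Let phiD L s t : (0 <= s)%R -> (0 <= t)%R -> (phi L (s + t) <= 2 ^+ r * (phi L s + t ^+ r))%R.
Proof.
move=> s0 t0; have m0 : (0 <= Num.min s L%:R)%R by rewrite le_min s0/=.
apply: le_trans (exprD_le r m0 t0).
rewrite lerXn2r ?nnegrE ?le_min ?addr_ge0 ?ler0n//.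
have [sL|/ltW sL] := leP s L%:R; first by rewrite ge_min lexx.
by rewrite ge_min lerDl t0 orbT.
Qed.

Let mphi L (a : R) : measurable_fun setT (fun y => (phi L `|b y - a|)%:E).
Proof.
apply/measurable_EFinP; apply: measurable_funX; exact: measurable_minr.
Qed.

Let phiE_ge0 L (a : R) y : 0 <= (phi L `|b y - a|)%:E.
Proof. by rewrite lee_fin phi_ge0. Qed.

Let S L : \bar R := ereal_sup [set cube_average 0 z.1 (fun y => (phi L `|b y - c z.1 z.2|)%:E) z.2
  | z in [set z : R * Rn R n | 0 < z.1]%R].

Let S_ub L h x : (0 < h)%R -> cube_average 0 h (fun y => (phi L `|b y - c h x|)%:E) x <= S L.
Proof. by move=> h0; apply: ereal_sup_ubound; exists (h, x). Qed.

Let S_ge0 L : 0 <= S L.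
Proof.
apply: le_trans (S_ub L (nseq_tuple n (0%R : measurableTypeR R)) ltr01).
exact: cube_average_ge0.
Qed.

Let S_le L : S L <= (L%:R ^+ r)%:E.
Proof.
apply: ge_ereal_sup => _ [[h x] /= h0 <-].
apply: (@le_trans _ _ (cube_average 0 h (cst (L%:R ^+ r)%:E) x)).
  by apply: le_cube_average => //= y *; rewrite lee_fin ?exprn_ge0 ?phi_le.
by rewrite cube_average0_constant.
Qed.

Section stopping.
Variables (L : nat) (h : R) (h0 : (0 < h)%R) (x : Rn R n).

Let s (j : nat) : R := (h / 2 ^+ j)%R.
Let s0 j : (0 < s j)%R. Proof. by rewrite divr_gt0// exprn_gt0. Qed.
Let s_0 : s 0 = h. Proof. by rewrite /s expr0 divr1. Qed.
Let sS j : (2 * s j.+1 = s j)%R.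
Proof. by rewrite /s exprS; field; rewrite expf_neq0. Qed.

Let Q := cube 0 h x.
Let mQ : measurable Q. Proof. exact: measurable_cube. Qed.
Let g y : R := `|b y - c h x|%R.
Let gE_ge0 y : 0 <= (EFin \o g) y. Proof. by rewrite /= lee_fin normr_ge0. Qed.
Let G y : \bar R := (phi L (g y))%:E.
Let a j := cube_average 0 (s j) (EFin \o g).
Let F j : set (Rn R n) := Q `&` [set y | lambda%:E < a j y].

Let a_constant i j y z : (i <= j)%N -> cube 0 (s j) y z -> a i y = a i z.
Proof. by move=> ij /(cube0_halve h0 ij); exact: cube_average_constant. Qed.

Let Q_level j y z : cube 0 (s j) y z -> Q y -> Q z.
Proof.
move=> yz Qy; apply: (cube0_trans Qy).
by have := cube0_halve h0 (leq0n j) yz; rewrite expr0 divr1.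
Qed.

Let mF j : measurable (F j).
Proof.
apply: measurableI => //; rewrite -[X in measurable X]setTI.
by apply: emeasurable_fun_o_infty => //; apply: measurable_cube_average => //; exact: mbBE.
Qed.

(** The Calderon-Zygmund stopping cells of generation j: those where the average exceeds [lambda]
    for the first time. *)
Let T := seqDU F.

Let mT j : measurable (T j).
Proof. by apply: measurableD => //; exact: bigsetU_measurable. Qed.

Let T_level j y z : cube 0 (s j) y z -> T j y -> T j z.
Proof.
move=> yz [[Qy ay] nF]; split.
  by split; [exact: Q_level yz Qy|rewrite /= -(a_constant (leqnn j) yz)].
apply: contra_not nF; rewrite -!bigcup_mkord => -[i /= ij [Qz az]].
by exists i => //=; split=> //; rewrite /= (a_constant (ltnW ij) yz).
Qed.

(** The parent of a stopped cell was not stopped, whence the factor 2^n; in generation 0 the average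
    is at most 1 <= lambda. *)
Let a_T j y : T j y -> a j y <= (2 ^+ n * lambda)%:E.
Proof.
move=> [[Qy _] nF].
have a0 : a 0 y <= lambda%:E.
  have -> : a 0 y = cube_average 0 h (EFin \o g) x.
    by rewrite /a s_0; apply/esym/cube_average_constant.
  by apply: (le_trans (osc0 _ _)) => //; rewrite lee_fin.
case: j nF => [_|j nF].
  apply: (le_trans a0); rewrite lee_fin ler_peMl// ?(le_trans ler01)//.
  by rewrite exprn_ege1// ler1n.
apply: (le_trans (cube_average_double _ _ _ _)) => //.
rewrite EFinM; apply: lee_wpmul2l; first by rewrite lee_fin exprn_ge0.
rewrite sS leNgt; apply/negP => aj; apply: nF.
by rewrite -bigcup_mkord; exists j => //=; split.
Qed.

Let B : \bar R := (2 ^+ r)%:E * (S L + (jump ^+ r)%:E).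

(** The constant of [Q] is exchanged for that of the stopped cell, at distance at most [jump]; about
    the latter the truncated moment is at most [S L]. *)
Let G_T j y : T j y -> cube_average 0 (s j) G y <= B.
Proof.
move=> Ty; have jumpE : (`|c (s j) y - c h x| <= jump)%R.
  rewrite -lee_fin; apply: (le_trans (dist_le_average y _ _ (s0 j))).
  by rewrite EFinD leeD// ?osc0//; exact: a_T.
apply: (@le_trans _ _ (cube_average 0 (s j) (fun z => (2 ^+ r)%:E *
    ((phi L `|b z - c (s j) y|)%:E + (jump ^+ r)%:E)) y)).
  have rhs_ge0 z : 0 <= (2 ^+ r)%:E * ((phi L `|b z - c (s j) y|)%:E + (jump ^+ r)%:E).
    by rewrite mule_ge0 ?adde_ge0 ?lee_fin ?exprn_ge0 ?le_min ?normr_ge0 ?ler0n.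
  apply: le_cube_average => // [z|z _]; first exact: phiE_ge0.
  rewrite -EFinD -EFinM lee_fin.
  refine (le_trans _ (phiD L (normr_ge0 (b z - c (s j) y)%R) jump_ge0)).
  apply: phi_mono; [by rewrite nnegrE normr_ge0|by rewrite nnegrE addr_ge0|].
  apply: (le_trans (ler_distD (c (s j) y) _ _)).
  by rewrite lerD2l.
rewrite cube_averageZ//; first last.
- by move=> z; rewrite adde_ge0// lee_fin exprn_ge0.
- by apply: emeasurable_funD.
rewrite cube_averageD//; last by move=> z; rewrite lee_fin exprn_ge0.
rewrite lee_wpmul2l ?lee_fin ?exprn_ge0// leeD ?S_ub//.
by rewrite cube_average0_constant.
Qed.

(** Off the stopped cells the oscillation is at most [lambda] almost everywhere, by differentiation.
    The stopped cells have total measure at most |Q| / lambda, because the average exceeds [lambda]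
    on each, and each contributes at most [B] times its measure. *)
Lemma truncated_moment_step : cube_average 0 h G x <=
  (lambda ^+ r)%:E + (lambda^-1)%:E * B.
Proof.
have B0 : 0 <= B.
  by rewrite mule_ge0 ?adde_ge0 ?S_ge0 ?lee_fin ?exprn_ge0.
have mG : measurable_fun setT G by exact: mphi.
have G0 y : 0 <= G y by exact: phiE_ge0.
have mgE : measurable_fun setT (EFin \o g) by exact: mbBE.
have lambda0 : (0 < lambda)%R by exact: lt_le_trans lambda_ge1.
have TQ j : T j `<=` Q by move=> y [[]].
have trT : trivIset setT T by exact: trivIset_seqDU.
have mU : measurable (\bigcup_j T j) by exact: bigcup_measurable.
have UQ : \bigcup_j T j `<=` Q by apply: bigcup_sub => j _; exact: TQ.
have leb_T j : leb n (T j) <= (lambda^-1)%:E * \int[leb n]_(y in T j) (EFin \o g) y.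
  rewrite (integral_cube_constant_set (s0 j))//; last exact: T_level.
  rewrite -lee_pdivrMl ?invr_gt0// invrK -integral_cst//.
  apply: ge0_le_integral_subset => // y.
  - by rewrite lee_fin ltW.
  - exact: cube_average_ge0.
  - by move=> [[_ ay] _]; exact: ltW.
have GT j : \int[leb n]_(y in T j) G y <=
    ((lambda^-1)%:E * B) * \int[leb n]_(y in T j) (EFin \o g) y.
  rewrite (integral_cube_constant_set (s0 j))//; last exact: T_level.
  apply: (@le_trans _ _ (\int[leb n]_(y in T j) B)).
    by apply: ge0_le_integral_subset => // y; [exact: cube_average_ge0|exact: G_T].
  rewrite integral_cst// [leRHS](_ : _ = B * ((lambda^-1)%:E * \int[leb n]_(y in T j) (EFin \o g) y)).
    by apply: lee_wpmul2l => //; exact: leb_T.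
  by rewrite -muleA muleCA.
have GU : \int[leb n]_(y in \bigcup_j T j) G y <= ((lambda^-1)%:E * B) * (h ^+ n)%:E.
  rewrite ge0_integral_bigcup//; last exact: measurable_funTS.
  apply: (@le_trans _ _ (\sum_(j <oo) ((lambda^-1)%:E * B) * \int[leb n]_(y in T j) (EFin \o g) y)).
    by apply: lee_nneseries => j _; [move=> *; exact: integral_ge0|exact: GT].
  have Kfin : (lambda^-1)%:E * B \is a fin_num.
    rewrite fin_numM// fin_numM// fin_numD andbT ge0_fin_numE ?S_ge0//.
    exact: le_lt_trans (S_le L) (ltry _).
  rewrite -(fineK Kfin) nneseriesZl ?fineK//; last by move=> j _; apply: integral_ge0.
  rewrite -ge0_integral_bigcup//; last exact: measurable_funTS.
  apply: lee_wpmul2l; first by rewrite mule_ge0// lee_fin invr_ge0 ltW.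
  apply: (@le_trans _ _ (\int[leb n]_(y in Q) (EFin \o g) y)).
    exact: ge0_le_integral_subset.
  have := osc0 x h0; rewrite /cube_average lee_pdivrMl ?exprn_gt0//.
  by rewrite mule1.
have Gdiff : \int[leb n]_(y in Q `\` \bigcup_j T j) G y <= (lambda ^+ r)%:E * (h ^+ n)%:E.
  have mD : measurable (Q `\` \bigcup_j T j) by exact: measurableD.
  have gle : {ae leb n, forall y, (Q `\` \bigcup_j T j) y -> (g y <= lambda)%R}.
    apply: (@cube_average_differentiation _ _ h h0 x _ _ _ mD _ _ _ lambda0) => //.
    - exact: mbB.
    - move=> y j [Qy nT]; rewrite leNgt; apply/negP => ay; apply: nT.
      by rewrite /T -seqDU_bigcup_eq; exists j.
  rewrite -EFinM; apply: (@le_trans _ _ (\int[leb n]_(y in Q) (cst (lambda ^+ r)%:E) y)); last first.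
    have lebQ : leb n Q = (h ^+ n)%:E by rewrite /Q leb_cube// mul1r.
    by rewrite integral_cst// EFinM -lebQ.
  rewrite integral_mkcond (integral_mkcond Q).
  apply: ge0_ae_le_lower_integral => [y|y|]; rewrite ?patchE.
  - by case: ifP.
  - by case: ifP => // _; rewrite lee_fin exprn_ge0// ltW.
  - apply: filterS gle => y gy; rewrite !patchE.
    case: ifPn => [|_]; last by case: ifP => // _; rewrite lee_fin exprn_ge0// ltW.
    rewrite inE => yD; rewrite mem_set; last by case: yD.
    have m0 : (0 <= Num.min (g y) L%:R)%R by rewrite le_min normr_ge0/=.
    by rewrite lee_fin lerXn2r ?nnegrE ?m0 ?(ltW lambda0) ?ge_min ?gy.
have splitQ : \int[leb n]_(y in Q) G y =
    \int[leb n]_(y in \bigcup_j T j) G y + \int[leb n]_(y in Q `\` \bigcup_j T j) G y.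
  rewrite -ge0_integral_setU ?setDUK//.
  - exact: measurableD.
  - exact: measurable_funTS.
  - by apply/disj_setPS => y [? []].
rewrite /cube_average -/Q lee_pdivrMl ?exprn_gt0// splitQ muleC ge0_muleDl; first last.
- by rewrite mule_ge0// lee_fin invr_ge0 ltW.
- by rewrite lee_fin exprn_ge0// ltW.
by rewrite addeC leeD.
Qed.

End stopping.

Let K0 : R := (2 * lambda ^+ r + jump ^+ r)%R.

(** Absorption: t <= lambda^r + (t + jump^r) / 2 for the finite number t = [S L]. *)
Let S_bound L : S L <= K0%:E.
Proof.
have Sfin : S L \is a fin_num.
  by rewrite ge0_fin_numE ?S_ge0//; exact: le_lt_trans (S_le L) (ltry _).
have : S L <= (lambda ^+ r)%:E + (lambda^-1)%:E * ((2 ^+ r)%:E * (S L + (jump ^+ r)%:E)).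
  by apply: ge_ereal_sup => _ [[h x] /= h0 <-]; exact: truncated_moment_step.
move: (S L) Sfin => [t| |]// _.
rewrite -[X in _ <= X -> _]/(lambda ^+ r + lambda^-1 * (2 ^+ r * (t + jump ^+ r)))%:E.
rewrite !lee_fin mulrA.
have -> : (lambda^-1 * 2 ^+ r = 2^-1)%R.
  by rewrite /lambda exprS invfM -mulrA mulVf ?mulr1// expf_neq0.
rewrite /K0; lra.
Qed.

Lemma moment_bound0 h x : (0 < h)%R ->
  cube_average 0 h (fun y => (`|b y - c h x| ^+ r)%:E) x <= K0%:E.
Proof.
move=> h0; rewrite /cube_average lee_pdivrMl ?exprn_gt0//.
pose f L y := (phi L `|b y - c h x|)%:E.
have fL y : f ^~ y @ \oo --> (`|b y - c h x| ^+ r)%:E.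
  apply: cvg_near_cst; exists (Num.truncn `|b y - c h x|%R).+1 => //= L Lb.
  congr (_ ^+ _)%:E; apply/min_idPl/ltW/(lt_le_trans (truncnS_gt _)).
  by rewrite ler_nat.
have nd_f y : nondecreasing_seq (f ^~ y).
  move=> L L' LL'; rewrite lee_fin.
  have m0 N : (0 <= Num.min `|b y - c h x| N%:R)%R by rewrite le_min normr_ge0/=.
  apply: lerXn2r; rewrite ?nnegrE ?m0// le_min !ge_min lexx/=.
  by rewrite ler_nat LL' orbT.
rewrite (_ : (fun y => _) = fun y => limn (f ^~ y)); last first.
  by apply/funext => y; apply/esym/cvg_lim.
rewrite monotone_convergence//.
- apply: lime_le.
    apply: ereal_nondecreasing_is_cvgn => L L' LL'.
    by apply: ge0_le_integral_subset => // y *; [exact: phiE_ge0|exact: phiE_ge0|exact: nd_f].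
  apply: nearW => L; have := S_ub L x h0; rewrite /cube_average lee_pdivrMl ?exprn_gt0//.
  move=> /le_trans; apply; apply: lee_wpmul2l; last exact: S_bound.
  by rewrite lee_fin exprn_ge0// ltW.
- exact: measurable_cube.
- by move=> L; apply: measurable_funTS; exact: mphi.
- by move=> L y _; exact: phiE_ge0.
Qed.

(** The constants of the cells in the block are within 2 of the constant of the central cell: both
    are compared with [b] on the outer cell, where the two averages are at most 1. *)
Lemma moment_bound h x : (0 < h)%R ->
  cube_average 1 h (fun y => (`|b y - c h x| ^+ r)%:E) x <=
  (3 ^+ n * (2 ^+ r * (K0 + 2 ^+ r)))%:E.
Proof.
move=> h0; have mpow (a : R) : measurable_fun setT (fun y => (`|b y - a| ^+ r)%:E).
  by apply/measurable_EFinP; exact: measurable_funX.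
have K0_ge0 : (0 <= K0)%R.
  by rewrite addr_ge0 ?mulr_ge0 ?exprn_ge0// (le_trans _ lambda_ge1).
rewrite EFinM; apply: cube_average1_le => //.
  rewrite lee_fin; apply: mulr_ge0; first exact: exprn_ge0.
  by apply: addr_ge0 => //; exact: exprn_ge0.
move=> y xy; have cc : (`|c h y - c h x| <= 2)%R.
  rewrite -lee_fin; apply: (le_trans (dist_le_average y _ _ h0)).
  rewrite (_ : 2%:E = 1 + 1)//; apply: leeD; first exact: osc0.
  apply: le_trans (osc x h0); apply: lee_wpmul2l; first exact: expn_inv_ge0.
  apply: ge0_le_integral_subset => // z yz.
  by apply/cube_sym/(cube0_trans (cube_sym yz))/cube_sym.
apply: (@le_trans _ _ (cube_average 0 h (fun z => (2 ^+ r)%:E *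
    ((`|b z - c h y| ^+ r)%:E + (2 ^+ r)%:E)) y)).
  apply: le_cube_average => // z *.
    by rewrite mule_ge0 ?adde_ge0 ?lee_fin ?exprn_ge0.
  rewrite -EFinD -EFinM lee_fin.
  refine (le_trans _ (exprD_le r (normr_ge0 (b z - c h y)%R) (ler0n _ 2))).
  rewrite lerXn2r ?nnegrE ?addr_ge0//.
  by apply: (le_trans (ler_distD (c h y) _ _)); rewrite lerD2l.
rewrite cube_averageZ//; first last.
- by move=> z; rewrite adde_ge0// lee_fin exprn_ge0.
- by apply: emeasurable_funD.
rewrite cube_averageD//.
rewrite [leRHS]EFinM; apply: lee_wpmul2l; first by rewrite lee_fin exprn_ge0.
rewrite [leRHS]EFinD; apply: leeD; first exact: moment_bound0.
by rewrite cube_average0_constant.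
Qed.

(** The growth is linear in the number of doublings, so a change of scale costs only polynomial
    factors later on. *)
Lemma mean_iter_double h x j : (0 < h)%R ->
  (`|c h x - c (2 ^+ j * h) x| <= j%:R * (1 + 2 ^+ n))%R.
Proof.
move=> h0; elim: j => [|j ih]; first by rewrite expr0 mul1r subrr normr0 mul0r.
apply: (le_trans (ler_distD (c (2 ^+ j * h)%R x) _ _)).
rewrite -[j.+1%:R]natr1 mulrDl mul1r lerD// exprS -mulrA.
by apply: mean_double; rewrite mulr_gt0// exprn_gt0.
Qed.

End john_nirenberg.

Section cube_constant_measurable.
Context {R : realType} {n : nat}.

(** There are countably many cells and every preimage is a union of cells. *)
Lemma cube_constant_measurable d (Y : measurableType d) (h : R) (f : Rn R n -> Y) :
  0 < h -> (forall x y, cube 0 h x y -> f x = f y) -> measurable_fun setT f.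
Proof.
move=> h0 fc _ A _; rewrite setTI.
pose F (z : {ffun 'I_n -> int}) : set (Rn R n) :=
  [set y | (forall i, cell_index h y i = z i) /\ A (f y)].
rewrite (_ : f @^-1` A = \bigcup_z F z); last first.
  apply/seteqP; split=> [y Ay|y [z _ []]//].
  by exists [ffun i => cell_index h y i] => //; split=> // i; rewrite ffunE.
apply: countable_bigcupT_measurable; first exact: countableP.
move=> z; have [[y [yz Ay]]|noy] := pselect (exists y, F z y).
  rewrite (_ : F z = cube 0 h y); first exact: measurable_cube.
  apply/seteqP; split=> [t [tz _]|t /[dup] yt /cube0P E].
    by apply/cube0P/funext => i; rewrite tz yz.
  by split=> [i|]; [rewrite E yz|rewrite -(fc y)].
rewrite (_ : F z = set0)// -subset0 => y Fy; apply: noy; by exists y.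
Qed.

End cube_constant_measurable.

(** * Sums over scales near a maximal term *)

Section geometric_sums.
Context {R : realType}.

Lemma nneseries_le_bound (f : nat -> \bar R) (C : \bar R) :
  (forall j, 0 <= f j)%E ->
  (forall N, \sum_(0 <= j < N) f j <= C)%E -> (\sum_(j <oo) f j <= C)%E.
Proof.
move=> f0 fC; apply: lime_le; first by apply: is_cvg_nneseries.
exact: nearW.
Qed.

Lemma sum_expr_dist_le (sigma : R) (k N : nat) : 0 < sigma < 1 ->
  \sum_(0 <= j < N) sigma ^+ `|j%:Z - k%:Z|%N <= 2 / (1 - sigma).
Proof.
move=> /andP[s0 s1]; have s1' : 0 < 1 - sigma by rewrite subr_gt0.
set f := fun j : nat => sigma ^+ `|j%:Z - k%:Z|%N.
have low M : (M <= k)%N -> (1 - sigma) * \sum_(0 <= j < M) f j <= sigma ^+ (k - M).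
  elim: M => [_|M ih Mk]; first by rewrite big_nil mulr0 exprn_ge0// ltW.
  rewrite big_nat_recr//= mulrDr; have := ih (ltnW Mk).
  rewrite /f (_ : `|_|%N = (k - M.+1).+1); last by lia.
  rewrite (_ : (k - M)%N = (k - M.+1).+1); last by lia.
  rewrite exprS; set z := sigma ^+ (k - M.+1); have z0 : 0 <= z by rewrite exprn_ge0// ltW.
  have : 0 <= z * (1 - sigma) ^+ 2 by rewrite mulr_ge0// sqr_ge0.
  move: (\sum_(_ <= _ < _) _) => y; nra.
have high i : (1 - sigma) * \sum_(0 <= j < k + i) f j <= 2 - sigma ^+ i.
  elim: i => [|i ih].
    by rewrite addn0 (le_trans (low k (leqnn k)))// subnn expr0; lra.
  have fki : f (k + i)%N = sigma ^+ i by rewrite /f (_ : `|_|%N = i)//; lia.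
  rewrite addnS big_nat_recr//= mulrDr fki; move: ih; rewrite exprS.
  move: (\sum_(_ <= _ < _) _) (sigma ^+ i) => y z; nra.
rewrite ler_pdivlMr// mulrC; have [Nk|kN] := leqP N k.
  apply: (le_trans (low N Nk)); apply: (@le_trans _ _ 1); last by lra.
  by rewrite exprn_ile1// ltW.
rewrite -(subnKC (ltnW kN)); apply: (le_trans (high _)).
by rewrite lerBlDr lerDl exprn_ge0// ltW.
Qed.

Lemma nneseries_expr_dist_le (sigma : R) (k : nat) : 0 < sigma < 1 ->
  (\sum_(j <oo) (sigma ^+ `|j%:Z - k%:Z|%N)%:E <= (2 / (1 - sigma))%:E)%E.
Proof.
move=> s01; apply: nneseries_le_bound => [j|N].
  by rewrite lee_fin exprn_ge0// ltW//; case/andP: s01.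
by rewrite sumEFin lee_fin sum_expr_dist_le.
Qed.

(** The bound is uniform in [theta]: with k the integer part of theta / delta, |delta j - theta| >=
    delta (|j - k| - 1), also for negative theta, where k = 0. *)
Lemma nneseries_exp_dist_le (eta delta : R) : 0 < eta -> 0 < delta ->
  exists2 C : R, 0 < C & forall theta : R,
    (\sum_(j <oo) (expR (- eta * `|delta * j%:R - theta|))%:E <= C%:E)%E.
Proof.
move=> eta0 delta0; pose sigma := expR (- (eta * delta)).
have s01 : 0 < sigma < 1 by rewrite expR_gt0 expR_lt1 oppr_lt0 mulr_gt0.
exists (expR (eta * delta) * (2 / (1 - sigma))).
  by rewrite mulr_gt0 ?expR_gt0// divr_gt0// subr_gt0; case/andP: s01.
move=> theta; pose k := Num.truncn (theta / delta).
have dist j : delta * (`|j%:Z - k%:Z|%N%:R - 1) <= `|delta * j%:R - theta|.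
  rewrite -[X in _ * j%:R - X](divfK (lt0r_neq0 delta0)) (mulrC (theta / delta)).
  rewrite -mulrBr normrM (gtr0_norm delta0) ler_pM2l//.
  rewrite natr_absz intr_norm rmorphB/= -!pmulrn lerBlDr.
  have [t0|t0] := leP 0 (theta / delta); last first.
    have j0 : 0 <= j%:R :> R by [].
    by rewrite /k truncn_floor ifF ?leNgt ?t0// subr0 !ger0_norm; lra.
  apply: (le_trans (ler_distD (theta / delta) _ _)); rewrite lerD2l.
  by have /andP[k1] := truncn_itv t0; rewrite -natr1 -/k => k2; rewrite ger0_norm; lra.
apply: (@le_trans _ _ (\sum_(j <oo) (expR (eta * delta))%:E * (sigma ^+ `|j%:Z - k%:Z|%N)%:E)%E).
  apply: lee_nneseries => j _ *; first by rewrite lee_fin expR_ge0.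
  rewrite -EFinM lee_fin /sigma -expRM_natl -expRD ler_expR.
  have := dist j; move: (`|_|%N%:R) (`|_|) => y z; nra.
rewrite nneseriesZl; last by move=> j _; rewrite lee_fin exprn_ge0// expR_ge0.
by rewrite EFinM lee_wpmul2l ?lee_fin ?expR_ge0// nneseries_expr_dist_le.
Qed.

Lemma exprD1_le_expR (N : nat) (a : R) : 0 < a ->
  exists2 C : R, 0 < C & forall t : R, 0 <= t -> (1 + t) ^+ N <= C * expR (a * t).
Proof.
move=> a0; pose s := Num.min 1 (a / N.+1%:R).
have s0 : 0 < s by rewrite lt_min ltr01 divr_gt0.
have s1 : s <= 1 by rewrite ge_min lexx.
have sa : s * N%:R <= a.
  apply: (@le_trans _ _ (a / N.+1%:R * N%:R)).
    by rewrite ler_wpM2r// ge_min lexx orbT.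
  by rewrite mulrAC ler_pdivrMr// ler_wpM2l ?ler_nat// ltW.
exists (s ^- N); first by rewrite invr_gt0 exprn_gt0.
move=> t t0; rewrite mulrC ler_pdivlMr ?exprn_gt0// -exprMn.
apply: (@le_trans _ _ (expR (s * t) ^+ N)).
  rewrite lerXn2r ?nnegrE ?mulr_ge0 ?addr_ge0 ?expR_ge0 ?(ltW s0)//.
  by apply: le_trans (expR_ge1Dx _); nra.
by rewrite -expRM_natl ler_expR mulrA ler_wpM2r// mulrC.
Qed.

End geometric_sums.

Section argmax.
Context {R : realType}.

Lemma has_near_argmax (g : nat -> R) (M : R) : (forall j, g j <= M) ->
  exists k, forall j, g j <= g k + 1.
Proof.
move=> gM; have gs : has_sup (range g).
  by split; [exists (g 0%N), 0%N|exists M => _ [j _ <-]].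
have [_ [k _ <-] kg] := sup_adherent ltr01 gs.
exists k => j; rewrite -lerBlDr -(lerD2r (- sup (range g))) in kg *.
have := sup_upper_bound gs (imageT g j); move: kg; lra.
Qed.

(* The index k nearly maximises the intermediate expression with exponent
   1 + delta / 2: below that exponent the terms decay on one side of k, above
   it they decay on the other side. *)
Lemma sum_le_near_argmax (beta delta q1 q2 A : R) (N : nat) : beta != 0 ->
  0 < delta -> 0 < q1 -> q1 <= q2 -> 0 <= A ->
  exists2 C : R, 0 < C &
  forall (q M : R) (tau Phi : nat -> R), q1 <= q <= q2 ->
    (forall j, tau j <= 0) -> (forall j, 0 <= Phi j) ->
    (forall j k, Phi j <= A * (1 + `|j%:R - k%:R|) ^+ N * Phi k) ->
    (forall j, - beta * j%:R + (1 + delta / 4) * tau j <= M) ->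
  exists k, (\sum_(j <oo) (Phi j * expR ((- beta * j%:R + (1 + delta) * tau j) / q))%:E <=
    (C * (Phi k * expR ((- beta * k%:R + (1 + delta / 4) * tau k) / q)))%:E)%E.
Proof.
move=> beta0 delta0 q10 q12 A0.
(* With theta = 1 + delta / 2 the outer exponents satisfy (1 + delta / 4) / theta = 1 - eta and (1 +
   delta) / theta = 1 + 2 eta, so eta is a rate of decay on both sides of k. *)
pose eta := (delta / 4) / (1 + delta / 2).
have eta0 : 0 < eta by rewrite divr_gt0 ?divr_gt0 ?addr_gt0 ?divr_gt0.
have b0 : 0 < `|beta| by rewrite normr_gt0.
have q20 : 0 < q2 by exact: lt_le_trans q12.
(* Half of the decay rate eta |beta| / q2 pays for the polynomial factor, the other half is
   summed. *)
pose a := eta * `|beta| / q2 / 2.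
have a0 : 0 < a by rewrite !divr_gt0// mulr_gt0.
have [C1 C10 polyC] := exprD1_le_expR N a0.
have [C2 C20 geoC] := nneseries_exp_dist_le a0 (@ltr01 R).
exists ((A + 1) * C1 * expR (2 / q1) * C2); first by rewrite !mulr_gt0 ?expR_gt0 ?ltr_wpDl.
move=> q M tau Phi /andP[q1q qq2] tau0 Phi0 PhiA tauM.
have q0 : 0 < q by exact: lt_le_trans q1q.
pose theta := 1 + delta / 2.
have theta0 : 0 < theta by rewrite addr_gt0 ?divr_gt0.
have [|k kmax] := @has_near_argmax (fun j => - beta * j%:R + theta * tau j) M.
  by move=> j; apply: le_trans (tauM j); rewrite lerD2l /theta; have := tau0 j; nra.
exists k.
have term j : - beta * j%:R + (1 + delta) * tau j <=
    - beta * k%:R + (1 + delta / 4) * tau k - eta * `|beta| * `|j%:R - k%:R| + 2.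
  pose D := beta * (j%:R - k%:R).
  have Dabs : `|beta| * `|j%:R - k%:R| = `|D| by rewrite normrM.
  rewrite -mulrA Dabs.
  have tauj : tau j <= tau k + (D + 1) / theta.
    rewrite -lerBlDl ler_pdivlMr// /D; have := kmax j; lra.
  have := tau0 j; have := tau0 k.
  have thetaE : eta * theta = delta / 4 by rewrite /eta divfK// gt_eqF.
  (* Since tau <= 0, lowering its exponent increases the expression. For D >= 0 the exponent is
     lowered at j before the comparison with k, for D < 0 at k after it. *)
  have [D0|D0] := leP 0 D.
    rewrite ger0_norm// => tk tj.
    have : (1 + delta) * tau j <= (1 + delta / 4) * (tau k + (D + 1) / theta).
      by apply: (@le_trans _ _ ((1 + delta / 4) * tau j)); [nra|rewrite ler_wpM2l//; lra].
    have -> : (1 + delta / 4) * (tau k + (D + 1) / theta) =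
        (1 + delta / 4) * tau k + (1 + delta / 4) / theta * (D + 1) by ring.
    have -> : (1 + delta / 4) / theta = 1 - eta.
      by rewrite /eta /theta; field; rewrite gt_eqF//; lra.
    rewrite /D; nra.
  rewrite ltr0_norm// => tk tj.
  have : (1 + delta) * tau j <= (1 + delta) * (tau k + (D + 1) / theta).
    by rewrite ler_wpM2l//; lra.
  have -> : (1 + delta) * (tau k + (D + 1) / theta) =
      (1 + delta) * tau k + (1 + delta) / theta * (D + 1) by ring.
  have -> : (1 + delta) / theta = 1 + 2 * eta.
    by rewrite /eta /theta; field; rewrite gt_eqF//; lra.
  have eta1 : eta <= 1 / 2 by rewrite /eta ler_pdivrMr//; lra.
  rewrite /D in D0 *; nra.
set E := Phi k * expR _.
have E0 : 0 <= E by rewrite mulr_ge0 ?Phi0 ?expR_ge0.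
apply: (@le_trans _ _ (\sum_(j <oo) ((A + 1) * C1 * expR (2 / q1) * E)%:E *
    (expR (- a * `|1 * j%:R - k%:R|))%:E)%E); last first.
  rewrite nneseriesZl; last by move=> j _; rewrite lee_fin expR_ge0.
  apply: (@le_trans _ _ (((A + 1) * C1 * expR (2 / q1) * E)%:E * C2%:E)%E).
    by rewrite lee_wpmul2l ?geoC// lee_fin !mulr_ge0 ?expR_ge0 ?(ltW C10) ?addr_ge0.
  by rewrite -EFinM lee_fin le_eqVlt; apply/orP; left; apply/eqP; ring.
apply: lee_nneseries => j *; first by rewrite lee_fin mulr_ge0 ?expR_ge0.
rewrite -EFinM lee_fin mul1r.
set t := `|j%:R - k%:R|; have t0 : 0 <= t by exact: normr_ge0.
have PhiE : Phi j <= (A + 1) * C1 * expR (a * t) * Phi k.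
  apply: (le_trans (PhiA j k)); rewrite ler_wpM2r// -mulrA.
  by rewrite ler_pM ?exprn_ge0 ?addr_ge0 ?lerDl ?polyC.
have expE : expR ((- beta * j%:R + (1 + delta) * tau j) / q) <=
    expR ((- beta * k%:R + (1 + delta / 4) * tau k) / q) * expR (2 / q1) * expR (- (2 * a * t)).
  rewrite -!expRD ler_expR ler_pdivrMr//.
  apply: (le_trans (term j)); rewrite -/t.
  move: (- beta * k%:R + (1 + delta / 4) * tau k) => X.
  have -> : (X / q + 2 / q1 - 2 * a * t) * q = X + 2 / q1 * q - 2 * a * t * q.
    by rewrite !(mulrDl, mulNr) divfK// gt_eqF.
  have : 2 <= 2 / q1 * q by rewrite mulrAC ler_pdivlMr// ler_wpM2l.
  have : 2 * a * t * q <= eta * `|beta| * t.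
    rewrite /a (_ : 2 * _ * t * q = eta * `|beta| * t * (q / q2)); last first.
      by field; rewrite gt_eqF.
    apply: ler_piMr; last by rewrite ler_pdivrMr// mul1r.
    by apply: mulr_ge0 => //; apply: mulr_ge0 => //; exact: ltW.
  lra.
apply: (le_trans (ler_pM (Phi0 j) (expR_ge0 _) PhiE expE)).
rewrite le_eqVlt; apply/orP; left; apply/eqP; rewrite /E.
have -> : expR (- a * t) = expR (a * t) * expR (- (2 * a * t)).
  by rewrite -expRD; congr expR; ring.
ring.
Qed.

End argmax.

(** * Integrals of powers of averages *)

Section averages_of_Lp.
Context {R : realType} {n : nat}.
Implicit Types (h : R) (x y : Rn R n).

Lemma powRE (v z : R) : 0 < v -> v `^ z = expR (z * ln v).
Proof. by move=> v0; rewrite /powR gt_eqF. Qed.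

(** Either v <= c or (v / c)^(r - 1) >= 1. Averaged and with c chosen suitably, this serves in place
    of Jensen's inequality. *)
Lemma le_add_powR (v c r : R) : 0 <= v -> 0 < c -> 1 <= r ->
  v <= c + c `^ (1 - r) * v `^ r.
Proof.
move=> v0 c0 r1; have [vc|cv] := leP v c.
  by rewrite (le_trans vc)// lerDl mulr_ge0 ?powR_ge0.
have v0' : 0 < v by exact: lt_trans cv.
apply: (@le_trans _ _ (c `^ (1 - r) * v `^ r)); last by rewrite lerDr ltW.
rewrite !powRE// -expRD -{1}(lnK v0') ler_expR.
have : ln c <= ln v by rewrite ler_ln ?posrE// ltW.
nra.
Qed.

Definition scale (s : bool) (j : nat) : R := if s then 2 ^+ j else 2 ^- j.

Lemma scale_gt0 s j : 0 < scale s j.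
Proof. by case: s; rewrite /= ?invr_gt0 exprn_gt0. Qed.

Lemma ln_scale s j : ln (scale s j) = (-1) ^+ (~~ s) * ln 2 * j%:R.
Proof.
by case: s; rewrite /= ?lnV ?posrE ?exprn_gt0// lnXn// ?mulN1r ?mul1r ?mulNr mulr_natr.
Qed.

Variables (a K : R).
Hypotheses (a1 : 1 < a) (K0 : 0 <= K).

(** The height c = h^(-n/a), for which h^n c^a = 1: averages of u over cubes of side h are at most
    of this order when u^a is integrable. *)
Definition critical_height h : R := expR (- (n%:R / a) * ln h).

Let c := critical_height.

Let c_gt0 h : 0 < c h. Proof. exact: expR_gt0. Qed.

Let ln_c h : ln (c h) = - (n%:R / a) * ln h. Proof. by rewrite expRK. Qed.

Let a0 : 0 < a. Proof. exact: lt_trans a1. Qed.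

Let hn h : 0 < h -> h ^- n = expR (- n%:R * ln h).
Proof. by move=> h0; rewrite mulNr expRN -powRE// powR_mulrn// ltW. Qed.

Section one_function.
Variable u : Rn R n -> R.
Hypotheses (mu : measurable_fun setT u) (u0 : forall y, 0 <= u y).
Hypothesis uK : (\int[leb n]_y (u y `^ a)%:E <= K%:E)%E.

Let muE : measurable_fun setT (EFin \o u). Proof. exact/measurable_EFinP. Qed.
Let mpow (r : R) : measurable_fun setT (fun y => (u y `^ r)%:E).
Proof. by apply/measurable_EFinP; apply: (measurableT_comp (measurable_powR r)). Qed.

Lemma cube_average_le_scale h x : 0 < h ->
  (cube_average 1 h (EFin \o u) x <= ((3 ^+ n + K) * c h)%:E)%E.
Proof.
move=> h0; have ca : c h `^ (1 - a) * h ^- n = c h.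
  by rewrite powRE// ln_c hn// -expRD; congr expR; field; rewrite (gt_eqF a0).
apply: (@le_trans _ _ (cube_average 1 h
    (fun y => (c h)%:E + (c h `^ (1 - a))%:E * (u y `^ a)%:E) x)%E).
  apply: le_cube_average => // [y|y _].
    by rewrite adde_ge0 ?mule_ge0 ?lee_fin ?powR_ge0 ?ltW.
  by rewrite -EFinM -EFinD lee_fin le_add_powR// ltW.
rewrite cube_averageD//; first last.
- by move=> y; rewrite mule_ge0// lee_fin powR_ge0.
- by move=> y; rewrite lee_fin ltW.
- exact: emeasurable_funM.
rewrite cube_averageZ// ?lee_fin ?powR_ge0//; last by move=> y; rewrite lee_fin powR_ge0.
rewrite mulrDl EFinD; apply: leeD.
  by rewrite cube_average_cst// -EFin_expe -EFinM.
rewrite -{2}ca mulrC -mulrA EFinM; apply: lee_wpmul2l; first by rewrite lee_fin powR_ge0.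
rewrite EFinM; apply: lee_wpmul2l; first exact: expn_inv_ge0.
apply: le_trans uK; apply: ge0_le_integral_subset => // y *; by rewrite lee_fin powR_ge0.
Qed.

Lemma cube_average_fin h x : 0 < h -> cube_average 1 h (EFin \o u) x \is a fin_num.
Proof.
move=> h0; rewrite ge0_fin_numE; last exact: cube_average_ge0.
exact: le_lt_trans (cube_average_le_scale x h0) (ltry _).
Qed.

Variable r : R.
Hypothesis ar : a < r.

Let r0 : 0 < r. Proof. exact: lt_trans ar. Qed.
Let r1 : 1 < r. Proof. exact: lt_trans ar. Qed.

Let lower h v : R := if v <= c h then v else 0.
Let upper h v : R := if v <= c h then 0 else v.

(** The cut of real interpolation between L^1 and L^r: v enters with its first power above the
    critical height and with its r-th power below, both scaled to give v^a at that height. *)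
Definition split_power h v : R :=
  c h `^ (a - 1) * upper h v + c h `^ (a - r) * lower h v `^ r.

Let lower_ge0 h v : 0 <= v -> 0 <= lower h v.
Proof. by rewrite /lower; case: ifP. Qed.
Let upper_ge0 h v : 0 <= v -> 0 <= upper h v.
Proof. by rewrite /upper; case: ifP. Qed.

Let split_power_ge0 h v : 0 <= v -> 0 <= split_power h v.
Proof. by move=> v0; rewrite addr_ge0 ?mulr_ge0 ?powR_ge0 ?upper_ge0. Qed.

Let mlower h : measurable_fun setT (fun y => lower h (u y)).
Proof. by apply: measurable_fun_ifT => //; exact: measurable_fun_ler. Qed.
Let mupper h : measurable_fun setT (fun y => upper h (u y)).
Proof. by apply: measurable_fun_ifT => //; exact: measurable_fun_ler. Qed.

Let msplit h : measurable_fun setT (fun y => (split_power h (u y))%:E).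
Proof.
apply/measurable_EFinP/measurable_funD; apply: measurable_funM => //.
by apply: (measurableT_comp (measurable_powR r)).
Qed.

(** With U the mean of u this is h^(-n) (h^n U^a)^(r / a), or c^(a - r) U^r for the critical height
    c. *)
Definition average_power h x : R :=
  expR (n%:R * (r / a - 1) * ln h) * fine (cube_average 1 h (EFin \o u) x) `^ r.

Let C1 : R := 2 * (3 ^+ n + K) `^ (r - 1).
Let C2 : R := 4 * (4 * 3 ^+ n) `^ (r - 1).

(** If the part of u above the critical height carries half of U, it bounds one factor U, and
    [cube_average_le_scale] bounds U^(r - 1). Otherwise the lower part carries half of U, and
    [le_add_powR] passes to the average of its r-th power. *)
Lemma average_power_le h x : 0 < h -> ((average_power h x)%:E <=
  (C1 + C2)%:E * cube_average 1 h (fun y => (split_power h (u y))%:E) x)%E.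
Proof.
move=> h0; have lu y : 0 <= lower h (u y) by exact: lower_ge0.
have uu y : 0 <= upper h (u y) by exact: upper_ge0.
have mlE : measurable_fun setT (fun y => (lower h (u y))%:E) by exact/measurable_EFinP.
have muE' : measurable_fun setT (fun y => (upper h (u y))%:E) by exact/measurable_EFinP.
have mlr : measurable_fun setT (fun y => (lower h (u y) `^ r)%:E).
  by apply/measurable_EFinP; apply: (measurableT_comp (measurable_powR r)).
pose A f := cube_average 1 h (fun y => (f (u y))%:E) x.
have Afin f (M : R) : 0 <= M -> (forall v, 0 <= v -> 0 <= f v <= v + M) -> A f \is a fin_num.
  move=> M0 fM; rewrite ge0_fin_numE; last first.
    by apply: cube_average_ge0 => // y; rewrite lee_fin; have /andP[] := fM _ (u0 y).
  apply: (@le_lt_trans _ _ (cube_average 1 h (fun y => (u y)%:E + M%:E) x)%E).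
    apply: le_cube_average => // y *.
    - by rewrite lee_fin; have /andP[] := fM _ (u0 y).
    - by rewrite adde_ge0 ?lee_fin.
    - by rewrite -EFinD lee_fin; have /andP[] := fM _ (u0 y).
  rewrite cube_averageD// cube_average_cst// -EFin_expe -EFinM lte_add_pinfty ?ltry//.
  by have := cube_average_fin x h0; rewrite ge0_fin_numE//; exact: cube_average_ge0.
have up_fin : A (upper h) \is a fin_num.
  by apply: (@Afin _ 0) => // v v0; rewrite addr0 /upper; case: ifP; rewrite ?lexx ?v0.
have low_fin : A (lower h) \is a fin_num.
  by apply: (@Afin _ 0) => // v v0; rewrite addr0 /lower; case: ifP; rewrite ?lexx ?v0.
have lowr_fin : A (fun v => lower h v `^ r) \is a fin_num.
  apply: (@Afin _ (c h `^ r)); rewrite ?powR_ge0// => v v0; rewrite powR_ge0/= /lower.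
  case: ifPn => vc; last by rewrite powR0 ?gt_eqF// addr_ge0// powR_ge0.
  by rewrite ler_wpDl// ge0_ler_powR ?nnegrE ?(ltW r0) ?(ltW (c_gt0 _)).
pose v1 := fine (A (upper h)); pose v2 := fine (A (lower h)).
pose w := fine (A (fun v => lower h v `^ r)).
pose U := fine (cube_average 1 h (EFin \o u) x).
have v10 : 0 <= v1 by apply/fine_ge0/cube_average_ge0.
have w0 : 0 <= w by apply/fine_ge0/cube_average_ge0 => // y; rewrite lee_fin powR_ge0.
have U0 : 0 <= U by apply/fine_ge0/cube_average_ge0.
have UE : U = v1 + v2.
  rewrite /U /v1 /v2 -fineD// -cube_averageD//; congr fine; congr (_ * _)%E.
  apply: eq_integral => y _; rewrite -EFinD /= /upper /lower.
  by case: ifP => _; rewrite ?add0r ?addr0.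
have Uc : U <= (3 ^+ n + K) * c h.
  by rewrite -lee_fin fineK ?cube_average_fin//; exact: cube_average_le_scale.
have v2w k : 0 < k -> v2 <= 3 ^+ n * k + k `^ (1 - r) * w.
  move=> k0; rewrite -lee_fin fineK// EFinD [(_ * w)%:E]EFinM fineK//.
  apply: (@le_trans _ _ (cube_average 1 h
      (fun y => k%:E + (k `^ (1 - r))%:E * (lower h (u y) `^ r)%:E) x)%E).
    apply: le_cube_average => // y *.
      by rewrite adde_ge0 ?mule_ge0 ?lee_fin ?powR_ge0 ?ltW.
    by rewrite -EFinM -EFinD lee_fin le_add_powR// ltW.
  rewrite cube_averageD//; first last.
  - by move=> y; rewrite mule_ge0// lee_fin powR_ge0.
  - by move=> y; rewrite lee_fin ltW.
  - exact: emeasurable_funM.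
  rewrite cube_averageZ// ?lee_fin ?powR_ge0//; last by move=> y; rewrite lee_fin powR_ge0.
  by apply: leeD => //; rewrite cube_average_cst// -EFin_expe -EFinM.
have -> : cube_average 1 h (fun y => (split_power h (u y))%:E) x =
    (c h `^ (a - 1) * v1 + c h `^ (a - r) * w)%:E.
  rewrite EFinD [(_ * v1)%:E]EFinM [(_ * w)%:E]EFinM !fineK//.
  rewrite -!cube_averageZ ?lee_fin ?powR_ge0//; last by move=> y; rewrite lee_fin powR_ge0.
  rewrite -cube_averageD//.
  - exact: emeasurable_funM.
  - exact: emeasurable_funM.
  - by move=> y; rewrite mule_ge0// lee_fin ?powR_ge0.
  - by move=> y; rewrite mule_ge0// lee_fin ?powR_ge0.
rewrite -EFinM lee_fin /average_power -/U.
have HE : expR (n%:R * (r / a - 1) * ln h) = c h `^ (a - r).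
  by rewrite powRE// ln_c; congr expR; field; rewrite (gt_eqF a0).
rewrite HE; have Hc : c h `^ (a - r) * c h `^ (r - 1) = c h `^ (a - 1).
  by rewrite !powRE// -expRD; congr expR; ring.
have B0 : 0 <= 3 ^+ n + K :> R by rewrite addr_ge0.
have C10 : 0 <= C1 by rewrite mulr_ge0// powR_ge0.
have C20 : 0 <= C2 by rewrite mulr_ge0// powR_ge0.
have p0 z : 0 <= c h `^ z by exact: powR_ge0.
have [->|Upos] := eqVneq U 0.
  rewrite powR0 ?(gt_eqF r0)// mulr0.
  by apply: mulr_ge0; apply: addr_ge0 => //; exact: mulr_ge0.
have {}Upos : 0 < U by rewrite lt_neqAle eq_sym Upos.
have Ur : U `^ r = U * U `^ (r - 1) by rewrite mulr_powRB1.
have [v1U|v1U] := leP (U / 2) v1.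
  apply: (@le_trans _ _ (C1 * (c h `^ (a - 1) * v1))); last first.
    apply: ler_pM => //; rewrite ?lerDl//; exact: mulr_ge0.
  rewrite -Hc /C1 Ur.
  have : U `^ (r - 1) <= (3 ^+ n + K) `^ (r - 1) * c h `^ (r - 1).
    by rewrite -powRM ?(ltW (c_gt0 _))// ge0_ler_powR ?nnegrE ?mulr_ge0 ?subr_ge0 ?(ltW r1) ?(ltW (c_gt0 _)).
  move=> UB; rewrite -mulrA mulrCA [leRHS](_ : _ = c h `^ (a - r) *
    ((2 * v1) * ((3 ^+ n + K) `^ (r - 1) * c h `^ (r - 1)))); last by ring.
  rewrite mulrCA ler_wpM2l// ler_pM ?powR_ge0//; lra.
apply: (@le_trans _ _ (C2 * (c h `^ (a - r) * w))); last first.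
  apply: ler_pM => //; rewrite ?lerDr//; exact: mulr_ge0.
rewrite [leRHS]mulrCA ler_wpM2l//.
have d0 : 0 < 4 * 3 ^+ n :> R by rewrite mulr_gt0// exprn_gt0.
(* With this threshold the first summand in [v2w] is U / 4, which v2 > U / 2 absorbs. *)
have k0 : 0 < U / (4 * 3 ^+ n) by rewrite divr_gt0.
have U4 : U / 4 <= (U / (4 * 3 ^+ n)) `^ (1 - r) * w.
  have := v2w _ k0; rewrite (_ : 3 ^+ n * _ = U / 4); last first.
    by field; rewrite expf_neq0.
  lra.
rewrite Ur /C2; apply: (@le_trans _ _ (4 * ((U / (4 * 3 ^+ n)) `^ (1 - r) * w) * U `^ (r - 1))).
  by rewrite ler_wpM2r ?powR_ge0//; lra.
rewrite le_eqVlt; apply/orP; left; apply/eqP.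
have -> : (U / (4 * 3 ^+ n)) `^ (1 - r) * w = w * ((4 * 3 ^+ n) `^ (r - 1) / U `^ (r - 1)).
  rewrite mulrC; congr (_ * _); rewrite -powRN !powRE// lnM ?posrE ?invr_gt0// lnV ?posrE//.
  by rewrite -expRD; congr expR; ring.
by field; rewrite gt_eqF// powR_gt0.
Qed.

Lemma measurable_average_power h : 0 < h -> measurable_fun setT (average_power h).
Proof.
move=> h0; apply: measurable_funM => //.
apply: (measurableT_comp (measurable_powR r)).
apply: (measurableT_comp (fine_measurable measurableT)).
exact: measurable_cube_average.
Qed.

Lemma average_power_ge0 h x : 0 <= average_power h x.
Proof. by rewrite mulr_ge0 ?expR_ge0 ?powR_ge0. Qed.

(** Self-adjointness, tested against the constant 1, shows that averaging over the blocks multiplies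
    an integral by 3^n. *)
Lemma integral_average_power_le h : 0 < h ->
  (\int[leb n]_x (average_power h x)%:E <=
   ((C1 + C2) * 3 ^+ n)%:E * \int[leb n]_x (split_power h (u x))%:E)%E.
Proof.
move=> h0; have C0 : 0 <= C1 + C2.
  by rewrite addr_ge0 ?mulr_ge0 ?powR_ge0 ?addr_ge0.
have s0 y : (0 <= (split_power h (u y))%:E)%E by rewrite lee_fin split_power_ge0.
apply: (@le_trans _ _ (\int[leb n]_x ((C1 + C2)%:E *
    cube_average 1 h (fun y => (split_power h (u y))%:E) x))%E).
  apply: ge0_le_lower_integral => x; first by rewrite lee_fin average_power_ge0.
  exact: average_power_le.
rewrite ge0_integralZl//; first last.
- by move=> x _; exact: cube_average_ge0.
- exact: measurable_cube_average.
rewrite EFinM -muleA; apply: lee_wpmul2l => //.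
have -> : (\int[leb n]_x cube_average 1 h (fun y => (split_power h (u y))%:E) x =
    \int[leb n]_x ((split_power h (u x))%:E * cube_average 1 h (cst 1) x))%E.
  rewrite -cube_average_adjoint//.
  by apply: eq_integral => x _; rewrite mule1.
under eq_integral do rewrite cube_average_cst// mule1.
rewrite ge0_integralZr//; first by rewrite -EFin_expe muleC.
by rewrite -EFin_expe lee_fin exprn_ge0.
Qed.

(** Relative to v^a the two branches are (c / v)^(a - 1) and (v / c)^(r - a), both decaying away
    from v = c. *)
Lemma split_power_le h v : 0 < h -> 0 < v ->
  split_power h v <= v `^ a * expR (- Num.min (a - 1) (r - a) * `|ln (c h) - ln v|).
Proof.
move=> h0 v0; rewrite /split_power /upper /lower.
set eta := Num.min _ _; have e1 : eta <= a - 1 by rewrite ge_min lexx.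
have e2 : eta <= r - a by rewrite ge_min lexx orbT.
have [vc|cv] := leP v (c h).
  have lvc : ln v <= ln (c h) by rewrite ler_ln ?posrE.
  rewrite mulr0 add0r !powRE// -!expRD ler_expR ger0_norm ?subr_ge0//; nra.
have lvc : ln (c h) <= ln v by rewrite ler_ln ?posrE// ltW.
rewrite powR0 ?(gt_eqF r0)// mulr0 addr0 -[X in _ * X](lnK v0) !powRE// -!expRD ler_expR.
rewrite ler0_norm ?subr_le0//; nra.
Qed.

Lemma split_power0 h : split_power h 0 = 0.
Proof.
by rewrite /split_power /upper /lower (ltW (c_gt0 h)) powR0 ?(gt_eqF r0)// !mulr0 addr0.
Qed.

End one_function.

(** Over dyadic h the numbers ln c(h) form an arithmetic progression, so at each point the sum over
    scales of [split_power] is at most a multiple of u^a. This stands in for the maximal theorem. *)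
Lemma sum_integral_average_power (r : R) : (0 < n)%N -> a < r -> exists2 C : R, 0 <= C &
  forall (u : Rn R n -> R) s, measurable_fun setT u -> (forall y, 0 <= u y) ->
    (\int[leb n]_y (u y `^ a)%:E <= K%:E)%E ->
    (\sum_(j <oo) \int[leb n]_x (average_power u r (scale s j) x)%:E <= C%:E)%E.
Proof.
move=> n0 ar; pose eta := Num.min (a - 1) (r - a).
have eta0 : 0 < eta by rewrite lt_min !subr_gt0 a1.
pose delta : R := n%:R / a * ln 2.
have delta0 : 0 < delta by rewrite mulr_gt0 ?divr_gt0 ?ltr0n// ln_gt0// ltr1n.
have [G G0 geoG] := nneseries_exp_dist_le eta0 delta0.
set C12 := ((2 * (3 ^+ n + K) `^ (r - 1) + 4 * (4 * 3 ^+ n) `^ (r - 1)) * 3 ^+ n : R).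
have C120 : 0 <= C12 by rewrite mulr_ge0 ?addr_ge0 ?mulr_ge0 ?powR_ge0 ?exprn_ge0.
exists (C12 * (G * K)); first by apply: mulr_ge0 => //; apply: mulr_ge0 => //; exact: ltW.
move=> u s mu u0 uK.
have sp0 j y : (0 <= (split_power r (scale s j) (u y))%:E)%E.
  rewrite lee_fin; apply: addr_ge0; apply: mulr_ge0; rewrite ?powR_ge0//.
  by case: ifP.
have msp j : measurable_fun setT (fun y => (split_power r (scale s j) (u y))%:E).
  apply/measurable_EFinP/measurable_funD; apply: measurable_funM => //.
    by apply: measurable_fun_ifT => //; exact: measurable_fun_ler.
  apply: (measurableT_comp (measurable_powR r)).
  by apply: measurable_fun_ifT => //; exact: measurable_fun_ler.
apply: (@le_trans _ _ (\sum_(j <oo) C12%:E *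
    \int[leb n]_x (split_power r (scale s j) (u x))%:E)%E).
  apply: lee_nneseries => j *.
    by apply: integral_ge0 => x _; rewrite lee_fin average_power_ge0.
  by apply: integral_average_power_le => //; exact: scale_gt0.
rewrite nneseriesZl; last by move=> j _; exact: integral_ge0.
rewrite [leRHS]EFinM; apply: lee_wpmul2l => //; rewrite -integral_nneseries//.
apply: (@le_trans _ _ (\int[leb n]_x (G%:E * (u x `^ a)%:E))%E); last first.
  rewrite ge0_integralZl//; [|by apply/measurable_EFinP; apply: (measurableT_comp (measurable_powR a))|by move=> *; rewrite lee_fin powR_ge0|by rewrite lee_fin ltW].
  by rewrite EFinM; apply: lee_wpmul2l => //; rewrite lee_fin ltW.
apply: ge0_le_lower_integral => x; first exact: nneseries_ge0.
have [ux0|ux] := eqVneq (u x) 0.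
  rewrite eseries0 ?mule_ge0 ?lee_fin ?powR_ge0 ?(ltW G0)// => j _ _.
  by rewrite ux0 split_power0.
have {}ux : 0 < u x by rewrite lt_neqAle eq_sym ux u0.
pose theta := (-1) ^+ s * ln (u x).
apply: (@le_trans _ _ (\sum_(j <oo) (u x `^ a)%:E *
    (expR (- eta * `|delta * j%:R - theta|))%:E)%E).
  apply: lee_nneseries => j *; first exact: sp0.
  rewrite -EFinM lee_fin; apply: le_trans (split_power_le ar _ ux) _; first exact: scale_gt0.
  rewrite ler_wpM2l ?powR_ge0// ler_expR -/eta !mulNr lerN2 ler_wpM2l ?(ltW eta0)//.
  rewrite ln_c ln_scale /theta /delta; case: (s) => /=.
    rewrite expr0 expr1 !mul1r -[leRHS]normrN le_eqVlt; apply/orP; left; apply/eqP.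
    by congr `|_|; ring.
  by rewrite expr0 expr1 le_eqVlt; apply/orP; left; apply/eqP; congr `|_|; ring.
rewrite nneseriesZl; last by move=> j _; rewrite lee_fin expR_ge0.
by rewrite muleC; apply: lee_wpmul2r; rewrite ?lee_fin ?powR_ge0.
Qed.

End averages_of_Lp.

(** * The weight and log-Hoelder continuity *)

Section weight.
Context {R : realType} {n : nat}.
Implicit Types (x y : Rn R n).

Let bracket (t : R) : R := (1 + (Num.floor t)%:~R ^+ 2)^-1.

(* At least a multiple of [(1 + |y|) ^ - 2n], and constant on unit cubes. *)
Definition weight y : R := \prod_(i < n) (1 + (cell_index 1 y i)%:~R ^+ 2)^-1.

Let d_gt0 (z : int) : 0 < 1 + z%:~R ^+ 2 :> R.
Proof. by rewrite ltr_pwDl// sqr_ge0. Qed.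

Lemma weight_gt0 y : 0 < weight y.
Proof. by apply: prodr_gt0 => i _; rewrite invr_gt0. Qed.

Lemma weight_le1 y : weight y <= 1.
Proof.
apply: prodr_ile1 => i; rewrite invr_ge0 ltW//=.
by rewrite invf_le1// lerDl sqr_ge0.
Qed.

Lemma weight_cube x y : cube 0 1 x y -> weight x = weight y.
Proof. by move=> /cube0P xy; rewrite /weight xy. Qed.

Lemma measurable_weight : measurable_fun setT weight.
Proof. apply: (cube_constant_measurable ltr01) => x y; exact: weight_cube. Qed.

Lemma tnth_le_euclid_norm y i : `|tnth y i : R| <= euclid_norm y.
Proof.
rewrite -sqrtr_sqr ler_sqrt; last by apply: sumr_ge0 => j _; exact: sqr_ge0.
by rewrite (bigD1 i)//= lerDl; apply: sumr_ge0 => j _; exact: sqr_ge0.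
Qed.

Lemma euclid_norm_ge0 y : 0 <= euclid_norm y.
Proof. exact: sqrtr_ge0. Qed.

Definition log_size y : R := ln (expR 1 + euclid_norm y).

Lemma expR1_ge2 : 2 <= expR 1 :> R.
Proof. by apply: le_trans (expR_ge1Dx _); lra. Qed.

Lemma log_size_ge1 y : 1 <= log_size y.
Proof.
rewrite -[1](@expRK R) ler_ln ?posrE ?expR_gt0//.
  by rewrite lerDl euclid_norm_ge0.
by rewrite ltr_wpDr ?expR_gt0 ?euclid_norm_ge0.
Qed.

(** For each coordinate t of y, 1 + floor(t)^2 <= 1 + (1 + |t|)^2 <= (e + |y|)^2, because e >= 2. *)
Lemma ln_weight_ge y : - (2 * n%:R) * log_size y <= ln (weight y).
Proof.
set e := expR 1 + euclid_norm y.
have e0 : 0 < e by rewrite ltr_wpDr ?expR_gt0 ?euclid_norm_ge0.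
rewrite -(expRK (- _ * _)) ler_ln ?posrE ?expR_gt0 ?weight_gt0//.
have -> : - (2 * n%:R) * log_size y = n%:R * (- 2 * log_size y) by ring.
rewrite expRM_natl -[X in _ ^+ X](card_ord n) -prodr_const; apply: ler_prod => i _.
rewrite expR_ge0/=; have -> : expR (- 2 * log_size y) = (e ^+ 2)^-1.
  by rewrite mulNr expRN -[2]/(2%:R) expRM_natl lnK.
rewrite lef_pV2 ?posrE ?exprn_gt0// /cell_index divr1.
set t : R := tnth y i; have te : `|t| <= euclid_norm y by exact: tnth_le_euclid_norm.
have f2 : (Num.floor t)%:~R ^+ 2 <= (1 + `|t|) ^+ 2.
  rewrite -[leLHS]real_normK ?num_real// lerXn2r ?nnegrE ?addr_ge0//.
  have := floor_le t; have := floorD1_gt t; rewrite intrD => t1 t2.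
  have := ler_norm t; have := ler_norm (- t); rewrite normrN => t3 t4.
  by rewrite ler_norml; apply/andP; split; lra.
apply: le_trans (lerD (lexx 1) f2) _; rewrite /e.
have := @expR1_ge2; have := normr_ge0 t; nra.
Qed.

Let bracket_le (t : R) : bracket t <= 3 * (1 + t ^+ 2)^-1.
Proof.
rewrite /bracket -[3]invrK -invfM lef_pV2 ?posrE ?d_gt0//; last first.
  by rewrite mulr_gt0// ltr_pwDl// sqr_ge0.
have := floor_le t; have := floorD1_gt t; rewrite intrD.
set z : R := (Num.floor t)%:~R => t1 t2.
rewrite mulrC ler_pdivrMr//.
have f1 : (t - z) ^+ 2 <= 1 by rewrite exprn_ile1//; lra.
have := sqr_ge0 (2 * z - t); have := sqr_ge0 z; nra.
Qed.

Let measurable_bracket : measurable_fun setT bracket.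
Proof.
apply: (measurableT_comp (f := fun z : R => (1 + z ^+ 2)^-1)).
  apply: continuous_measurable_fun; exact: continuous_oneDsqrV.
by apply: nondecreasing_measurable => // s t st; rewrite ler_int le_floor.
Qed.

(** The weight is a product over the coordinates, and each one-dimensional factor is at most 3 / (1
    + t^2). *)
Lemma integral_weight : (\int[leb n]_y (weight y)%:E < +oo)%E.
Proof.
have -> : (\int[leb n]_y (weight y)%:E =
    \prod_(i < n) \int[lebesgue_measure]_t (bracket t)%:E)%E.
  rewrite -(@integral_measure_power_prod _ (measurableTypeR R) R lebesgue_measure n
    (fun=> EFin \o bracket)).
  - by apply: eq_integral => y _; rewrite prodEFin; congr EFin; apply: eq_bigr => i _;
      rewrite /cell_index divr1.
  - move=> i; apply/measurable_EFinP; exact: measurable_bracket.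
  - by move=> i t; rewrite lee_fin invr_ge0 ltW.
have fin : (\int[lebesgue_measure]_t (bracket t)%:E < +oo)%E.
  apply: (@le_lt_trans _ _ (\int[lebesgue_measure]_t (3%:E * ((oneDsqr t)^-1)%:E))%E).
    apply: ge0_le_lower_integral => t; first by rewrite lee_fin invr_ge0 ltW.
    by rewrite -EFinM lee_fin bracket_le.
  have oneD0 (t : R) : 0 <= (oneDsqr t)^-1 by rewrite invr_ge0 addr_ge0// sqr_ge0.
  rewrite ge0_integralZl//; last first.
    apply/measurable_EFinP; apply: continuous_measurable_fun.
    exact: continuous_oneDsqrV.
  rewrite ge0_symfun_integralT//; [|exact: continuous_oneDsqrV|].
    rewrite -set_itvcy integral0y_oneDsqr -!EFinM; exact: ltry.
  by move=> t; rewrite /= /oneDsqr sqrrN.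
have fin_num : (\int[lebesgue_measure]_t (bracket t)%:E)%E \is a fin_num.
  by rewrite ge0_fin_numE//; apply: integral_ge0 => t _; rewrite lee_fin invr_ge0 ltW.
by rewrite ltey_eq prode_fin_num.
Qed.

End weight.

Section log_holder.
Context {R : realType} {n : nat}.
Hypothesis n0 : (0 < n)%N.
Implicit Types (x y : Rn R n) (h : R).

Lemma sqrt_sum_sqr_le (v : 'I_n -> R) :
  Num.sqrt (\sum_(i < n) v i ^+ 2) <= \sum_(i < n) `|v i|.
Proof.
have S0 : 0 <= \sum_(i < n) `|v i| by apply: sumr_ge0.
rewrite -[leRHS]ger0_norm// -sqrtr_sqr; apply: ler_wsqrtr.
rewrite expr2 mulr_suml; apply: ler_sum => i _.
rewrite -real_normK ?num_real// expr2 ler_wpM2l//.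
by rewrite (bigD1 i)//= lerDl; apply: sumr_ge0.
Qed.

Lemma cube1_coord_dist h x y i : 0 < h -> cube 1 h x y ->
  `|(tnth x i : R) - tnth y i| <= 2 * h.
Proof.
move=> h0 /(_ i); rewrite /cell_index.
set s := (tnth x i : R) / h; set t := (tnth y i : R) / h => st.
have -> : (tnth x i : R) - tnth y i = (s - t) * h.
  by rewrite /s /t mulrBl !divfK ?gt_eqF.
rewrite normrM (gtr0_norm h0) ler_pM2r//.
have : `|(Num.floor t)%:~R - (Num.floor s)%:~R| <= 1 :> R.
  by rewrite -intrB -intr_norm -[1]/(1%:~R) ler_int.
have := floor_le s; have := floorD1_gt s; have := floor_le t; have := floorD1_gt t.
rewrite !intrD !ler_norml => ? ? ? ? /andP[? ?]; apply/andP; split; lra.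
Qed.

Lemma cube1_dist h x y : 0 < h -> cube 1 h x y -> euclid_dist x y <= 2 * n%:R * h.
Proof.
move=> h0 xy; apply: (le_trans (sqrt_sum_sqr_le _)).
apply: (@le_trans _ _ (\sum_(i < n) 2 * h)).
  by apply: ler_sum => i _; exact: cube1_coord_dist.
by rewrite sumr_const card_ord -[leLHS]mulr_natr mulrAC.
Qed.

Let A : R := 1 + ln (2 * n%:R + 1).

Let A_ge1 : 1 <= A.
Proof. by rewrite lerDl ln_ge0// lerDr mulr_ge0. Qed.

Lemma log_size_cube1 h x y : 0 < h <= 1 -> cube 1 h x y -> log_size x <= A * log_size y.
Proof.
move=> /andP[h0 h1] xy.
have xyn : euclid_norm x <= n%:R * euclid_norm y + 2 * n%:R.
  apply: (le_trans (sqrt_sum_sqr_le _)).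
  apply: (@le_trans _ _ (\sum_(i < n) (euclid_norm y + 2))).
    apply: ler_sum => i _; apply: (@le_trans _ _ (`|tnth y i : R| + 2 * h)).
      rewrite -lerBlDl; apply: le_trans (cube1_coord_dist i h0 xy).
      exact: lerB_dist.
    apply: lerD; first exact: tnth_le_euclid_norm.
    by rewrite -[leRHS]mulr1 ler_wpM2l.
  by rewrite sumr_const card_ord -[leLHS]mulr_natr mulrDl mulrC.
have ey : 0 < expR 1 + euclid_norm y by rewrite ltr_wpDr ?expR_gt0 ?euclid_norm_ge0.
have ex : 0 < expR 1 + euclid_norm x by rewrite ltr_wpDr ?expR_gt0 ?euclid_norm_ge0.
have n21 : 0 < 2 * n%:R + 1 :> R by rewrite ltr_wpDl ?mulr_ge0.
apply: (@le_trans _ _ (ln (2 * n%:R + 1) + log_size y)).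
  rewrite -lnM ?posrE// ler_ln ?posrE ?mulr_gt0//.
  have n1 : 1 <= n%:R :> R by rewrite ler1n.
  have := @expR1_ge2 R; have := euclid_norm_ge0 y; nra.
have L1 : 0 <= ln (2 * n%:R + 1) :> R by rewrite ln_ge0// lerDr mulr_ge0.
have := log_size_ge1 y; rewrite /A; nra.
Qed.

Variables (p : Rn R n -> R) (C pinf : R).
Hypothesis C0 : 0 < C.
Hypothesis p_loc : forall x y, euclid_dist x y < 2^-1 ->
  `|p x - p y| <= C / - ln (euclid_dist x y).
Hypothesis p_inf : forall x, `|p x - pinf| <= C / log_size x.

Lemma log_holder_inf x : `|p x - pinf| * log_size x <= C.
Proof.
by have := log_size_ge1 x => l1; rewrite -ler_pdivlMr ?(lt_le_trans ltr01).
Qed.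

Let p_bnd x : `|p x - pinf| <= C.
Proof.
apply: (le_trans (p_inf x)); rewrite ler_pdivrMr ?(lt_le_trans ltr01)// ?log_size_ge1//.
by rewrite ler_peMr ?log_size_ge1// ltW.
Qed.

(** The factor [log_size x - ln h] joins both log-Hoelder conditions. The first part is handled by
    comparing p(x) and p(y) with the limit. For the second, the points are at distance at most 2 n
    h: once -ln h > 2 ln (4 n), minus the logarithm of the distance is at least -ln h / 2; for
    larger h the crude bound 2 C suffices. *)
Lemma log_holder_cube1 : exists2 C' : R, 0 < C' & forall h x y, 0 < h <= 1 ->
  cube 1 h x y -> `|p x - p y| * (log_size x - ln h) <= C'.
Proof.
have n1 : 1 <= n%:R :> R by rewrite ler1n.
pose l0 : R := 2 * ln (4 * n%:R).
have ln4 : 0 <= ln (4 * n%:R) :> R by apply: ln_ge0; lra.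
have l00 : 0 <= l0 by exact: mulr_ge0.
exists (C * (1 + A) + (2 * C + 2 * C * l0)).
  rewrite ltr_pwDl ?mulr_gt0 ?addr_ge0 ?mulr_ge0 ?(ltW C0)//.
  by rewrite (lt_le_trans ltr01)// lerDl (le_trans ler01).
move=> h x y h01 xy; have /andP[h0 h1] := h01.
have lx := log_size_ge1 x; have ly := log_size_ge1 y.
have pxy : `|p x - p y| <= `|p x - pinf| + `|p y - pinf|.
  by rewrite (distrC (p y)) ler_distD.
rewrite mulrBr -mulrN; apply: lerD.
  apply: (@le_trans _ _ ((`|p x - pinf| + `|p y - pinf|) * log_size x)).
    by rewrite ler_wpM2r// (le_trans ler01).
  rewrite mulrDl mulrDr mulr1 lerD ?log_holder_inf//.
  apply: (@le_trans _ _ (`|p y - pinf| * (A * log_size y))).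
    by rewrite ler_wpM2l// (log_size_cube1 h01 xy).
  by rewrite mulrCA mulrC ler_wpM2r ?log_holder_inf// (le_trans ler01).
have lnh : 0 <= - ln h by rewrite oppr_ge0 ln_le0.
have [hl|hl] := leP (- ln h) l0.
  apply: (@le_trans _ _ (2 * C * l0)); last by rewrite lerDr mulr_ge0// ltW.
  by apply: ler_pM => //; have := p_bnd x; have := p_bnd y; lra.
apply: (@le_trans _ _ (2 * C)); last by rewrite lerDl !mulr_ge0// ltW.
have n4 : 0 < 4 * n%:R :> R by lra.
have dle : euclid_dist x y <= 2 * n%:R * h by exact: cube1_dist.
(* At distance 0 the conventions for [ln] and the inverse turn the local condition into p(x) =
   p(y). *)
have [d0|d0] := eqVneq (euclid_dist x y) 0.
  have pxy0 : `|p x - p y| <= 0.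
    by have := @p_loc x y; rewrite d0 ln0// oppr0 invr0 mulr0; apply; rewrite invr_gt0.
  rewrite (_ : `|p x - p y| = 0) ?mul0r; first by rewrite mulr_ge0// ltW.
  by apply/eqP; rewrite eq_le pxy0 normr_ge0.
have {}d0 : 0 < euclid_dist x y by rewrite lt_neqAle eq_sym d0 sqrtr_ge0.
have n0R : 0 < n%:R :> R by lra.
have lnE : ln (4 * n%:R / 2 * h) = ln (4 * n%:R) - ln 2 + ln h.
  by rewrite -[RHS]expRK !expRD expRN !lnK ?posrE.
have lnd : ln (euclid_dist x y) <= ln (4 * n%:R) - ln 2 + ln h.
  rewrite -lnE ler_ln ?posrE ?mulr_gt0//.
  by rewrite (_ : 4 * n%:R / 2 = 2 * n%:R)//; lra.
have ln2 : 0 < ln 2 :> R by rewrite ln_gt0// ltr1n.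
have d2 : euclid_dist x y < 2^-1.
  rewrite -ltr_ln ?posrE ?invr_gt0// lnV ?posrE//; rewrite /l0 in hl; lra.
have : `|p x - p y| <= C / - ln (euclid_dist x y) by exact: p_loc.
have dpos : 0 < - ln (euclid_dist x y) by move: hl; rewrite /l0; lra.
rewrite ler_pdivlMr// => H.
have : - ln h / 2 <= - ln (euclid_dist x y) by move: hl; rewrite /l0; lra.
have := normr_ge0 (p x - p y); nra.
Qed.

End log_holder.

(** * Pointwise inequalities for scaled powers *)

Section pointwise.
Context {R : realType}.

Lemma powR_le1 (v z : R) : 0 <= v -> v <= 1 -> 0 <= z -> v `^ z <= 1.
Proof.
move=> v0 v1 z0; have := ge0_ler_powR z0 (x := v) (y := 1).
by rewrite !nnegrE powR1; exact.
Qed.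

(** Young's inequality with a natural number N in place of the conjugate exponent of a; the
    condition on N says that N is at least that exponent. Natural powers match the moments available
    for b. *)
Lemma mul_le_powers (a t w : R) (N : nat) : 1 < a -> (0 < N)%N ->
  1 <= (N%:R - 1) * (a - 1) -> 0 <= t -> 0 <= w -> t * w <= 1 + t ^+ N + w `^ a.
Proof.
move=> a1 N0 Na t0 w0; have tN : 0 <= t ^+ N by exact: exprn_ge0.
have wa : 0 <= w `^ a by exact: powR_ge0.
have tN1 : t <= 1 + t ^+ N.
  have [t1|t1] := leP t 1; first by rewrite (le_trans t1)// lerDl.
  by rewrite (@le_trans _ _ (t ^+ N)) ?lerDr// ler_eXnr// ltW.
have [w1|w1] := leP w 1.
  by apply: (@le_trans _ _ t); [rewrite ler_piMr|rewrite (le_trans tN1)// lerDl].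
have w0' : 0 < w by exact: lt_trans w1.
have lw : 0 < ln w by rewrite ln_gt0.
have [tw|tw] := leP t (w `^ (a - 1)).
  apply: (@le_trans _ _ (w `^ a)); last by rewrite lerDr addr_ge0.
  by rewrite -mulr_powRB1// ?(lt_trans _ a1)// mulrC ler_wpM2l.
have t0' : 0 < t by apply: le_lt_trans tw; exact: powR_ge0.
apply: (@le_trans _ _ (t ^+ N)); last by rewrite addrAC lerDr addr_ge0.
have lt : (a - 1) * ln w < ln t by rewrite -ln_powR ltr_ln ?posrE// powR_gt0.
rewrite -ler_ln ?posrE ?mulr_gt0 ?exprn_gt0// lnM ?posrE// lnXn// -mulr_natl.
have : 0 <= (N%:R - 1 : R) by rewrite subr_ge0 ler1n.
have : 0 < ln t by apply: lt_trans lt; rewrite mulr_gt0// subr_gt0.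
nra.
Qed.

(** With L = ln U the scaling is V = U^(a / p(x)). For f > V, (f / V)^a <= (f / V)^(p(y) / a) =
    f^(p(y) / a) U^-1 U^((p(x) - p(y)) / p(x)), and the last factor is bounded because |ln U| is at
    most a multiple of [lh]. *)
Lemma scaled_powR_le_small (a B C' px py lh L f u : R) : 1 < a -> 1 <= px -> a * a <= py ->
  0 <= B -> `|L| <= B * lh -> `|px - py| * lh <= C' -> 0 <= f -> f `^ (py / a) <= u ->
  (f / expR (a * L / px)) `^ a <= expR (B * C') * (1 + u / expR L).
Proof.
move=> a1 px1 apy B0 LB pC f0 fu.
have a0 : 0 < a by exact: lt_trans a1.
have px0 : 0 < px by exact: lt_le_trans px1.
set V := expR _; have V0 : 0 < V by exact: expR_gt0.
have u0 : 0 <= u by apply: le_trans fu; exact: powR_ge0.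
have lh0 : 0 <= B * lh by exact: le_trans LB.
have BC0 : 0 <= B * C'.
  apply: (@le_trans _ _ (`|px - py| * (B * lh))); first exact: mulr_ge0.
  by rewrite mulrCA ler_wpM2l.
have E1 : 1 <= expR (B * C') by rewrite -expR0 ler_expR.
have uL : 0 <= u / expR L by rewrite divr_ge0// expR_ge0.
have [fV|Vf] := leP f V.
  apply: (@le_trans _ _ 1); last first.
    by rewrite -[1]mulr1 ler_pM ?mulr1// lerDl.
  by apply: powR_le1; [rewrite divr_ge0// ltW|rewrite ler_pdivrMr// mul1r|exact: ltW].
have f0' : 0 < f by exact: lt_trans Vf.
apply: (@le_trans _ _ (expR (B * C') * (u / expR L))); last first.
  by rewrite ler_wpM2l ?expR_ge0// lerDr.
have lnVf : 0 <= ln f - a * L / px.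
  by rewrite subr_ge0 -[leLHS]expRK ler_ln ?posrE// ltW.
apply: (@le_trans _ _ (expR (B * C') * (f `^ (py / a) / expR L))); last first.
  by rewrite ler_wpM2l ?expR_ge0// ler_wpM2r// invr_ge0 expR_ge0.
have -> : f / V = expR (ln f - a * L / px) by rewrite expRD lnK ?posrE// expRN.
rewrite /powR gt_eqF ?expR_gt0// gt_eqF// expRK -expRN -!expRD ler_expR.
have apya : a <= py / a by rewrite ler_pdivlMr.
apply: (@le_trans _ _ (py / a * (ln f - a * L / px))); first exact: ler_wpM2r.
have -> : py / a * (ln f - a * L / px) = py / a * ln f - L + (px - py) * (L / px).
  by field; rewrite !gt_eqF.
rewrite addrC lerD2r.
apply: (le_trans (ler_norm _)); rewrite normrM normrM normfV (gtr0_norm px0).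
have : `|L| / px <= `|L| by rewrite ler_pdivrMr// ler_peMr.
have := normr_ge0 (px - py); have := normr_ge0 L => L0 D0 Lpx.
apply: (@le_trans _ _ (`|px - py| * (B * lh))).
  by apply: ler_wpM2l => //; exact: le_trans LB.
by rewrite mulrCA ler_wpM2l.
Qed.

(** The scaling now uses p(oo). For V < f <= 1 the exponent p(y) is exchanged for p(oo), unless f is
    below the power -M of e + |y|; then f is below w and hence below u. For f > 1 there is no
    exchange: f^a <= u, and L <= B2 controls the power of U. *)
Lemma scaled_powR_le_large (a M B2 C pinf py ly L f u w : R) : 1 < a -> a * a <= pinf ->
  a * a <= py -> 0 <= M -> 0 <= C -> 0 <= B2 -> L <= B2 -> `|py - pinf| * ly <= C ->
  1 <= ly -> 0 < w -> - M * ly <= ln w ->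
  0 <= f -> f `^ (py / a) + w <= u ->
  (f / expR (a * L / pinf)) `^ a <= expR (M * C + B2) * (1 + u / expR L).
Proof.
move=> a1 api apy M0 C0 B20 LB pC ly1 w0 lw f0 fwu.
have a0 : 0 < a by exact: lt_trans a1.
have pi0 : 0 < pinf by apply: lt_le_trans api; exact: mulr_gt0.
set V := expR _; have V0 : 0 < V by exact: expR_gt0.
have fp0 : 0 <= f `^ (py / a) by exact: powR_ge0.
have wu : w <= u by apply: le_trans fwu; rewrite lerDr.
have fu : f `^ (py / a) <= u by apply: le_trans fwu; rewrite lerDl ltW.
have u0 : 0 <= u by exact: le_trans fu.
have MC0 : 0 <= M * C by exact: mulr_ge0.
have E1 : 1 <= expR (M * C + B2) by rewrite -expR0 ler_expR addr_ge0.
have uL : 0 <= u / expR L by rewrite divr_ge0// expR_ge0.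
have [fV|Vf] := leP f V.
  apply: (@le_trans _ _ 1); last first.
    by rewrite -[1]mulr1 ler_pM ?mulr1// lerDl.
  by apply: powR_le1; [rewrite divr_ge0// ltW|rewrite ler_pdivrMr// mul1r|exact: ltW].
have f0' : 0 < f by exact: lt_trans Vf.
apply: (@le_trans _ _ (expR (M * C + B2) * (u / expR L))); last first.
  by rewrite ler_wpM2l ?expR_ge0// lerDr.
have lnVf : 0 <= ln f - a * L / pinf.
  by rewrite subr_ge0 -[leLHS]expRK ler_ln ?posrE// ltW.
have -> : f / V = expR (ln f - a * L / pinf) by rewrite expRD lnK ?posrE// expRN.
rewrite /powR gt_eqF ?expR_gt0// expRK.
have u0' : 0 < u by exact: lt_le_trans wu.
rewrite -[u](lnK u0') -expRN -!expRD ler_expR.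
have lnfu : py / a * ln f <= ln u by rewrite -ln_powR ler_ln ?posrE// powR_gt0.
have lnwu : ln w <= ln u by rewrite ler_ln ?posrE.
have apia : a <= pinf / a by rewrite ler_pdivlMr.
have apya : a <= py / a by rewrite ler_pdivlMr.
have [f1|f1] := leP f 1.
  have lf : ln f <= 0 by exact: ln_le0.
  apply: (@le_trans _ _ (pinf / a * (ln f - a * L / pinf))); first exact: ler_wpM2r.
  have -> : pinf / a * (ln f - a * L / pinf) = pinf / a * ln f - L.
    by field; rewrite !gt_eqF.
  suff : pinf / a * ln f <= M * C + ln u by lra.
  have [lflow|lflow] := leP (- M * ly) (ln f).
    have -> : pinf / a * ln f = py / a * ln f + (pinf - py) / a * ln f by ring.
    suff : (pinf - py) / a * ln f <= M * C by lra.
    apply: (le_trans (ler_norm _)); rewrite normrM normrM normfV (gtr0_norm a0) distrC.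
    apply: (@le_trans _ _ (`|py - pinf| * (M * ly))); last by rewrite mulrCA ler_wpM2l.
    apply: ler_pM => //; first by rewrite mulr_ge0// invr_ge0 ltW.
      by rewrite ler_pdivrMr// ler_peMr// ltW.
    by rewrite ler0_norm// lerNl -mulNr.
  have pia1 : 1 <= pinf / a by apply: le_trans apia; exact: ltW.
  apply: (@le_trans _ _ (ln f)); first by nra.
  by apply: (le_trans (ltW lflow)); lra.
have lf : 0 < ln f by rewrite ln_gt0.
have -> : a * (ln f - a * L / pinf) = a * ln f - (a * a / pinf) * L by ring.
have afu : a * ln f <= ln u by apply: le_trans lnfu; rewrite ler_wpM2r// ltW.
set k := a * a / pinf; have k1 : k <= 1 by rewrite ler_pdivrMr// mul1r.
have k0 : 0 <= k by rewrite divr_ge0 ?mulr_ge0// ltW.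
nra.
Qed.

End pointwise.

(** * The estimate at a single scale *)

Section single_scale.
Context {R : realType} {n : nat}.
Local Open Scope ereal_scope.

Lemma ae_le_cube_average_in c (h : R) (f g : Rn R n -> \bar R) x : (0 < h)%R ->
  (forall y, 0 <= f y) -> (forall y, 0 <= g y) ->
  {ae leb n, forall y, cube c h x y -> f y <= g y} ->
  cube_average c h f x <= cube_average c h g x.
Proof.
move=> h0 f0 g0 fg; apply: lee_wpmul2l; first exact: expn_inv_ge0.
rewrite (integral_mkcond (cube c h x)) (integral_mkcond (cube c h x) g).
apply: ge0_ae_le_lower_integral => [y|y|].
- by rewrite patchE; case: ifP.
- by rewrite patchE; case: ifP.
- by apply: filterS fg => y fgy; rewrite !patchE; case: ifPn => //; rewrite inE.
Qed.

Variables (a C1 KN : R) (N : nat).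
Hypotheses (a1 : (1 < a)%R) (N0 : (0 < N)%N) (Na : (1 <= (N%:R - 1) * (a - 1))%R).
Hypotheses (C10 : (0 <= C1)%R) (KN0 : (0 <= KN)%R).

Definition single_scale_constant : R :=
  3 ^+ n + 2 ^+ N * (3 ^+ n + KN) + C1 * (3 ^+ n + 1).

Lemma single_scale_constant_ge0 : (0 <= single_scale_constant)%R.
Proof.
apply: addr_ge0; last by rewrite mulr_ge0 ?addr_ge0.
by rewrite addr_ge0// mulr_ge0 ?addr_ge0.
Qed.

(** Young's inequality, applied after scaling f by V, separates |b(x) - b(y)| from f(y). The
    oscillation is then split at c: the part at x remains as a factor, the part at y has a bounded
    N-th moment. *)
Lemma single_scale (b f u : Rn R n -> R) (h c V U : R) x : (0 < h)%R -> (0 < V)%R -> (0 < U)%R ->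
  measurable_fun setT b -> measurable_fun setT f -> measurable_fun setT u ->
  (forall y, 0 <= f y)%R -> (forall y, 0 <= u y)%R ->
  cube_average 1 h (EFin \o u) x = U%:E ->
  cube_average 1 h (fun y => (`|b y - c| ^+ N)%:E) x <= KN%:E ->
  {ae leb n, forall y, cube 1 h x y -> ((f y / V) `^ a <= C1 * (1 + u y / U))%R} ->
  cube_average 1 h (fun y => (`|b x - b y| * f y)%:E) x <=
    (single_scale_constant * (1 + `|b x - c|) ^+ N * V)%:E.
Proof.
move=> h0 V0 U0 mb mf mu f0 u0 avU avb fV.
set t := `|b x - c|%R; have t0 : (0 <= t)%R by exact: normr_ge0.
have tN1 : (1 <= (1 + t) ^+ N)%R by rewrite exprn_ege1// lerDl.
have ttN : (t ^+ N <= (1 + t) ^+ N)%R by rewrite lerXn2r ?nnegrE ?addr_ge0// lerDr.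
pose k1 : R := (V * (1 + 2 ^+ N * t ^+ N + C1))%R.
pose k2 : R := (V * 2 ^+ N)%R.
pose k3 : R := (V * (C1 / U))%R.
have k10 : (0 <= k1)%R by rewrite mulr_ge0 ?(ltW V0)// !addr_ge0// mulr_ge0// exprn_ge0.
have k20 : (0 <= k2)%R by rewrite mulr_ge0 ?(ltW V0)// exprn_ge0.
have k30 : (0 <= k3)%R by rewrite mulr_ge0 ?(ltW V0)// divr_ge0// ltW.
have mbN : measurable_fun setT (fun y => (`|b y - c| ^+ N)%:E).
  apply/measurable_EFinP; apply: measurable_funX; apply: measurableT_comp => //.
  exact: measurable_funB.
have muE : measurable_fun setT (EFin \o u) by exact/measurable_EFinP.
apply: (@le_trans _ _ (cube_average 1 h (fun y => k1%:E + (k2%:E * (`|b y - c| ^+ N)%:E +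
    k3%:E * (u y)%:E)) x)).
  apply: ae_le_cube_average_in => // [y|y|].
  - by rewrite lee_fin mulr_ge0.
  - by rewrite !adde_ge0 ?mule_ge0 ?lee_fin ?exprn_ge0.
  apply: filterS fV => y fV /fV {}fV; rewrite -!EFinM -!EFinD lee_fin.
  have w0 : (0 <= f y / V)%R by rewrite divr_ge0// ltW.
  have -> : (`|b x - b y| * f y = V * (`|b x - b y| * (f y / V)))%R.
    by rewrite mulrCA [(V * (f y / V))%R]mulrC divfK// gt_eqF.
  have := mul_le_powers a1 N0 Na (normr_ge0 (b x - b y)%R) w0.
  have bN : (`|b x - b y| ^+ N <= 2 ^+ N * (t ^+ N + `|b y - c| ^+ N))%R.
    apply: le_trans (exprD_le N t0 (normr_ge0 _)).
    by rewrite lerXn2r ?nnegrE ?addr_ge0// /t (distrC (b y)) ler_distD.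
  move=> H; rewrite /k1 /k2 /k3 -!mulrA -!mulrDr ler_pM2l//.
  apply: (le_trans H); apply: (le_trans (lerD (lerD (lexx 1%R) bN) fV)).
  by rewrite le_eqVlt; apply/orP; left; apply/eqP; ring.
rewrite cube_averageD//; first last.
- by move=> y; rewrite adde_ge0 ?mule_ge0 ?lee_fin ?exprn_ge0.
- by apply: emeasurable_funD; apply: emeasurable_funM.
rewrite cube_averageD//; first last.
- by move=> y; rewrite mule_ge0 ?lee_fin.
- by move=> y; rewrite mule_ge0 ?lee_fin ?exprn_ge0.
- exact: emeasurable_funM.
- exact: emeasurable_funM.
rewrite cube_averageZ//.
rewrite (@cube_averageZ _ _ 1 h k3%:E (EFin \o u))// avU cube_average_cst// -EFin_expe.
apply: (@le_trans _ _ ((3 ^+ n)%:E * k1%:E + (k2%:E * KN%:E + k3%:E * U%:E))).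
  by apply: leeD => //; apply: leeD => //; apply: lee_wpmul2l.
rewrite -!EFinM -!EFinD lee_fin /k1 /k2 /k3.
have -> : (3 ^+ n * (V * (1 + 2 ^+ N * t ^+ N + C1)) + (V * 2 ^+ N * KN + V * (C1 / U) * U) =
  (3 ^+ n * 1 + 2 ^+ N * (3 ^+ n * t ^+ N + KN * 1) + (C1 * (3 ^+ n + 1)) * 1) * V)%R.
  by field; rewrite gt_eqF.
rewrite ler_pM2r// /single_scale_constant !mulrDl.
have e3 : (0 <= 3 ^+ n :> R)%R by rewrite exprn_ge0.
apply: lerD; last by rewrite ler_wpM2l// mulr_ge0 ?addr_ge0.
apply: lerD; first by rewrite ler_wpM2l.
by rewrite -mulrA ler_wpM2l ?exprn_ge0// mulrDl lerD// ler_wpM2l.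
Qed.

End single_scale.

(** * The sum over the scales *)

Lemma dist_inv_le (R : realType) (u v : R) : 1 <= u -> 1 <= v ->
  `|1 / u - 1 / v| <= `|u - v|.
Proof.
move=> u1 v1; have u0 : 0 < u by exact: lt_le_trans u1.
have v0 : 0 < v by exact: lt_le_trans v1.
have -> : 1 / u - 1 / v = - (u - v) / (u * v) by field; rewrite !gt_eqF.
rewrite normrM normfV (gtr0_norm (mulr_gt0 u0 v0)) normrN ler_pdivrMr ?mulr_gt0//.
by rewrite ler_peMr// mulr_ege1.
Qed.

Section exponent_change.
Context {R : realType}.

(** Passing from qi to qq multiplies xi by qq / qi. While xi >= - N' ls, closeness of the exponents
    makes this a bounded factor. Below that, with z = q1 / q2 <= qq / qi, half of z xi is at most ln
    w and the other half keeps the decay in kap; this fixes N' = 2 M / z. *)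
Lemma expR_exponent_change (xi kap qq qi q1 q2 ls C5 w M : R) : 0 < q1 ->
  q1 <= qq <= q2 -> q1 <= qi <= q2 -> 0 <= kap -> xi <= - kap ->
  `|qq / qi - 1| * ls <= C5 -> 1 <= ls -> 0 <= M -> 0 < w -> - M * ls <= ln w ->
  expR (xi * (qq / qi)) <= expR (2 * M * q2 / q1 * C5) *
    (expR xi + expR (- (q1 / q2 / 2) * kap) * w).
Proof.
move=> q10 /andP[q1q qq2] /andP[q1i qi2] kap0 xik HC ls1 M0 w0 lw.
have q20 : 0 < q2 by apply: lt_le_trans q10 _; exact: le_trans qq2.
have qi0 : 0 < qi by exact: lt_le_trans q1i.
set N' := 2 * M * q2 / q1; have N'0 : 0 <= N' by apply: divr_ge0; rewrite ?(ltW q10)// !mulr_ge0 ?(ltW q20).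
have C50 : 0 <= C5 by apply: le_trans HC; rewrite mulr_ge0// (le_trans ler01).
set rho := qq / qi in HC *; set z := q1 / q2.
have zrho : z <= rho.
  by rewrite ler_pdivrMr// mulrAC ler_pdivlMr// ler_pM// ltW.
have e0 : 0 <= expR xi := expR_ge0 _.
have e1 : 0 <= expR (- (z / 2) * kap) * w by rewrite mulr_ge0 ?expR_ge0// ltW.
have [xl|xl] := leP (- (N' * ls)) xi.
  apply: (@le_trans _ _ (expR (N' * C5) * expR xi)); last first.
    by rewrite ler_wpM2l ?expR_ge0// lerDl.
  rewrite -expRD ler_expR (_ : xi * rho = xi * (rho - 1) + xi); last by ring.
  rewrite lerD2r; apply: (le_trans (ler_norm _)); rewrite normrM.
  apply: (@le_trans _ _ ((N' * ls) * `|rho - 1|)).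
    by rewrite ler_wpM2r// ler0_norm; lra.
  by rewrite -mulrA ler_wpM2l// mulrC.
apply: (@le_trans _ _ (expR (- (z / 2) * kap) * w)); last first.
  apply: (@le_trans _ _ (1 * (expR xi + expR (- (z / 2) * kap) * w))).
    by rewrite mul1r lerDr.
  by rewrite ler_wpM2r ?addr_ge0// -expR0 ler_expR mulr_ge0.
rewrite -[w](lnK w0) -expRD ler_expR.
have z0 : 0 < z by rewrite divr_gt0.
have zN : z * N' = 2 * M by rewrite /z /N'; field; rewrite !gt_eqF.
have xi0 : xi <= 0 by lra.
have : xi * rho <= xi * z by rewrite ler_wnM2l.
have : z * xi <= z * - kap by rewrite ler_pM2l.
have : z * xi <= z * - (N' * ls) by rewrite ler_pM2l// ltW.
have -> : z * - (N' * ls) = - (2 * M * ls) by rewrite mulrN mulrA zN.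
lra.
Qed.

End exponent_change.

Section core.
Context {R : realType} {n m : nat}.
Implicit Types (x y : Rn R n) (h : R).

Lemma lee_prode (I : Type) (r : seq I) (A B : I -> \bar R) :
  (forall i, 0 <= A i)%E -> (forall i, A i <= B i)%E ->
  (\prod_(i <- r) A i <= \prod_(i <- r) B i)%E.
Proof.
move=> A0 AB; have : (0 <= \prod_(i <- r) A i <= \prod_(i <- r) B i)%E.
  elim/big_rec2 : _ => [|i x y _ /andP[x0 xy]]; first by rewrite lexx lee01.
  by rewrite mule_ge0//= lee_pmul.
by case/andP.
Qed.

Lemma poweR_add_le (y z : \bar R) (k : R) (Q : nat) : (0 <= y)%E -> (0 <= z)%E ->
  0 < k -> k <= Q%:R ->
  (poweR (y + z) k <= (2 ^+ Q)%:E * (poweR y k + poweR z k))%E.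
Proof.
move=> y0 z0 k0 kQ; wlog yz : y z y0 z0 / (y <= z)%E => [H|].
  have [yz|/ltW zy] := leP y z; first exact: H.
  by rewrite addeC [X in (_ * X)%E]addeC; exact: H.
apply: (@le_trans _ _ (poweR (2%:E * z) k)).
  apply: gt0_ler_poweR; rewrite ?(ltW k0)// ?in_itv/= ?leey ?adde_ge0 ?mule_ge0//.
  by rewrite EFinD ge0_muleDl// !mul1e leeD.
rewrite poweRM//; apply: lee_pmul; rewrite ?poweR_ge0//.
  by rewrite poweR_EFin lee_fin -powR_mulrn// ler_powR ?ler1n.
by rewrite leeDr// poweR_ge0.
Qed.

Hypothesis n0 : (0 < n)%N.
Variables (alpha q1 q2 a C' qinf : R) (N : nat) (KN : R).
Variables (p : 'I_m -> Rn R n -> R) (pinf : 'I_m -> R) (q : Rn R n -> R).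
Hypotheses (alpha0 : 0 < alpha) (q10 : 0 < q1) (a1 : 1 < a) (C'0 : 0 <= C').
Hypotheses (N0 : (0 < N)%N) (Na : 1 <= (N%:R - 1) * (a - 1)) (KN0 : 0 <= KN).
Hypothesis hq : forall x, alpha / n%:R = \sum_(i < m) 1 / p i x - 1 / q x.
Hypothesis p_loc : forall i h x y, 0 < h <= 1 -> cube 1 h x y ->
  `|p i x - p i y| * (log_size x - ln h) <= C'.
Hypothesis p_inf : forall i x, `|p i x - pinf i| * log_size x <= C'.
Hypothesis pinf_ge : forall i, a * a <= pinf i.
Hypothesis qinf12 : q1 <= qinf <= q2.
Hypothesis hqinf : alpha / n%:R = \sum_(i < m) 1 / pinf i - 1 / qinf.

Definition good_point x := (forall i, a * a <= p i x) /\ q1 <= q x <= q2.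

Hypothesis ae_good : {ae leb n, forall x, good_point x}.

Definition weight_mass : R := fine (\int[leb n]_y (weight y)%:E)%E.

Definition majorant_mass : R := m.+1%:R `^ a * (m%:R + weight_mass).

Let K := majorant_mass.

Let a0 : 0 < a. Proof. exact: lt_trans a1. Qed.

Let wm0 : 0 <= weight_mass.
Proof. by apply/fine_ge0/integral_ge0 => y _; rewrite lee_fin ltW// weight_gt0. Qed.

Let K0 : 0 <= K.
Proof. by rewrite mulr_ge0 ?powR_ge0 ?addr_ge0. Qed.

Let lnB : R := ln (3 ^+ n + K).

Let B_ge1 : 1 <= 3 ^+ n + K.
Proof. by rewrite ler_wpDr// exprn_ege1// ler1n. Qed.

Let lnB0 : 0 <= lnB. Proof. exact: ln_ge0. Qed.

Let A : R := 1 + ln (2 * n%:R + 1).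

Let A0 : 0 <= A.
Proof. by rewrite addr_ge0// ln_ge0// lerDr mulr_ge0. Qed.

Let Bound : R := 2 * n%:R * A + lnB + n%:R / a.

Let Bound0 : 0 <= Bound.
Proof. by rewrite !addr_ge0 ?mulr_ge0 ?invr_ge0 ?(ltW a0). Qed.

Let C1 : R := expR (Bound * C' + (2 * n%:R * C' + lnB)).

Definition point_constant : R := single_scale_constant (n := n) C1 KN N ^+ m *
  expR (a * lnB * (1 / q1 + alpha / n%:R)).

Section data.
(** The [pt] are Borel versions of the exponents [p], which are only Lebesgue measurable. *)
Variables (pt f b : 'I_m -> Rn R n -> R) (c : 'I_m -> R -> Rn R n -> R).
Hypothesis mpt : forall i, measurable_fun setT (pt i).
Hypothesis mf : forall i, measurable_fun setT (f i).
Hypothesis mb : forall i, measurable_fun setT (b i).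
Hypothesis pt_eq : {ae leb n, forall y, forall i, p i y = pt i y}.
Hypothesis f0 : forall i y, 0 <= f i y.
Hypothesis f_modular : forall i, (\int[leb n]_y (f i y `^ pt i y)%:E <= 1)%E.
Hypothesis c_moment : forall i h x, 0 < h ->
  (cube_average 1 h (fun y => (`|b i y - c i h x| ^+ N)%:E) x <= KN%:E)%E.

Definition majorant y : R := \sum_(i < m) f i y `^ (pt i y / a) + weight y.

Let u := majorant.

Let weight_u y : weight y <= u y.
Proof. by rewrite lerDr sumr_ge0// => i _; exact: powR_ge0. Qed.

Let u_gt0 y : 0 < u y. Proof. exact: lt_le_trans (weight_gt0 y) (weight_u y). Qed.

Let u0 y : 0 <= u y. Proof. exact/ltW/u_gt0. Qed.

Lemma measurable_fun_powR_var (g e : Rn R n -> R) : measurable_fun setT g ->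
  measurable_fun setT e -> measurable_fun setT (fun y => g y `^ e y).
Proof.
move=> mg me.
have -> : (fun y => g y `^ e y) = (fun y => if g y == 0 then (if e y == 0 then 1 else 0)
    else expR (e y * ln (g y))).
  by apply/funext => y; rewrite /powR; case: ifP => // _; case: ifP.
apply: measurable_fun_ifT.
- exact: measurable_fun_eqr.
- by apply: measurable_fun_ifT => //; exact: measurable_fun_eqr.
- apply: measurableT_comp => //; apply: measurable_funM => //.
  exact: measurableT_comp.
Qed.

Lemma measurable_majorant : measurable_fun setT u.
Proof.
apply: measurable_funD; last exact: measurable_weight.
apply: measurable_sum => i; apply: measurable_fun_powR_var => //.
exact: measurable_funM.
Qed.

(** Each of the m + 1 summands of u is at most S^(1/a), with S the sum of the f_i^(p_i) and the
    weight; for the weight this holds because it is at most 1. *)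
Lemma majorant_modular : (\int[leb n]_y (u y `^ a)%:E <= K%:E)%E.
Proof.
have mw : measurable_fun setT (EFin \o @weight R n).
  by apply/measurable_EFinP; exact: measurable_weight.
have w0 y : (0 <= (weight y)%:E :> \bar R)%E by rewrite lee_fin ltW// weight_gt0.
have mfp i : measurable_fun setT (fun y => (f i y `^ pt i y)%:E).
  by apply/measurable_EFinP; exact: measurable_fun_powR_var.
have fp0 i y : (0 <= (f i y `^ pt i y)%:E)%E by rewrite lee_fin powR_ge0.
apply: (@le_trans _ _ (\int[leb n]_y ((m.+1%:R `^ a)%:E *
    (\sum_(i < m) (f i y `^ pt i y)%:E + (weight y)%:E)))%E).
  apply: ge0_le_lower_integral => y; first by rewrite lee_fin powR_ge0.
  rewrite sumEFin -EFinD -EFinM lee_fin.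
  set S := _ + weight y.
  have fpy i : 0 <= f i y `^ pt i y by exact: powR_ge0.
  have fS i : f i y `^ pt i y <= S.
    rewrite /S (bigD1 i)//= -addrA lerDl addr_ge0 ?(ltW (weight_gt0 y))//.
    by apply: sumr_ge0.
  have wS : weight y <= S by rewrite lerDr sumr_ge0.
  have S0 : 0 <= S by apply: le_trans wS; exact/ltW/weight_gt0.
  have ai0 : 0 <= a^-1 by rewrite invr_ge0 ltW.
  have uS : u y <= m.+1%:R * S `^ a^-1.
    rewrite /u /majorant -natr1 mulrDl mul1r lerD//.
      rewrite mulr_natl -[X in _ *+ X](card_ord m) -sumr_const.
      by apply: ler_sum => i _; rewrite powRrM ge0_ler_powR ?nnegrE.
    apply: (@le_trans _ _ (weight y `^ a^-1)).
      rewrite ger1_powR ?weight_gt0 ?weight_le1//.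
      by rewrite invf_le1// ltW.
    by rewrite ge0_ler_powR ?nnegrE// ltW// weight_gt0.
  apply: (@le_trans _ _ ((m.+1%:R * S `^ a^-1) `^ a)).
    by rewrite ge0_ler_powR ?nnegrE ?(ltW a0)// mulr_ge0// powR_ge0.
  by rewrite powRM ?powR_ge0// -powRrM mulVf ?gt_eqF// powRr1.
have mS : measurable_fun setT (fun y => \sum_(i < m) (f i y `^ pt i y)%:E + (weight y)%:E)%E.
  by apply: emeasurable_funD => //; exact: emeasurable_sum.
have S0 y : (0 <= \sum_(i < m) (f i y `^ pt i y)%:E + (weight y)%:E)%E.
  by rewrite adde_ge0// sume_ge0.
rewrite ge0_integralZl ?lee_fin ?powR_ge0//.
rewrite EFinM; apply: lee_wpmul2l; first by rewrite lee_fin powR_ge0.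
have s0 y : (0 <= \sum_(i < m) (f i y `^ pt i y)%:E)%E by exact: sume_ge0.
have ms : measurable_fun setT (fun y => \sum_(i < m) (f i y `^ pt i y)%:E)%E.
  exact: emeasurable_sum.
rewrite ge0_integralD//.
rewrite EFinD; apply: leeD; last first.
  by rewrite /weight_mass fineK// ge0_fin_numE ?integral_weight// integral_ge0.
rewrite ge0_integral_sum//.
apply: (@le_trans _ _ (\sum_(i < m) 1)%E); first exact: lee_sum.
by rewrite sumEFin sumr_const card_ord.
Qed.

Definition majorant_mean h x : R := fine (cube_average 1 h (EFin \o u) x).

Let U := majorant_mean.

Let L h x := ln (U h x).

Let UE h x : 0 < h -> (cube_average 1 h (EFin \o u) x = (U h x)%:E)%E.
Proof.
move=> h0; rewrite fineK//; apply: (@cube_average_fin _ _ a K) => //.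
- exact: measurable_majorant.
- exact: majorant_modular.
Qed.

Let U_ge h x k : 0 < h -> 0 <= k -> (forall y, cube 1 h x y -> k <= u y) -> k <= U h x.
Proof.
move=> h0 k0 ku; rewrite -lee_fin -UE//.
apply: (@le_trans _ _ (cube_average 1 h (cst k%:E) x)).
  by rewrite cube_average_cst// -EFin_expe -EFinM lee_fin ler_peMl// exprn_ege1// ler1n.
apply: le_cube_average => // y *; rewrite lee_fin//; exact: ku.
Qed.

(** The weight keeps U positive whatever f is, so that [L] is a genuine logarithm. *)
Let U_gt0 h x : 0 < h -> 0 < U h x.
Proof.
move=> h0; pose M := \sum_(i < n) (`|tnth x i : R| + 2 * h).
have M0 : 0 <= M by apply: sumr_ge0 => i _; rewrite addr_ge0// mulr_ge0// ltW.
pose k := expR (- (2 * n%:R) * ln (expR 1 + M)).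
apply: (@lt_le_trans _ _ k); first exact: expR_gt0.
apply: U_ge => // [|y xy]; first exact: expR_ge0.
apply: le_trans (weight_u y).
rewrite -ler_ln ?posrE ?expR_gt0 ?weight_gt0// expRK.
apply: le_trans (ln_weight_ge y); rewrite !mulNr lerN2 ler_wpM2l ?mulr_ge0//.
rewrite ler_ln ?posrE ?ltr_wpDr ?expR_gt0 ?euclid_norm_ge0// lerD2l.
apply: (le_trans (sqrt_sum_sqr_le _)); apply: ler_sum => i _.
rewrite -lerBlDl; apply: le_trans (cube1_coord_dist i h0 xy).
by rewrite distrC; exact: lerB_dist.
Qed.

Let L_le h x : 0 < h -> L h x <= lnB - n%:R / a * ln h.
Proof.
move=> h0; have Bpos : 0 < 3 ^+ n + K by exact: lt_le_trans B_ge1.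
rewrite -[leRHS]expRK ler_ln ?posrE ?expR_gt0 ?U_gt0// expRD lnK ?posrE//.
rewrite -lee_fin -UE// -mulNr; apply: cube_average_le_scale => //.
- exact: measurable_majorant.
- exact: majorant_modular.
Qed.

Let L_ge h x : 0 < h <= 1 -> - (2 * n%:R * A * log_size x) <= L h x.
Proof.
move=> h01; have /andP[h0 h1] := h01.
rewrite -[leLHS]expRK ler_ln ?posrE ?expR_gt0 ?U_gt0//.
apply: U_ge => // y xy.
apply: le_trans (weight_u y).
rewrite -ler_ln ?posrE ?expR_gt0 ?weight_gt0// expRK.
apply: le_trans (ln_weight_ge y); rewrite !mulNr lerN2 -!mulrA ler_wpM2l// ler_wpM2l//.
exact: log_size_cube1 h01 (cube_sym xy).
Qed.

(** From below the weight controls U, from above the critical height does. The result is exactly the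
    size of ln U that log-Hoelder continuity can compensate. *)
Let L_abs h x : 0 < h <= 1 -> `|L h x| <= Bound * (log_size x - ln h).
Proof.
move=> h01; have /andP[h0 h1] := h01.
have l1 := log_size_ge1 x; have lh : ln h <= 0 by exact: ln_le0.
have na0 : 0 <= n%:R / a by rewrite divr_ge0// ltW.
have nA : 0 <= 2 * n%:R * A by rewrite !mulr_ge0.
have := L_ge x h01; have := L_le x h0; rewrite /Bound ler_norml => H1 H2.
set s := 2 * n%:R * A in nA H2 *; set r := n%:R / a in na0 H1 *.
have z0 : 0 <= log_size x - ln h by lra.
have s1 : 0 <= s * - ln h by rewrite mulr_ge0// oppr_ge0.
have s2 : s <= s * log_size x by rewrite ler_peMr.
have s3 : 0 <= lnB * (log_size x - ln h) by exact: mulr_ge0.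
have s4 : lnB <= lnB * log_size x by rewrite ler_peMr.
have s5 : 0 <= lnB * - ln h by rewrite mulr_ge0// oppr_ge0.
have s6 : 0 <= r * log_size x by rewrite mulr_ge0// (le_trans ler01).
have s7 : 0 <= r * - ln h by rewrite mulr_ge0// oppr_ge0.
have -> : (s + lnB + r) * (log_size x - ln h) = s * log_size x + s * - ln h +
  (lnB * log_size x + lnB * - ln h) + (r * log_size x + r * - ln h) by ring.
by apply/andP; split; lra.
Qed.

Let dev i h x : R := 1 + `|b i x - c i h x|.

Let dev_ge1 i h x : 1 <= dev i h x.
Proof. by rewrite lerDl. Qed.

Definition commutator_average i h x : \bar R :=
  cube_average 1 h (fun y => (`|b i x - b i y| * f i y)%:E) x.

Lemma commutator_average_ge0 i h x : 0 < h -> (0 <= commutator_average i h x)%E.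
Proof. by move=> h0; apply: cube_average_ge0 => // y; rewrite lee_fin mulr_ge0. Qed.

Let SC := single_scale_constant (n := n) C1 KN N.

Let SC0 : 0 <= SC.
Proof. by apply: single_scale_constant_ge0 => //; exact: expR_ge0. Qed.

Let commutator_average_small i h x : 0 < h <= 1 -> good_point x ->
  (commutator_average i h x <= (SC * dev i h x ^+ N * expR (a * L h x / p i x))%:E)%E.
Proof.
move=> h01 [px _]; have /andP[h0 h1] := h01.
apply: (single_scale a1 N0 Na (expR_ge0 _) KN0 (u := u) (U := U h x)) => //.
- exact: expR_gt0.
- exact: U_gt0.
- exact: measurable_majorant.
- exact: UE.
- exact: c_moment.
apply: filterS2 ae_good pt_eq => y [py _] pty xy.
have px1 : 1 <= p i x by apply: le_trans (px i); rewrite mulr_ege1 ?ltW.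
have := @scaled_powR_le_small _ a Bound C' (p i x) (p i y) (log_size x - ln h) (L h x)
  (f i y) (u y) a1 px1 (py i) Bound0 (L_abs x h01) (p_loc i h01 xy) (f0 i y).
rewrite [expR (L h x)]lnK ?posrE ?U_gt0// => H; apply: (le_trans (H _)).
  rewrite pty /u /majorant (bigD1 i)//= -addrA lerDl addr_ge0 ?(ltW (weight_gt0 y))//.
  by apply: sumr_ge0 => j _; exact: powR_ge0.
rewrite ler_wpM2r ?addr_ge0 ?divr_ge0 ?(ltW (U_gt0 x h0))// ler_expR lerDl.
by rewrite addr_ge0// !mulr_ge0.
Qed.

Let commutator_average_large i h x : 1 <= h ->
  (commutator_average i h x <= (SC * dev i h x ^+ N * expR (a * L h x / pinf i))%:E)%E.
Proof.
move=> h1; have h0 : 0 < h by exact: lt_le_trans h1.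
apply: (single_scale a1 N0 Na (expR_ge0 _) KN0 (u := u) (U := U h x)) => //.
- exact: expR_gt0.
- exact: U_gt0.
- exact: measurable_majorant.
- exact: UE.
- exact: c_moment.
apply: filterS2 ae_good pt_eq => y [py _] pty xy.
have n20 : 0 <= 2 * n%:R :> R by rewrite mulr_ge0.
have LB : L h x <= lnB.
  by apply: (le_trans (L_le x h0)); rewrite gerBl mulr_ge0 ?ln_ge0// divr_ge0// ltW.
have := @scaled_powR_le_large _ a (2 * n%:R) lnB C' (pinf i) (p i y) (log_size y) (L h x)
  (f i y) (u y) (weight y) a1 (pinf_ge i) (py i) n20 C'0 lnB0 LB (p_inf i y)
  (log_size_ge1 y) (weight_gt0 y) (ln_weight_ge y) (f0 i y).
rewrite [expR (L h x)]lnK ?posrE ?U_gt0// => H; apply: (le_trans (H _)).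
  rewrite pty /u /majorant (bigD1 i)//= -addrA lerD2l lerDr.
  by apply: sumr_ge0 => j _; exact: powR_ge0.
rewrite ler_wpM2r ?addr_ge0 ?divr_ge0 ?(ltW (U_gt0 x h0))// ler_expR lerDr.
exact: mulr_ge0.
Qed.

Definition scale_term h x : \bar R :=
  ((expR (alpha * ln h))%:E * \prod_(i < m) commutator_average i h x)%E.

(** The logarithm of h^n U^a, shifted by its upper bound so as to be nonpositive. *)
Definition tau h x : R := n%:R * ln h + a * L h x - a * lnB.

Let tau_le0 h x : 0 < h -> tau h x <= 0.
Proof.
move=> h0; have := L_le x h0 => H.
have : a * L h x <= a * (lnB - n%:R / a * ln h) by rewrite ler_wpM2l// ltW.
have -> : a * (lnB - n%:R / a * ln h) = a * lnB - n%:R * ln h.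
  by field; rewrite gt_eqF.
rewrite /tau; lra.
Qed.

Let delta : R := alpha * q1 / n%:R.

Let nR0 : 0 < n%:R :> R. Proof. by rewrite ltr0n. Qed.

(** The exponents 1 / p_i sum to 1 / q + alpha / n, so the scalings multiply to U^(a / q + a alpha /
    n). The second part and h^alpha combine to (h^n U^a)^(alpha / n), a gain alpha q / n inside the
    power 1 / q; as tau <= 0 it may be lowered to [delta]. *)
Let scale_term_le (qq : R) (pp : 'I_m -> R) h x : 0 < h -> q1 <= qq ->
  alpha / n%:R = \sum_(i < m) 1 / pp i - 1 / qq ->
  (forall i, (commutator_average i h x <=
    (SC * dev i h x ^+ N * expR (a * L h x / pp i))%:E)%E) ->
  (scale_term h x <= (point_constant * (\prod_(i < m) dev i h x ^+ N *
    expR ((- n%:R * ln h + (1 + delta) * tau h x) / qq)))%:E)%E.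
Proof.
move=> h0 q1q sumpp Hi; have qq0 : 0 < qq by exact: lt_le_trans q1q.
apply: (@le_trans _ _ ((expR (alpha * ln h))%:E *
    \prod_(i < m) (SC * dev i h x ^+ N * expR (a * L h x / pp i))%:E)%E).
  apply: lee_wpmul2l; first by rewrite lee_fin expR_ge0.
  by apply: lee_prode => // i; exact: commutator_average_ge0.
rewrite prodEFin -EFinM lee_fin !big_split/= prodr_const card_ord.
have -> : \prod_(i < m) expR (a * L h x / pp i) = expR (a * L h x * (1 / qq + alpha / n%:R)).
  rewrite -expR_sum; congr expR; rewrite sumpp addrCA subrr addr0 mulr_sumr.
  by apply: eq_bigr => i _; rewrite mul1r.
set P := \prod_(i < m) dev i h x ^+ N.
have P0 : 0 <= P by apply: prodr_ge0 => i _; rewrite exprn_ge0// (le_trans ler01).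
rewrite /point_constant -/SC.
have -> : expR (alpha * ln h) * (SC ^+ m * P * expR (a * L h x * (1 / qq + alpha / n%:R))) =
  SC ^+ m * P * (expR (alpha * ln h + a * L h x * (1 / qq + alpha / n%:R))).
  by rewrite expRD; ring.
have -> : SC ^+ m * expR (a * lnB * (1 / q1 + alpha / n%:R)) *
    (P * expR ((- n%:R * ln h + (1 + delta) * tau h x) / qq)) =
  SC ^+ m * P * expR (a * lnB * (1 / q1 + alpha / n%:R) +
    (- n%:R * ln h + (1 + delta) * tau h x) / qq).
  by rewrite expRD; ring.
rewrite ler_wpM2l ?mulr_ge0 ?exprn_ge0// ler_expR.
have -> : alpha * ln h + a * L h x * (1 / qq + alpha / n%:R) =
   a * lnB * (1 / qq + alpha / n%:R) + (- n%:R * ln h + (1 + alpha * qq / n%:R) * tau h x) / qq.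
  by rewrite /tau; field; rewrite !gt_eqF.
apply: lerD.
  rewrite ler_wpM2l ?mulr_ge0 ?(ltW a0)// lerD2r !mul1r lef_pV2 ?posrE//.
rewrite ler_pM2r ?invr_gt0// lerD2l.
have := tau_le0 x h0; have : delta <= alpha * qq / n%:R.
  by rewrite /delta ler_pM2r ?invr_gt0// ler_wpM2l// ltW.
nra.
Qed.

Let scale_term_small h x : 0 < h <= 1 -> good_point x ->
  (scale_term h x <= (point_constant * (\prod_(i < m) dev i h x ^+ N *
    expR ((- n%:R * ln h + (1 + delta) * tau h x) / q x)))%:E)%E.
Proof.
move=> h01 gx; have /andP[h0 h1] := h01; have [_ /andP[q1x _]] := gx.
apply: (@scale_term_le _ (p ^~ x)) => // i.
exact: commutator_average_small.
Qed.

Let scale_term_large h x : 1 <= h ->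
  (scale_term h x <= (point_constant * (\prod_(i < m) dev i h x ^+ N *
    expR ((- n%:R * ln h + (1 + delta) * tau h x) / qinf)))%:E)%E.
Proof.
move=> h1; have h0 : 0 < h by exact: lt_le_trans h1.
have /andP[q1x _] := qinf12.
by apply: (@scale_term_le _ pinf) => // i; exact: commutator_average_large.
Qed.

Variables (Q : nat) (KM : R).
Hypotheses (q2Q : q2 <= Q%:R) (KM0 : 0 <= KM).
Hypothesis c_constant : forall i h, 0 < h -> cube_constant h (EFin \o c i h).
Hypothesis c_ladder : forall i h x j, 0 < h ->
  `|c i h x - c i (2 ^+ j * h) x| <= j%:R * (1 + 2 ^+ n).
Hypothesis c_moment_high : forall i h x, 0 < h ->
  (cube_average 0 h (fun y => (`|b i y - c i h x| ^+ (N * Q * m))%:E) x <= KM%:E)%E.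

Let D : R := 1 + 2 ^+ n.

Let D_ge1 : 1 <= D. Proof. by rewrite lerDl. Qed.

Let scale_ladder s i j k x :
  `|c i (scale s j) x - c i (scale s k) x| <= `|j%:R - k%:R| * D.
Proof.
wlog jk : j k / (j <= k)%N => [H|].
  have [/H//|/ltnW/H kj] := leqP j k.
  by rewrite distrC (distrC j%:R).
have jkE : `|j%:R - k%:R| = (k - j)%N%:R :> R.
  by rewrite distrC natrB// ger0_norm// subr_ge0 ler_nat.
rewrite jkE /scale; case: s.
  rewrite (_ : 2 ^+ k = 2 ^+ (k - j) * 2 ^+ j); last by rewrite -exprD subnK.
  by apply: c_ladder; exact: exprn_gt0.
rewrite distrC (_ : 2 ^- j = 2 ^+ (k - j) * 2 ^- k); last first.
  rewrite (_ : 2 ^+ k = 2 ^+ (k - j) * 2 ^+ j); last by rewrite -exprD subnK.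
  by rewrite invfM mulrA mulfV ?mul1r// expf_neq0.
by apply: c_ladder; rewrite invr_gt0 exprn_gt0.
Qed.

Let dev_ladder s i j k x :
  dev i (scale s j) x <= D * (1 + `|j%:R - k%:R|) * dev i (scale s k) x.
Proof.
have H := scale_ladder s i k j x; set t := `|j%:R - k%:R|.
have t0 : 0 <= t by exact: normr_ge0.
apply: (@le_trans _ _ (dev i (scale s k) x + t * D)).
  rewrite /dev -addrA lerD2l; apply: (le_trans (ler_distD (c i (scale s k) x) _ _)).
  by rewrite lerD2l /t (distrC j%:R).
have := dev_ge1 i (scale s k) x; have := D_ge1; set d := dev _ _ _ => D1 d1.
have : 0 <= t * D * (d - 1) by rewrite !mulr_ge0 ?subr_ge0// (le_trans ler01).
have : d <= D * d by rewrite ler_peMl// (le_trans ler01).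
nra.
Qed.

Let Phi h x : R := \prod_(i < m) dev i h x ^+ N.

Let Phi_ge1 h x : 1 <= Phi h x.
Proof.
rewrite /Phi; elim/big_rec : _ => // i z _ z1.
by rewrite mulr_ege1// exprn_ege1.
Qed.

Let Phi_ge0 h x : 0 <= Phi h x. Proof. exact: le_trans ler01 (Phi_ge1 h x). Qed.

(** Between scales j and k each cell constant moves by at most D |j - k|; m factors of power N give
    the degree N m. *)
Let Phi_ladder s x j k :
  Phi (scale s j) x <= D ^+ (N * m) * (1 + `|j%:R - k%:R|) ^+ (N * m) * Phi (scale s k) x.
Proof.
rewrite -exprMn; set z := D * _.
have -> : z ^+ (N * m) = \prod_(i < m) z ^+ N by rewrite prodr_const card_ord exprM.
rewrite -big_split/=.
apply: ler_prod => i _; rewrite exprn_ge0 ?(le_trans ler01)//= -exprMn.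
have dev0 h y : 0 <= dev i h y by exact: le_trans ler01 (dev_ge1 i h y).
have z0 : 0 <= z by rewrite mulr_ge0 ?addr_ge0// (le_trans ler01 D_ge1).
by apply: lerXn2r; [rewrite nnegrE dev0|rewrite nnegrE mulr_ge0 ?dev0|exact: dev_ladder].
Qed.

Let Psi h x : R := Phi h x ^+ Q.

Let r : R := a * (1 + delta / 4).

Let delta0 : 0 < delta. Proof. by rewrite divr_gt0// mulr_gt0. Qed.

Let ar : a < r. Proof. by rewrite ltr_pMr// ltrDl divr_gt0. Qed.

Let W h x : R := average_power a u r h x.

Let W_ge h x : 0 < h -> expR (- n%:R * ln h + (1 + delta / 4) * tau h x) <= W h x.
Proof.
move=> h0; rewrite /W /average_power -/(U h x) powRE ?U_gt0// -expRD ler_expR /r /tau.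
rewrite (_ : n%:R * _ * ln h = n%:R * (delta / 4) * ln h); last first.
  by rewrite [a * _]mulrC mulfK ?gt_eqF//; ring.
have : 0 <= (1 + delta / 4) * (a * lnB).
  by rewrite mulr_ge0 ?mulr_ge0 ?(ltW a0)// addr_ge0// ltW// divr_gt0.
rewrite -/(L h x); lra.
Qed.

Let W0 h x : 0 <= W h x. Proof. exact: average_power_ge0. Qed.

Let mW h : 0 < h -> measurable_fun setT (W h).
Proof. by move=> h0; apply: measurable_average_power => //; exact: measurable_majorant. Qed.

Let Psi0 h x : 0 <= Psi h x. Proof. exact: exprn_ge0. Qed.

Let PsiW s x : \bar R := (\sum_(j <oo) (Psi (scale s j) x * W (scale s j) x)%:E)%E.

Let PsiW_term s x k : ((Psi (scale s k) x * W (scale s k) x)%:E <= PsiW s x)%E.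
Proof.
have f_ge0 j : (0 <= (Psi (scale s j) x * W (scale s j) x)%:E)%E.
  by rewrite lee_fin mulr_ge0.
apply: (@le_trans _ _ (\sum_(0 <= j < k.+1) (Psi (scale s j) x * W (scale s j) x)%:E)%E).
  by rewrite big_nat_recr//= leeDr// sume_ge0.
by apply: nneseries_lim_ge => j _.
Qed.

Variables (Cg : bool -> R).
Hypothesis Cg0 : forall s, 0 < Cg s.
Hypothesis near_argmax : forall s (qq M : R) (t P : nat -> R), q1 <= qq <= q2 ->
    (forall j, t j <= 0) -> (forall j, 0 <= P j) ->
    (forall j k, P j <= D ^+ (N * m) * (1 + `|j%:R - k%:R|) ^+ (N * m) * P k) ->
    (forall j, - (n%:R * ((-1) ^+ (~~ s) * ln 2)) * j%:R + (1 + delta / 4) * t j <= M) ->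
  exists k, (\sum_(j <oo) (P j *
      expR ((- (n%:R * ((-1) ^+ (~~ s) * ln 2)) * j%:R + (1 + delta) * t j) / qq))%:E <=
    (Cg s * (P k *
      expR ((- (n%:R * ((-1) ^+ (~~ s) * ln 2)) * k%:R + (1 + delta / 4) * t k) / qq)))%:E)%E.

Let ln_scaleE s j : - n%:R * ln (scale s j) = - (n%:R * ((-1) ^+ (~~ s) * ln 2)) * j%:R :> R.
Proof. by rewrite ln_scale; ring. Qed.

Definition half_sum s x : \bar R := (\sum_(j <oo) scale_term (scale s j) x)%E.

Lemma half_sum_ge0 s x : (0 <= half_sum s x)%E.
Proof.
apply: nneseries_ge0 => j _ _; rewrite mule_ge0 ?lee_fin ?expR_ge0// prode_ge0// => i _.
by apply: commutator_average_ge0; exact: scale_gt0.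
Qed.

Let PC0 : 0 <= point_constant.
Proof. by rewrite mulr_ge0 ?exprn_ge0 ?expR_ge0. Qed.

Let half_sum_le s qq x : q1 <= qq <= q2 ->
  (forall j, (scale_term (scale s j) x <= (point_constant * (Phi (scale s j) x *
    expR ((- n%:R * ln (scale s j) + (1 + delta) * tau (scale s j) x) / qq)))%:E)%E) ->
  (PsiW s x < +oo)%E ->
  exists k, (half_sum s x <= (point_constant * Cg s * (Phi (scale s k) x *
    expR ((- n%:R * ln (scale s k) + (1 + delta / 4) * tau (scale s k) x) / qq)))%:E)%E.
Proof.
move=> qq12 Hj Pfin.
have [M HM] : exists M, forall j,
    - (n%:R * ((-1) ^+ (~~ s) * ln 2)) * j%:R + (1 + delta / 4) * tau (scale s j) x <= M.
  exists (ln (fine (PsiW s x))) => j; rewrite -ln_scaleE.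
  have WP : ((W (scale s j) x)%:E <= PsiW s x)%E.
    apply: le_trans (PsiW_term s x j); rewrite lee_fin ler_peMl//.
    by rewrite exprn_ege1.
  have Wj := W_ge x (scale_gt0 s j).
  have Pf : PsiW s x \is a fin_num.
    by rewrite ge0_fin_numE//; apply: le_trans WP; rewrite lee_fin.
  rewrite -[leLHS]expRK ler_ln ?posrE ?expR_gt0//.
    by rewrite -lee_fin fineK//; apply: le_trans WP; rewrite lee_fin.
  rewrite -lte_fin fineK//; apply: lt_le_trans WP; rewrite lte_fin.
  by apply: lt_le_trans Wj; exact: expR_gt0.
have [k Hk] := near_argmax (s := s) qq12 (fun j => tau_le0 x (scale_gt0 s j))
  (fun j => Phi_ge0 _ x) (Phi_ladder s x) HM.
exists k; apply: (@le_trans _ _ (\sum_(j <oo) point_constant%:E * (Phi (scale s j) x *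
    expR ((- n%:R * ln (scale s j) + (1 + delta) * tau (scale s j) x) / qq))%:E)%E).
  apply: lee_nneseries => j *.
    rewrite mule_ge0 ?lee_fin ?expR_ge0// prode_ge0// => i _.
    by apply: commutator_average_ge0; exact: scale_gt0.
  by rewrite -EFinM; exact: Hj.
rewrite nneseriesZl; last by move=> j _; rewrite lee_fin mulr_ge0 ?expR_ge0.
rewrite -mulrA [leRHS]EFinM; apply: lee_wpmul2l; first by rewrite lee_fin.
under eq_eseriesr => j _ do rewrite ln_scaleE.
by rewrite ln_scaleE.
Qed.

Let prod_dev_le h x : Psi h x <= 1 + \sum_(i < m) dev i h x ^+ (N * Q * m).
Proof.
have dev0 i : 0 <= dev i h x by exact: le_trans ler01 (dev_ge1 i h x).
rewrite /Psi /Phi -prodrXl; under eq_bigr do rewrite -exprM.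
have [[i0 _]|noi] := pselect (exists i : 'I_m, True); last first.
  rewrite big1 ?lerDl ?sumr_ge0// => i; first by rewrite exprn_ge0.
  by exfalso; apply: noi; exists i.
have [i _ imax] := @arg_maxP _ _ 'I_m i0 xpredT (fun i => dev i h x) isT.
apply: (@le_trans _ _ (dev i h x ^+ (N * Q * m))).
  rewrite exprM -[X in _ ^+ X](card_ord m) -prodr_const.
  by apply: ler_prod => j _; rewrite exprn_ge0//= lerXn2r ?nnegrE//; exact: imax.
rewrite (bigD1 i)//= addrCA lerDl addr_ge0// sumr_ge0// => j _.
by rewrite exprn_ge0.
Qed.

Let MM := (N * Q * m)%N.

Let KPsi : R := 1 + m%:R * (2 ^+ MM * (1 + KM)).

Let KPsi0 : 0 <= KPsi.
Proof. by rewrite addr_ge0// !mulr_ge0// ?exprn_ge0// addr_ge0. Qed.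

Let mdev i h : 0 < h -> measurable_fun setT (dev i h).
Proof.
move=> h0; apply: measurable_funD => //; apply: measurableT_comp => //.
apply: measurable_funB => //; apply: (cube_constant_measurable h0) => x y xy.
exact: EFin_inj (c_constant i h0 xy).
Qed.

Let mPsi h : 0 < h -> measurable_fun setT (Psi h).
Proof.
move=> h0; apply: measurable_funX; apply: measurable_prod => i _.
by apply: measurable_funX; exact: mdev.
Qed.

Let integral_Psi_le h (w : Rn R n -> R) : 0 < h -> measurable_fun setT w ->
  (forall x, 0 <= w x) -> (forall x y, cube 0 h x y -> w x = w y) ->
  (\int[leb n]_x (Psi h x * w x)%:E <= KPsi%:E * \int[leb n]_x (w x)%:E)%E.
Proof.
move=> h0 mw w0 wc.
have dev0 i x : 0 <= dev i h x by exact: le_trans ler01 (dev_ge1 i h x).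
pose g x := (1 + \sum_(i < m) dev i h x ^+ MM)%:E.
have mdM i : measurable_fun setT (fun x => dev i h x ^+ MM).
  by apply: measurable_funX; exact: mdev.
have mg : measurable_fun setT g.
  by apply/measurable_EFinP/measurable_funD => //; exact: measurable_sum.
have g0 x : (0 <= g x)%E by rewrite lee_fin addr_ge0// sumr_ge0// => i _; rewrite exprn_ge0.
apply: (@le_trans _ _ (\int[leb n]_x ((w x)%:E * g x))%E).
  apply: ge0_le_lower_integral => x; first by rewrite lee_fin mulr_ge0.
  by rewrite -EFinM lee_fin mulrC ler_wpM2l// prod_dev_le.
have mwE : measurable_fun setT (EFin \o w) by exact/measurable_EFinP.
rewrite (@integral_cube_constant _ _ h (EFin \o w) g)//; last first.
  by move=> x y xy; rewrite /= (wc x y xy).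
have avg_dev i x : (cube_average 0 h (fun y => (dev i h y ^+ MM)%:E) x <=
    (2 ^+ MM * (1 + KM))%:E)%E.
  apply: (@le_trans _ _ (cube_average 0 h (fun y => (2 ^+ MM)%:E *
      (1%:E + (`|b i y - c i h x| ^+ MM)%:E))%E x)).
    apply: le_cube_average => // [y|y|y xy].
    - by rewrite lee_fin exprn_ge0.
    - by rewrite mule_ge0 ?adde_ge0 ?lee_fin ?exprn_ge0.
    have -> : dev i h y = 1 + `|b i y - c i h x|.
      by rewrite /dev (EFin_inj (c_constant i h0 xy)).
    rewrite -EFinD -EFinM lee_fin.
    by have := exprD_le MM ler01 (normr_ge0 (b i y - c i h x)); rewrite expr1n.
  have mbM : measurable_fun setT (fun y => (`|b i y - c i h x| ^+ MM)%:E).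
    apply/measurable_EFinP; apply: measurable_funX; apply: measurableT_comp => //.
    exact: measurable_funB.
  rewrite cube_averageZ//; first last.
  - by move=> y; rewrite adde_ge0 ?lee_fin ?exprn_ge0.
  - exact: emeasurable_funD.
  rewrite EFinM; apply: lee_wpmul2l; first by rewrite lee_fin exprn_ge0.
  rewrite cube_averageD// EFinD; apply: leeD; last exact: c_moment_high.
  by rewrite cube_average0_constant.
rewrite muleC -ge0_integralZr//; last by move=> x _; rewrite lee_fin.
apply: ge0_le_lower_integral => x.
  by rewrite mule_ge0 ?lee_fin//; exact: cube_average_ge0.
apply: lee_wpmul2l; first by rewrite lee_fin.
rewrite /g.
have -> : cube_average 0 h (fun y => (1 + \sum_(i < m) dev i h y ^+ MM)%:E) x =
    (1 + \sum_(i < m) cube_average 0 h (fun y => (dev i h y ^+ MM)%:E) x)%E.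
  have msum : measurable_fun setT (fun y => \sum_(i < m) (dev i h y ^+ MM)%:E)%E.
    by apply: emeasurable_sum => i; exact/measurable_EFinP.
  have sum0 y : (0 <= \sum_(i < m) (dev i h y ^+ MM)%:E)%E.
    by apply: sume_ge0 => i _; rewrite lee_fin exprn_ge0.
  transitivity (cube_average 0 h (fun y => 1 + \sum_(i < m) (dev i h y ^+ MM)%:E)%E x).
    by congr (_ * _)%E; apply: eq_integral => y _; rewrite sumEFin -EFinD.
  rewrite cube_averageD// cube_average0_constant//; congr (1 + _)%E.
  rewrite /cube_average ge0_integral_sum//.
  - rewrite ge0_sume_distrr// => i _; apply: integral_ge0 => y _.
    by rewrite lee_fin exprn_ge0.
  - exact: measurable_cube.
  - by move=> i; apply: measurable_funTS; exact/measurable_EFinP.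
  - by move=> i y _; rewrite lee_fin exprn_ge0.
rewrite /KPsi EFinD; apply: leeD => //.
apply: (@le_trans _ _ (\sum_(i < m) (2 ^+ MM * (1 + KM))%:E)%E); first exact: lee_sum.
by rewrite sumEFin sumr_const card_ord mulr_natl.
Qed.

Let Cmax s : R := (1 + point_constant * Cg s) ^+ Q.

Let Cmax_ge1 s : 1 <= Cmax s.
Proof. by rewrite exprn_ege1// lerDl mulr_ge0// ltW. Qed.

Let half_sum_pow s qq x k e : q1 <= qq <= q2 -> good_point x ->
  (half_sum s x <= (point_constant * Cg s * (Phi (scale s k) x * expR (e / qq)))%:E)%E ->
  (poweR (half_sum s x) (q x) <=
    (Cmax s * (Psi (scale s k) x * expR (e * (q x / qq))))%:E)%E.
Proof.
move=> /andP[q1q _] [_ /andP[q1x qx2]] H.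
have qx0 : 0 < q x by exact: lt_le_trans q1x.
have hs0 := half_sum_ge0 s x.
have PCg : 0 <= point_constant * Cg s by rewrite mulr_ge0// ltW.
have b0 : 0 <= point_constant * Cg s * (Phi (scale s k) x * expR (e / qq)).
  by rewrite mulr_ge0// mulr_ge0// expR_ge0.
apply: (@le_trans _ _ (poweR (point_constant * Cg s *
    (Phi (scale s k) x * expR (e / qq)))%:E (q x))).
  by apply: gt0_ler_poweR => //; rewrite ?(ltW qx0)// in_itv/= ?hs0 ?leey ?lee_fin ?b0.
rewrite poweR_EFin lee_fin (powRM _ PCg (mulr_ge0 (Phi_ge0 _ _) (expR_ge0 _))) (powRM _ (Phi_ge0 _ _) (expR_ge0 _)).
have powQ z : 1 <= z -> z `^ q x <= z ^+ Q.
  move=> z1; rewrite -powR_mulrn ?(le_trans ler01)// ler_powR//.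
  exact: le_trans q2Q.
rewrite ler_pM ?mulr_ge0 ?powR_ge0//.
  apply: (@le_trans _ _ ((1 + point_constant * Cg s) `^ q x)).
    by rewrite ge0_ler_powR ?nnegrE ?addr_ge0 ?(ltW qx0)// lerDr.
  by apply: powQ; rewrite lerDl.
rewrite ler_pM ?powR_ge0 ?powQ//.
by rewrite powRE ?expR_gt0// expRK le_eqVlt; apply/orP; left; apply/eqP; congr expR; ring.
Qed.

Let eta : R := q1 / q2 / 2 * (n%:R * ln 2).

Variable C6 : R.
Hypothesis C60 : 0 < C6.
Hypothesis poly_C6 : forall t : R, 0 <= t -> (1 + t) ^+ (N * m * Q) <= C6 * expR (eta * t).

Let C4 : R := expR (2 * (2 * n%:R) * q2 / q1 * (q2 * (m%:R * C'))).

Let C7 : R := D ^+ (N * m * Q) * C6.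

Let Cpt s : R := Cmax s * (1 + C4 * (1 + C7)).

Let q12 : q1 <= q2.
Proof. by have /andP[q1i qi2] := qinf12; exact: le_trans qi2. Qed.

Let C70 : 0 <= C7.
Proof. by rewrite mulr_ge0 ?exprn_ge0 ?(ltW C60)// (le_trans ler01). Qed.

Let half_sum_pow_le s x : good_point x ->
  (poweR (half_sum s x) (q x) <= (Cpt s)%:E * (PsiW s x + (Psi 1 x * weight x)%:E))%E.
Proof.
move=> gx; have [px /andP[q1x qx2]] := gx.
have w0 : 0 < weight x by exact: weight_gt0.
have Cmax0 : 0 < Cmax s by exact: lt_le_trans ltr01 (Cmax_ge1 s).
have C40 : 0 < C4 by exact: expR_gt0.
have Cpt0 : 0 < Cpt s by rewrite mulr_gt0// ltr_pwDl// mulr_ge0 ?addr_ge0 ?(ltW C40).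
have PW0 : (0 <= PsiW s x)%E.
  by apply: nneseries_ge0 => j _ _; rewrite lee_fin mulr_ge0.
have Pw0 : (0 <= (Psi 1 x * weight x)%:E)%E by rewrite lee_fin mulr_ge0// ltW.
have [Pfin|] := ltP (PsiW s x) +oo%E; last first.
  by rewrite leye_eq => /eqP ->; rewrite addye// gt0_muley ?lte_fin// leey.
have tk k : Cmax s * (Psi (scale s k) x * expR (- n%:R * ln (scale s k) +
    (1 + delta / 4) * tau (scale s k) x)) <= Cmax s * (Psi (scale s k) x * W (scale s k) x).
  by rewrite ler_pM2l// ler_wpM2l// W_ge// scale_gt0.
case: s Cmax0 Cpt0 PW0 Pfin tk => Cmax0 Cpt0 PW0 Pfin tk; last first.
  have [|//|k Hk] := @half_sum_le false (q x) x _ _ Pfin; first by rewrite q1x.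
    by move=> j; apply: scale_term_small => //; rewrite scale_gt0/= invf_le1 ?exprn_gt0// exprn_ege1// ler1n.
  have := half_sum_pow (qq := q x) (k := k) _ gx Hk; rewrite q1x qx2 => /(_ isT) H.
  apply: (le_trans H); rewrite divff ?mulr1; last by rewrite gt_eqF// (lt_le_trans q10).
  apply: (@le_trans _ _ ((Cmax false)%:E * PsiW false x)%E).
    apply: (@le_trans _ _ ((Cmax false)%:E * (Psi (scale false k) x * W (scale false k) x)%:E)%E).
      by rewrite -EFinM lee_fin.
    by apply: lee_wpmul2l; rewrite ?lee_fin ?(ltW Cmax0).
  apply: lee_pmul; rewrite ?lee_fin ?(ltW Cmax0)//; last by rewrite leeDl.
  by rewrite /Cpt ler_peMr ?(ltW Cmax0)// lerDl mulr_ge0 ?addr_ge0 ?(ltW C40).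
have [|k Hk] := @half_sum_le true qinf x qinf12 _ Pfin.
  by move=> j; apply: scale_term_large; rewrite exprn_ege1// ler1n.
apply: (le_trans (half_sum_pow (k := k) qinf12 gx Hk)).
set xi := _ + (1 + delta / 4) * _.
have kap0 : 0 <= n%:R * ln 2 * k%:R :> R by rewrite !mulr_ge0// ln_ge0// ler1n.
have xik : xi <= - (n%:R * ln 2 * k%:R).
  rewrite /xi ln_scaleE /= expr0 mul1r mulNr gerDl mulr_ge0_le0 ?tau_le0 ?scale_gt0//.
  by rewrite addr_ge0// ltW// divr_gt0.
have qq1 : `|q x / qinf - 1| * log_size x <= q2 * (m%:R * C').
  have /andP[q1i qi2] := qinf12; have qi0 : 0 < qinf by exact: lt_le_trans q1i.
  have qx0 : 0 < q x by exact: lt_le_trans q1x.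
  have l0 : 0 <= log_size x by rewrite (le_trans ler01)// log_size_ge1.
  have -> : q x / qinf - 1 = q x * \sum_(i < m) (1 / pinf i - 1 / p i x).
    rewrite sumrB; have := hq x; have := hqinf => E1 E2.
    have -> : \sum_(i < m) 1 / pinf i = alpha / n%:R + 1 / qinf by rewrite E1; ring.
    have -> : \sum_(i < m) 1 / p i x = alpha / n%:R + 1 / q x by rewrite E2; ring.
    by field; rewrite !gt_eqF.
  rewrite normrM (gtr0_norm qx0) -mulrA ler_pM ?mulr_ge0 ?(ltW qx0)//.
  apply: (@le_trans _ _ ((\sum_(i < m) `|1 / pinf i - 1 / p i x|) * log_size x)).
    by rewrite ler_wpM2r// ler_norm_sum.
  rewrite mulr_suml; apply: (@le_trans _ _ (\sum_(i < m) C')); last first.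
    by rewrite sumr_const card_ord mulr_natl.
  apply: ler_sum => i _; apply: le_trans (p_inf i x); rewrite ler_wpM2r//.
  have aa1 : 1 <= a * a by rewrite mulr_ege1 ?ltW.
  rewrite (distrC (p i x)); apply: dist_inv_le.
    exact: le_trans (pinf_ge i).
  exact: le_trans (px i).
have M20 : 0 <= 2 * n%:R :> R by rewrite mulr_ge0.
have := @expR_exponent_change _ xi (n%:R * ln 2 * k%:R) (q x) qinf q1 q2 (log_size x)
  (q2 * (m%:R * C')) (weight x) (2 * n%:R) q10 _ qinf12 kap0 xik qq1 (log_size_ge1 x) M20 w0
  (ln_weight_ge x).
rewrite q1x qx2 => /(_ isT); rewrite -/C4 => Hexp.
have Psi_ladder : Psi (scale true k) x * expR (- (q1 / q2 / 2) * (n%:R * ln 2 * k%:R)) <=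
    C7 * Psi 1 x.
  have e0 : 0 < expR (eta * k%:R) by exact: expR_gt0.
  have -> : - (q1 / q2 / 2) * (n%:R * ln 2 * k%:R) = - (eta * k%:R) by rewrite /eta; ring.
  rewrite expRN ler_pdivrMr// /Psi.
  apply: (@le_trans _ _ ((D ^+ (N * m) * (1 + k%:R) ^+ (N * m) * Phi 1 x) ^+ Q)).
    apply: lerXn2r; [by rewrite nnegrE| |].
      by rewrite nnegrE !mulr_ge0// exprn_ge0// ?addr_ge0// (le_trans ler01 D_ge1).
    by have := Phi_ladder true x k 0%N; rewrite subr0 ger0_norm.
  rewrite !exprMn -!exprM /C7 -!mulrA ler_wpM2l ?exprn_ge0 ?(le_trans ler01 D_ge1)//.
  rewrite [leRHS](_ : _ = C6 * expR (eta * k%:R) * Phi 1 x ^+ Q).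
    by rewrite ler_wpM2r ?exprn_ge0// poly_C6.
  by rewrite /eta !mulrA mulrAC.
apply: (@le_trans _ _ ((Cmax true)%:E * (C4%:E *
   ((Psi (scale true k) x * W (scale true k) x)%:E + (C7 * (Psi 1 x * weight x))%:E)))%E).
  rewrite -EFinD -!EFinM lee_fin ler_pM2l//.
  apply: (@le_trans _ _ (Psi (scale true k) x * (C4 * (expR xi +
      expR (- (q1 / q2 / 2) * (n%:R * ln 2 * k%:R)) * weight x)))); first exact: ler_wpM2l.
  rewrite mulrCA ler_pM2l// mulrDr lerD//.
    by rewrite ler_wpM2l// W_ge// scale_gt0.
  by rewrite [leLHS]mulrA [leRHS]mulrA ler_pM2r.
apply: (@le_trans _ _ ((Cmax true)%:E * (C4%:E * ((1 + C7)%:E * (PsiW true x + (Psi 1 x * weight x)%:E))))%E).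
  apply: lee_wpmul2l; first by rewrite lee_fin ltW.
  apply: lee_wpmul2l; first by rewrite lee_fin ltW.
  rewrite ge0_muleDr//; apply: leeD.
    apply: (@le_trans _ _ (1 * PsiW true x)%E); first by rewrite mul1e.
    by apply: lee_wpmul2r => //; rewrite lee_fin lerDl.
  by rewrite EFinM; apply: lee_wpmul2r => //; rewrite lee_fin lerDr.
rewrite !muleA -!EFinM; apply: lee_wpmul2r; first exact: adde_ge0.
by rewrite lee_fin /Cpt -mulrA ler_pM2l// lerDr.
Qed.

Variable CW : R.
Hypothesis W_mass : forall s,
  (\sum_(j <oo) \int[leb n]_x (W (scale s j) x)%:E <= CW%:E)%E.

Definition core_constant : R :=
  2 ^+ Q * ((Cpt false + Cpt true) * (KPsi * (CW + weight_mass))).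

Let weight_fin : (\int[leb n]_y (weight y)%:E = weight_mass%:E :> \bar R)%E.
Proof.
rewrite fineK// ge0_fin_numE ?integral_weight//.
by apply: integral_ge0 => y _; rewrite lee_fin ltW// weight_gt0.
Qed.

Let mPsiW s : measurable_fun setT (PsiW s).
Proof.
apply: ge0_emeasurable_sum => j; first by move=> x _ _; rewrite lee_fin mulr_ge0.
move=> _; apply/measurable_EFinP/measurable_funM.
  by apply: mPsi; exact: scale_gt0.
by apply: mW; exact: scale_gt0.
Qed.

Let PsiW_ge0 s x : (0 <= PsiW s x)%E.
Proof. by apply: nneseries_ge0 => j _ _; rewrite lee_fin mulr_ge0. Qed.

Let integral_PsiW s : (\int[leb n]_x PsiW s x <= (KPsi * CW)%:E)%E.
Proof.
rewrite integral_nneseries//; first last.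
- by move=> j x _; rewrite lee_fin mulr_ge0.
- move=> j; apply/measurable_EFinP/measurable_funM.
    by apply: mPsi; exact: scale_gt0.
  by apply: mW; exact: scale_gt0.
apply: (@le_trans _ _ (\sum_(j <oo) (KPsi%:E * \int[leb n]_x (W (scale s j) x)%:E))%E).
  apply: lee_nneseries => j _; first by move=> _; apply: integral_ge0 => x _; rewrite lee_fin mulr_ge0.
  apply: (@integral_Psi_le (scale s j) (W (scale s j))).
  - exact: scale_gt0.
  - by apply: mW; exact: scale_gt0.
  - exact: W0.
  move=> x y xy; rewrite /W /average_power; by rewrite (cube_average_constant _ _ xy).
rewrite nneseriesZl; last by move=> j _; apply: integral_ge0 => x _; rewrite lee_fin.
by rewrite EFinM; apply: lee_wpmul2l; rewrite ?lee_fin.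
Qed.

Let integral_Psi1 : (\int[leb n]_x (Psi 1 x * weight x)%:E <= (KPsi * weight_mass)%:E)%E.
Proof.
rewrite [leRHS]EFinM -weight_fin; apply: (@integral_Psi_le 1 weight).
- exact: ltr01.
- exact: measurable_weight.
- by move=> x; rewrite ltW// weight_gt0.
- by move=> x y xy; exact: weight_cube.
Qed.

Lemma core_integral :
  (\int[leb n]_x poweR (half_sum false x + half_sum true x) (q x) <= core_constant%:E)%E.
Proof.
have h0 := half_sum_ge0.
have Cpt0 s : 0 <= Cpt s.
  by rewrite mulr_ge0 ?(le_trans ler01 (Cmax_ge1 s))// ?addr_ge0// ?mulr_ge0 ?expR_ge0 ?addr_ge0.
pose G s x : \bar R := (PsiW s x + (Psi 1 x * weight x)%:E)%E.
have Pw0 x : (0 <= (Psi 1 x * weight x)%:E)%E by rewrite lee_fin mulr_ge0// ltW// weight_gt0.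
have G0 s x : (0 <= G s x)%E by exact: adde_ge0.
have mPw : measurable_fun setT (fun x => (Psi 1 x * weight x)%:E).
  apply/measurable_EFinP/measurable_funM; first exact: mPsi.
  exact: measurable_weight.
have mG s : measurable_fun setT (G s) by exact: emeasurable_funD.
have intG s : (\int[leb n]_x G s x <= (KPsi * (CW + weight_mass))%:E)%E.
  by rewrite ge0_integralD// mulrDr EFinD leeD.
apply: (@le_trans _ _ (\int[leb n]_x ((2 ^+ Q)%:E *
    ((Cpt false)%:E * G false x + (Cpt true)%:E * G true x)))%E).
  apply: ge0_ae_le_lower_integral.
  - by move=> x; exact: poweR_ge0.
  - by move=> x; rewrite mule_ge0 ?adde_ge0 ?mule_ge0 ?lee_fin.
  apply: filterS ae_good => x gx; have [_ /andP[q1x qx2]] := gx.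
  apply: (le_trans (poweR_add_le (h0 _ _) (h0 _ _) (lt_le_trans q10 q1x) (le_trans qx2 q2Q))).
  by rewrite lee_wpmul2l ?lee_fin// leeD// half_sum_pow_le.
rewrite ge0_integralZl//; first last.
- by move=> x _; rewrite adde_ge0 ?mule_ge0 ?lee_fin.
- by apply: emeasurable_funD; exact: measurable_funeM.
rewrite ge0_integralD//; first last.
- exact: measurable_funeM.
- by move=> x _; rewrite mule_ge0 ?lee_fin.
- exact: measurable_funeM.
- by move=> x _; rewrite mule_ge0 ?lee_fin.
have mulE (c1 c2 c3 c4 : R) : ((c1 * ((c2 + c3) * c4))%:E = c1%:E * (c2%:E * c4%:E + c3%:E * c4%:E))%E.
  by rewrite mulrDl.
rewrite /core_constant mulE; apply: lee_wpmul2l; first by rewrite lee_fin exprn_ge0.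
have G1 s : (\int[leb n]_x ((Cpt s)%:E * G s x) <=
    (Cpt s)%:E * (KPsi * (CW + weight_mass))%:E)%E.
  rewrite ge0_integralZl//; last by rewrite lee_fin; exact: Cpt0.
  by apply: lee_wpmul2l; [rewrite lee_fin; exact: Cpt0|exact: intG].
by apply: leeD; exact: G1.
Qed.

End data.
End core.

(** * Uniform bounds *)

Section commutator_sums.
Context {R : realType} {n m : nat}.
Implicit Types (x y : Rn R n).
Hypothesis n0 : (0 < n)%N.
Variables (alpha q1 q2 a C' qinf : R).
Variables (p : 'I_m -> Rn R n -> R) (pinf : 'I_m -> R) (q : Rn R n -> R).
Hypotheses (alpha0 : 0 < alpha) (q10 : 0 < q1) (a1 : 1 < a) (C'0 : 0 <= C').
Hypothesis hq : forall x, alpha / n%:R = \sum_(i < m) 1 / p i x - 1 / q x.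
Hypothesis p_loc : forall i h x y, 0 < h <= 1 -> cube 1 h x y ->
  `|p i x - p i y| * (log_size x - ln h) <= C'.
Hypothesis p_inf : forall i x, `|p i x - pinf i| * log_size x <= C'.
Hypothesis pinf_ge : forall i, a * a <= pinf i.
Hypothesis qinf12 : q1 <= qinf <= q2.
Hypothesis hqinf : alpha / n%:R = \sum_(i < m) 1 / pinf i - 1 / qinf.
Hypothesis ae_good : {ae leb n, forall x, good_point q1 q2 a p q x}.

Lemma integral_half_sums_bound : exists2 C : R, 0 <= C &
  forall (pt f b : 'I_m -> Rn R n -> R) (c : 'I_m -> R -> Rn R n -> R),
    (forall i, measurable_fun setT (pt i)) ->
    (forall i, measurable_fun setT (f i)) ->
    (forall i, measurable_fun setT (b i)) ->
    {ae leb n, forall y, forall i, p i y = pt i y} ->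
    (forall i y, 0 <= f i y) ->
    (forall i, (\int[leb n]_y (f i y `^ pt i y)%:E <= 1)%E) ->
    (forall i h, 0 < h -> cube_constant h (EFin \o c i h)) ->
    (forall i h x, 0 < h -> (cube_average 1 h (fun y => `|b i y - c i h x|%:E) x <= 1)%E) ->
  (\int[leb n]_x poweR (half_sum alpha f b false x + half_sum alpha f b true x) (q x)
    <= C%:E)%E.
Proof.
have am1 : 0 < a - 1 by rewrite subr_gt0.
have /andP[q1i qi2] := qinf12.
have q12 : q1 <= q2 by exact: le_trans qi2.
have q20 : 0 < q2 by exact: lt_le_trans q12.
have nR0 : 0 < n%:R :> R by rewrite ltr0n.
have l2 : 0 < ln 2 :> R by rewrite ln_gt0// ltr1n.
pose N := (Num.truncn (a - 1)^-1).+2.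
have Na : 1 <= (N%:R - 1) * (a - 1).
  rewrite -ler_pdivrMr// mul1r /N -natr1 addrK ltW//.
  by apply: truncnS_gt.
pose Q := (Num.truncn q2).+1.
have q2Q : q2 <= Q%:R by rewrite ltW// truncnS_gt.
pose delta : R := alpha * q1 / n%:R.
have delta0 : 0 < delta by rewrite divr_gt0// mulr_gt0.
have D0 : 0 <= (1 + 2 ^+ n) ^+ (N * m) :> R by rewrite exprn_ge0// addr_ge0.
have bt s : n%:R * ((-1) ^+ (~~ s) * ln 2) != 0 :> R.
  by rewrite !mulf_eq0 signr_eq0 (gt_eqF nR0) (gt_eqF l2).
have [Gf Gf0 HGf] := sum_le_near_argmax (N * m) (bt false) delta0 q10 q12 D0.
have [Gt Gt0 HGt] := sum_le_near_argmax (N * m) (bt true) delta0 q10 q12 D0.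
have eta0 : 0 < q1 / q2 / 2 * (n%:R * ln 2) by rewrite !mulr_gt0 ?invr_gt0.
have [C6 C60 HC6] := exprD1_le_expR (N * m * Q) eta0.
have ar : a < a * (1 + delta / 4).
  by rewrite ltr_pMr ?(lt_trans ltr01)// ltrDl divr_gt0.
have wm0 : 0 <= weight_mass (R := R) (n := n).
  by apply/fine_ge0/integral_ge0 => y _; rewrite lee_fin ltW// weight_gt0.
have K0 : 0 <= majorant_mass (R := R) (n := n) (m := m) a.
  by rewrite mulr_ge0 ?powR_ge0 ?addr_ge0.
have [CW CW0 HCW] := sum_integral_average_power a1 K0 n0 ar.
pose KN : R := 3 ^+ n * (2 ^+ N * (2 * 2 ^+ N.+1 ^+ N + (1 + 2 ^+ n * 2 ^+ N.+1) ^+ N + 2 ^+ N)).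
have KN0 : 0 <= KN by rewrite /KN; repeat first [done|apply: exprn_ge0|apply: addr_ge0|apply: mulr_ge0].
pose M := (N * Q * m)%N.
pose KM : R := 2 * 2 ^+ M.+1 ^+ M + (1 + 2 ^+ n * 2 ^+ M.+1) ^+ M.
have KM0 : 0 <= KM by rewrite /KM; repeat first [done|apply: exprn_ge0|apply: addr_ge0|apply: mulr_ge0].
pose Cg s := if s then Gt else Gf.
exists (Num.max 0 (core_constant (n := n) (m := m) alpha q1 q2 a C' N KN Q KM Cg C6 CW)).
  by rewrite le_max lexx.
move=> pt f b c mpt mf mb pt_eq f0 fmod cc osc.
apply: (@le_trans _ _ (core_constant (n := n) (m := m) alpha q1 q2 a C' N KN Q KM Cg C6 CW)%:E);
  last by rewrite lee_fin le_max lexx orbT.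
apply: (@core_integral R n m n0 alpha q1 q2 a C' qinf N KN p pinf q alpha0 q10 a1 C'0 _ Na
  KN0 hq p_loc p_inf pinf_ge qinf12 hqinf ae_good pt f b c mpt mf mb pt_eq f0 fmod _ Q KM q2Q
  KM0 cc _ _ Cg _ _ C6 C60 HC6 CW _) => //.
- by move=> i h x h0; exact: (moment_bound (mb i) (osc i)).
- by move=> i h x j h0; exact: (mean_iter_double (mb i) (osc i)).
- by move=> i h x h0; exact: (moment_bound0 (mb i) (osc i)).
- by case.
- case=> qq M' t P; [exact: HGt|exact: HGf].
- move=> s; apply: HCW.
  + exact: measurable_majorant.
  + by move=> y; rewrite addr_ge0 ?(ltW (weight_gt0 _))// sumr_ge0// => i _; exact: powR_ge0.
  + exact: majorant_modular.
Qed.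

End commutator_sums.

(** * Parameters of the exponents *)

Section exponent_parameters.
Context {R : realType} {n : nat}.
Implicit Types (x y : Rn R n) (p q v : Rn R n -> R).

Lemma ess_lower_ae (l : R) p : (l%:E < ess_lower p)%E ->
  exists2 r : R, l < r & {ae leb n, forall x, r <= p x}.
Proof.
move=> lp; have [r lr rp] : exists2 r : R, l < r & (r%:E <= ess_lower p)%E.
  case: (ess_lower p) lp => [r||//]; first by exists r => //; rewrite -lte_fin.
  by move=> _; exists (l + 1); rewrite ?ltrDl ?leey.
exists r => //; apply: filterS (ess_inf_le (leb n) (EFin \o p)) => x /=.
by rewrite -lee_fin; exact: le_trans.
Qed.

Lemma ess_upper_ae p : (ess_upper p < +oo)%E ->
  exists r : R, {ae leb n, forall x, p x <= r}.
Proof.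
move=> pu; have [r pr] : exists r : R, (ess_upper p <= r%:E)%E.
  by case: (ess_upper p) pu => [r||]; [exists r|rewrite ltxx|exists 0; rewrite leNye].
exists r; apply: filterS (ess_sup_ge (leb n) (EFin \o p)) => x /= H.
by rewrite -lee_fin (le_trans H).
Qed.

Lemma leb_cube0_ae h x (P : Rn R n -> Prop) : 0 < h -> {ae leb n, forall y, P y} ->
  exists2 y, P y & cube 0 h x y.
Proof.
move=> h0 [N [mN N0 PN]]; apply: contrapT => H.
have : (leb n (cube 0 h x) <= leb n N)%E.
  apply: le_measure; rewrite ?inE//; first exact: measurable_cube.
  by move=> y xy; apply: PN => /= Py; apply: H; exists y.
by rewrite N0 leb_cube// lee_fin leNgt exprn_gt0// mulr_gt0.
Qed.

Hypothesis n0 : (0 < n)%N.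

Lemma ae_far (P : Rn R n -> Prop) (L : R) : {ae leb n, forall y, P y} ->
  exists2 y, P y & L <= log_size y.
Proof.
move=> aeP; pose k := (Num.truncn (expR L)).+1.
have [y Py zy] := leb_cube0_ae [tuple (k%:R : measurableTypeR R) | i < n] ltr01 aeP.
exists y => //; have i := Ordinal n0.
have kL : expR L <= k%:R by rewrite ltW// truncnS_gt.
have := zy i; rewrite /cell_index tnth_mktuple !divr1.
have -> : Num.floor (k%:R : R) = k%:Z by rewrite pmulrn intrKfloor.
move=> ky; have {}ky : Num.floor (tnth y i : R) = k%:Z by lia.
have yk : k%:R <= tnth y i :> R.
  by have := floor_le (tnth y i : R); rewrite ky.
rewrite -(expRK L) /log_size ler_ln ?posrE ?expR_gt0//; last first.
  by rewrite ltr_pwDl ?expR_gt0 ?euclid_norm_ge0.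
apply: (le_trans kL); apply: (le_trans yk); apply: (le_trans (ler_norm _)).
by apply: (le_trans (tnth_le_euclid_norm _ _)); rewrite lerDr expR_ge0.
Qed.

Lemma le_value_at_infinity (P : Rn R n -> Prop) v (s lo K : R) :
  {ae leb n, forall y, P y} ->
  (forall y, P y -> lo <= v y /\ `|v y - s| * log_size y <= K) -> lo <= s.
Proof.
move=> aeP H; rewrite leNgt; apply/negP => slo.
have [y Py Ly] := ae_far (K / (lo - s) + 1) aeP.
have [v1] := H y Py; apply/negP; rewrite -ltNge.
have d0 : 0 < lo - s by rewrite subr_gt0.
have l0 := log_size_ge1 y.
apply: (@lt_le_trans _ _ ((lo - s) * log_size y)).
  by rewrite -ltr_pdivrMl// (lt_le_trans _ Ly)// mulrC ltrDl.
rewrite ler_wpM2r ?(le_trans ler01)// (le_trans _ (ler_norm _))//.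
by rewrite lerD2r.
Qed.

Lemma exponent_parameters (m : nat) (p_ : 'I_m -> Rn R n -> R) q (alpha : R) :
  (forall i, log_Holder (p_ i) /\ exponent_P (p_ i)) -> exponent_P0 q ->
  (forall x, alpha / n%:R = \sum_(i < m) 1 / p_ i x - 1 / q x) ->
  exists a q1 q2 C' qinf : R, exists pinf : 'I_m -> R,
  [/\ 1 < a, 0 < q1, 0 <= C', q1 <= qinf <= q2 &
   [/\ forall i h x y, 0 < h <= 1 -> cube 1 h x y ->
        `|p_ i x - p_ i y| * (log_size x - ln h) <= C',
      forall i x, `|p_ i x - pinf i| * log_size x <= C',
      forall i, a * a <= pinf i,
      alpha / n%:R = \sum_(i < m) 1 / pinf i - 1 / qinf &
      {ae leb n, forall x, good_point q1 q2 a p_ q x}]].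
Proof.
move=> hp [[_ qpos] /ess_lower_ae[q1 q10 q1q] /ess_upper_ae[q2 qq2]] hq.
have /choice[r hr] i : exists r : R, 1 < r /\ {ae leb n, forall x, r <= p_ i x}.
  by have [_ [_ /ess_lower_ae[r r1 rp] _]] := hp i; exists r.
pose r0 := \big[Num.min/2]_i r i.
have r01 : 1 < r0 by apply: lt_bigmin => [|i _]; [rewrite ltr1n|exact: (hr i).1].
pose a := Num.sqrt r0.
have aa : a * a = r0 by rewrite -expr2 sqr_sqrtr// ltW// (lt_trans ltr01).
have a1 : 1 < a by rewrite -sqrtr1 ltr_sqrt// (lt_trans ltr01).
have /choice[pC hpC] i : exists w : R * R, 0 <= w.2 /\
    (forall h x y, 0 < h <= 1 -> cube 1 h x y ->
      `|p_ i x - p_ i y| * (log_size x - ln h) <= w.2) /\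
    (forall x, `|p_ i x - w.1| * log_size x <= w.2).
  have [[C [pinf [C0 pi0 loc inf]]] _] := hp i.
  have [C1 C10 H1] := log_holder_cube1 n0 C0 loc inf.
  exists (pinf, C + C1); split=> /=; first by rewrite addr_ge0 ?ltW.
  split=> [h x y h01 xy|x].
    by apply: (le_trans (H1 h x y h01 xy)); rewrite lerDr ltW.
  by apply: (le_trans (log_holder_inf inf x)); rewrite lerDl ltW.
pose pinf i := (pC i).1; pose C' := \sum_(i < m) (pC i).2.
have C'i i : (pC i).2 <= C'.
  by rewrite /C' (bigD1 i)//= lerDl sumr_ge0// => j _; exact: (hpC j).1.
have C'0 : 0 <= C' by apply: sumr_ge0 => i _; exact: (hpC i).1.
have inf i x : `|p_ i x - pinf i| * log_size x <= C'.
  by apply: le_trans (C'i i); exact: (hpC i).2.2.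
have ag : {ae leb n, forall x, good_point q1 q2 a p_ q x}.
  have rp : {ae leb n, forall x, forall i, a * a <= p_ i x}.
    apply: filter_forall => i; apply: filterS (hr i).2 => x; apply: le_trans.
    by rewrite aa; exact: bigmin_le.
  by apply: filterS3 rp q1q qq2 => x H1 H2 H3; split=> //; rewrite H2 H3.
have pinf_ge i : a * a <= pinf i.
  apply: (le_value_at_infinity (v := p_ i) (K := C') ag) => x [px _].
  by split.
have aa1 : 1 <= a * a by rewrite aa ltW.
pose s := \sum_(i < m) 1 / pinf i - alpha / n%:R.
have sE x : 1 / q x - s = \sum_(i < m) (1 / p_ i x - 1 / pinf i).
  have -> : 1 / q x = \sum_(i < m) 1 / p_ i x - alpha / n%:R by rewrite (hq x); ring.
  by rewrite sumrB /s; ring.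
have sq x : good_point q1 q2 a p_ q x -> `|1 / q x - s| * log_size x <= m%:R * C'.
  move=> [px _]; rewrite sE.
  have l0 : 0 <= log_size x by rewrite (le_trans ler01)// log_size_ge1.
  apply: (@le_trans _ _ ((\sum_(i < m) `|1 / p_ i x - 1 / pinf i|) * log_size x)).
    by rewrite ler_wpM2r// ler_norm_sum.
  rewrite mulr_suml; apply: (@le_trans _ _ (\sum_(i < m) C')); last first.
    by rewrite sumr_const card_ord mulr_natl.
  apply: ler_sum => i _; apply: le_trans (inf i x); rewrite ler_wpM2r//.
  by apply: dist_inv_le; [exact: le_trans (px i)|exact: le_trans (pinf_ge i)].
have [x0 [_ /andP[q1x q2x]] _] := ae_far 0 ag.
have q20 : 0 < q2 by exact: lt_le_trans (lt_le_trans q10 q1x) q2x.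
have s_ge : 1 / q2 <= s.
  apply: (le_value_at_infinity (v := fun x => 1 / q x) (K := m%:R * C') ag) => x gx.
  split; last exact: sq.
  have [_ /andP[q1y q2y]] := gx.
  by rewrite !div1r lef_pV2 ?posrE// (lt_le_trans q10).
have s_le : s <= 1 / q1.
  rewrite -lerN2.
  apply: (le_value_at_infinity (v := fun x => - (1 / q x)) (K := m%:R * C') ag) => x gx.
  split; last by rewrite -opprD normrN; exact: sq.
  have [_ /andP[q1y q2y]] := gx.
  by rewrite lerN2 !div1r lef_pV2 ?posrE// (lt_le_trans q10).
have s0 : 0 < s by apply: lt_le_trans s_ge; rewrite divr_gt0.
exists a, q1, q2, C', (1 / s), pinf; split=> //.
  apply/andP; split; rewrite div1r.
    by rewrite -[leLHS]invrK lef_pV2 ?posrE ?invr_gt0// -div1r.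
  by rewrite -[leRHS]invrK lef_pV2 ?posrE ?invr_gt0// -div1r.
split=> //.
- by move=> i h x y h01 xy; apply: le_trans (C'i i); exact: (hpC i).2.1.
- by rewrite /s !div1r invrK opprB addrCA subrr addr0.
Qed.

End exponent_parameters.

(** * Domination by dyadic sums *)

Section dyadic_domination.
Context {R : realType} {n m : nat}.
Implicit Types (x y z : Rn R n) (h r : R).

Lemma prode_scale (I : Type) (s : seq I) (c : R) (A : I -> \bar R) :
  (\prod_(i <- s) (c%:E * A i) = (c ^+ size s)%:E * \prod_(i <- s) A i)%E.
Proof.
elim: s => [|i s ih]; first by rewrite !big_nil expr0 mul1e.
by rewrite !big_cons ih /= exprS EFinM muleACA.
Qed.

Lemma exists_scale r : 0 < r -> exists s j, scale s j / 2 <= r <= scale s j.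
Proof.
move=> r0; have l2 : 0 < ln 2 :> R by rewrite ln_gt0// ltr1n.
pose z := Num.ceil (ln r / ln 2).
have zu : ln r <= z%:~R * ln 2 by rewrite -ler_pdivrMr// ceil_ge.
have zl : z%:~R * ln 2 - ln 2 <= ln r.
  rewrite -[X in _ - X]mul1r -mulrBl -ler_pdivlMr//.
  have := ceilB1_lt (ln r / ln 2); rewrite -/z => /ltW.
  by rewrite intrB.
have [s [j sj]] : exists s j, ln (scale s j) = z%:~R * ln 2 :> R.
  case: (z) => k.
    by exists true, k; rewrite ln_scale expr0 mul1r mulrC.
  by exists false, k.+1; rewrite ln_scale expr1 NegzE mulrNz -pmulrn; ring.
exists s, j; have h0 : 0 < scale s j :> R by exact: scale_gt0.
rewrite -[in X in X && _]ler_ln ?posrE ?divr_gt0// -[in X in _ && X]ler_ln ?posrE//.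
by rewrite ln_div ?posrE// sj zl zu.
Qed.

Lemma tnth_dist_le x y i : `|(tnth x i : R) - tnth y i| <= euclid_dist x y.
Proof.
rewrite -sqrtr_sqr ler_sqrt; last by apply: sumr_ge0 => j _; exact: sqr_ge0.
by rewrite (bigD1 i)//= lerDl; apply: sumr_ge0 => j _; exact: sqr_ge0.
Qed.

Lemma euclid_dist_cube (c : nat) h x y : 0 < h -> euclid_dist x y <= c%:R * h -> cube c h x y.
Proof.
move=> h0 xy i; rewrite /cell_index.
have : `|(tnth x i : R) / h - tnth y i / h| <= c%:R.
  rewrite -mulrBl normrM normfV (gtr0_norm h0) ler_pdivrMr//.
  exact: le_trans (tnth_dist_le x y i) xy.
set a := _ / h; set b := _ / h => ab.
have key (u v : R) : u - v <= c%:R -> Num.floor u - Num.floor v <= c%:Z.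
  move=> uv; rewrite lerBlDr -ltzD1 -(@ltr_int R).
  apply: (le_lt_trans (floor_le u)); rewrite !intrD -pmulrn.
  have := floorD1_gt v; rewrite intrD; move: uv; lra.
move: ab; rewrite ler_norml => /andP[ab1 ab2].
by rewrite ler_norml; apply/andP; split; [rewrite lerNl opprB|]; apply: key; lra.
Qed.

Lemma measurable_eball x r : measurable (eball x r).
Proof.
have [r0|r0] := leP r 0.
  rewrite (_ : eball x r = set0)// -subset0 => y /=.
  by rewrite /eball/= ltNge (le_trans r0)// sqrtr_ge0.
have mS : measurable_fun setT
    (fun y : Rn R n => \sum_(i < n) ((tnth x i : R) - tnth y i) ^+ 2).
  apply: measurable_sum => i; apply: measurable_funX; apply: measurable_funB => //.
  exact: measurable_tnth.
rewrite (_ : eball x r = (fun y : Rn R n => \sum_(i < n) ((tnth x i : R) - tnth y i) ^+ 2)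
    @^-1` `]-oo, r ^+ 2[); first by rewrite -[X in measurable X]setTI; exact: mS.
apply/seteqP; split=> y; rewrite /eball/= in_itv/= /euclid_dist => H.
  rewrite -(@sqr_sqrtr _ (\sum_(i < n) _)) ?ltr_pXn2r ?nnegrE ?sqrtr_ge0 ?(ltW r0)//.
  by apply: sumr_ge0 => i _; exact: sqr_ge0.
rewrite -(@ger0_norm _ r) ?(ltW r0)// -sqrtr_sqr ltr_sqrt//.
exact: exprn_gt0.
Qed.

Lemma eball_cube (c : nat) h x : 0 < h -> eball x (c%:R * h) `<=` cube c h x.
Proof. by move=> h0 y /ltW; exact: euclid_dist_cube. Qed.

Lemma leb_eball_le (c : nat) h x r : 0 < h -> r <= c%:R * h ->
  (leb n (eball x r) <= (((2 * c + 1)%:R * h) ^+ n)%:E)%E.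
Proof.
move=> h0 rc; rewrite -(leb_cube c x h0); apply: le_measure; rewrite ?inE.
- exact: measurable_eball.
- exact: measurable_cube.
by move=> y yr; apply: (eball_cube h0); exact: lt_le_trans rc.
Qed.

Lemma leb_eballE x r : 0 < r -> leb n (eball x r) = (eball_volume x r)%:E.
Proof.
move=> r0; rewrite /eball_volume fineK// ge0_fin_numE//.
by apply: (le_lt_trans (@leb_eball_le 1 r x r r0 _)); rewrite ?mul1r// ltry.
Qed.

Lemma cube1_eball h x : 0 < h -> cube 1 h x `<=` eball x ((2 * n + 1)%:R * h).
Proof.
move=> h0 y /(cube1_dist h0) xy; rewrite /eball/=; apply: (le_lt_trans xy).
by rewrite ltr_pM2r// natrD natrM ltrDl.
Qed.

Lemma eball_volume_ge x h r : 0 < h -> (2 * n + 1)%:R * h <= r ->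
  h ^+ n <= eball_volume x r.
Proof.
move=> h0 hr; have r0 : 0 < r by apply: lt_le_trans hr; rewrite mulr_gt0// ltr0n addn1.
rewrite -lee_fin -leb_eballE//.
have := @leb_cube R n 0 h x h0; rewrite mul1r => <-.
apply: le_measure; rewrite ?inE.
- exact: measurable_cube.
- exact: measurable_eball.
by move=> y /cube01 /(cube1_eball h0) xy; exact: lt_le_trans hr.
Qed.

Lemma bmo_cube_oscillation (b : Rn R n -> R) (A : R) : (BMO_norm b <= A%:E)%E ->
  exists c : R -> Rn R n -> R,
    (forall h, 0 < h -> cube_constant h (EFin \o c h)) /\
    (forall h x, 0 < h -> (cube_average 1 h (fun y => `|b y - c h x|%:E) x <=
      ((4 * n + 3)%:R ^+ n * A)%:E)%E).
Proof.
move=> bA.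
pose rep h x : Rn R n := [tuple (h * (cell_index h x i)%:~R : measurableTypeR R) | i < n].
pose rho h : R := (2 * n + 1)%:R * h.
exists (fun h x => ball_average b (rep h x) (rho h)); split=> [h h0 x y /cube0P xy|h x h0].
  by rewrite /= /rep xy.
have rho0 : 0 < rho h by rewrite mulr_gt0// ltr0n addn1.
have xrep : cube 0 h (rep h x) = cube 0 h x.
  apply: cube0_eq => i; rewrite /cell_index tnth_mktuple [h * _]mulrC mulfK ?gt_eqF//.
  by rewrite intrKfloor subrr normr0.
have xrep1 : cube 1 h x = cube 1 h (rep h x).
  by apply: cube0_eq; rewrite -xrep; exact: cubexx.
set av := ball_average _ _ _.
apply: (@le_trans _ _ ((h ^- n)%:E *
    \int[leb n]_(y in eball (rep h x) (rho h)) `|b y - av|%:E)%E).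
  apply: lee_wpmul2l; first by rewrite lee_fin invr_ge0 exprn_ge0// ltW.
  by apply: ge0_le_integral_subset => //; rewrite xrep1; exact: cube1_eball.
have V0 : 0 < eball_volume (rep h x) (rho h).
  by apply: lt_le_trans (eball_volume_ge _ h0 (lexx _)); rewrite exprn_gt0.
have VA : ((eball_volume (rep h x) (rho h))^-1%:E *
    \int[leb n]_(y in eball (rep h x) (rho h)) `|b y - av|%:E <= A%:E)%E.
  apply: le_trans bA; apply: ereal_sup_ubound.
  by exists (rep h x, rho h).
have Vu : eball_volume (rep h x) (rho h) <= ((4 * n + 3)%:R * h) ^+ n.
  rewrite -lee_fin -leb_eballE//.
  have := @leb_eball_le (2 * n + 1) h (rep h x) (rho h) h0 (lexx _).
  by rewrite (_ : 2 * (2 * n + 1) + 1 = 4 * n + 3)%N//; lia.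
have A0 : 0 <= A.
  rewrite -lee_fin (le_trans _ VA)// mule_ge0 ?lee_fin ?invr_ge0 ?(ltW V0)//.
  exact: integral_ge0.
set I := (\int[leb n]_(y in eball _ _) _)%E in VA *.
have I_le : (I <= (eball_volume (rep h x) (rho h) * A)%:E)%E.
  by rewrite EFinM -lee_pdivrMl.
apply: (le_trans (lee_wpmul2l _ I_le)); first by rewrite lee_fin invr_ge0 exprn_ge0// ltW.
rewrite -EFinM lee_fin mulrA ler_wpM2r// ler_pdivrMl ?exprn_gt0// mulrC.
by apply: (le_trans Vu); rewrite exprMn.
Qed.

Definition dyadic_term (alpha h : R) (g : 'I_m -> Rn R n -> \bar R) x : \bar R :=
  ((expR (alpha * ln h))%:E * \prod_(i < m) cube_average 1 h (g i) x)%E.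

Definition dyadic_sum (alpha : R) (g : 'I_m -> Rn R n -> \bar R) s x : \bar R :=
  (\sum_(j <oo) dyadic_term alpha (scale s j) g x)%E.

Lemma dyadic_term_ge0 alpha h g x : 0 < h -> (forall i y, 0 <= g i y)%E ->
  (0 <= dyadic_term alpha h g x)%E.
Proof.
move=> h0 g0; rewrite mule_ge0 ?lee_fin ?expR_ge0// prode_ge0// => i _.
exact: cube_average_ge0.
Qed.

Lemma dyadic_term_le_sums alpha g s j x : (forall i y, 0 <= g i y)%E ->
  (dyadic_term alpha (scale s j) g x <=
    dyadic_sum alpha g false x + dyadic_sum alpha g true x)%E.
Proof.
move=> g0.
have t0 s' j' : (0 <= dyadic_term alpha (scale s' j') g x)%E.
  by apply: dyadic_term_ge0 => //; exact: scale_gt0.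
have H : (dyadic_term alpha (scale s j) g x <= dyadic_sum alpha g s x)%E.
  apply: (@le_trans _ _ (\sum_(0 <= k < j.+1) dyadic_term alpha (scale s k) g x)%E).
    by rewrite big_nat_recr//= leeDr// sume_ge0.
  by apply: nneseries_lim_ge => k _.
have d0 s' : (0 <= dyadic_sum alpha g s' x)%E by exact: nneseries_ge0.
by apply: (le_trans H); case: s {H}; rewrite ?leeDr ?leeDl.
Qed.

Lemma dyadic_termE alpha h g x : 0 < h ->
  dyadic_term alpha h g x = ((expR ((alpha - m%:R * n%:R) * ln h))%:E *
    \prod_(i < m) \int[leb n]_(y in cube 1 h x) g i y)%E.
Proof.
move=> h0; rewrite /dyadic_term /cube_average prode_scale muleA -EFinM.
congr (_%:E * _)%E; rewrite -[index_enum _]enumT size_enum_ord -exprVn -exprM.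
rewrite -[h in h^-1](@lnK R h)// -expRN -expRM_natr -expRD; congr expR.
by rewrite natrM; ring.
Qed.

Lemma fractional_maximal_le_dyadic (alpha : R) : 0 <= m%:R - alpha / n%:R -> (0 < n)%N ->
  exists2 C : R, 0 <= C & forall (g : 'I_m -> Rn R n -> R) x,
    (fractional_maximal m alpha g x <=
      C%:E * (dyadic_sum alpha (fun i y => `|g i y|%:E) false x +
              dyadic_sum alpha (fun i y => `|g i y|%:E) true x))%E.
Proof.
set theta := m%:R - alpha / n%:R => theta0 n0.
pose D : R := 2 * (2 * n + 1)%:R.
have D0 : 0 < D by rewrite mulr_gt0// ltr0n addn1.
exists (expR (theta * n%:R * ln D)); first exact: expR_ge0.
move=> g x; apply: ge_ereal_sup => _ [r /= r0 <-].
have [s [j /andP[hr rh]]] := exists_scale r0.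
set h : R := scale s j in hr rh; have h0 : 0 < h by exact: scale_gt0.
have g0 i y : (0 <= `|g i y|%:E)%E by rewrite lee_fin.
apply: (@le_trans _ _ ((expR (theta * n%:R * ln D))%:E *
    dyadic_term alpha h (fun i y => `|g i y|%:E) x)%E); last first.
  by apply: lee_wpmul2l; rewrite ?lee_fin ?expR_ge0// dyadic_term_le_sums.
rewrite dyadic_termE// muleA -EFinM.
have hD : 0 < h / D by rewrite divr_gt0.
have V : (h / D) ^+ n <= eball_volume x r.
  apply: eball_volume_ge => //; suff -> : (2 * n + 1)%:R * (h / D) = h / 2 by [].
  have k0 : (2 * n + 1)%:R != 0 :> R by rewrite pnatr_eq0 addn1.
  by rewrite /D; move: (2 * n + 1)%:R k0 => k k0; field.
have V0 : 0 < eball_volume x r by apply: lt_le_trans V; rewrite exprn_gt0.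
apply: lee_pmul; rewrite ?lee_fin ?invr_ge0 ?powR_ge0//.
- by apply: prode_ge0 => i _; apply: integral_ge0.
- apply: (@le_trans _ _ ((((h / D) ^+ n) `^ theta)^-1)).
    rewrite lef_pV2 ?posrE ?powR_gt0 ?exprn_gt0//.
    by apply: ge0_ler_powR => //; rewrite nnegrE; [exact/exprn_ge0/ltW|exact: ltW].
  rewrite powRE ?exprn_gt0// lnXn// -expRN ln_div ?posrE// -expRD ler_expR.
  rewrite le_eqVlt; apply/orP; left; apply/eqP; rewrite /theta -mulr_natr.
  by field; rewrite pnatr_eq0 -lt0n.
apply: lee_prode => i; first exact: integral_ge0.
apply: ge0_le_integral_subset => // y yr; apply: (euclid_dist_cube h0).
by rewrite mul1r; exact: le_trans (ltW yr) rh.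
Qed.

Lemma fractional_kernel_le_dyadic (alpha : R) : 0 < m%:R * n%:R - alpha ->
  exists2 C : R, 0 <= C & forall (G : 'I_m -> Rn R n -> R) x,
    (forall i, measurable_fun setT (G i)) -> (forall i y, 0 <= G i y) ->
    (\int[measure_power (leb n) m]_t
      ((\prod_(i < m) G i (tnth t i)) /
       (\sum_(i < m) euclid_dist x (tnth t i)) `^ (m%:R * n%:R - alpha))%:E <=
      C%:E * (dyadic_sum alpha (fun i y => (G i y)%:E) false x +
              dyadic_sum alpha (fun i y => (G i y)%:E) true x))%E.
Proof.
set theta := m%:R * n%:R - alpha => theta0.
exists (expR (theta * ln 2)); first exact: expR_ge0.
move=> G x mG G0.
pose ind h i y : \bar R := ((G i y)%:E * (\1_(cube 1 h x) y)%:E)%E.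
have ind0 h i y : (0 <= ind h i y)%E by rewrite mule_ge0 ?lee_fin.
have mind h i : 0 < h -> measurable_fun setT (ind h i).
  move=> h0; apply: emeasurable_funM; first exact/measurable_EFinP.
  by apply/measurable_EFinP; apply: measurable_indic; exact: measurable_cube.
pose term s j (t : m.-tuple (Rn R n)) : \bar R :=
  ((expR (- theta * ln (scale s j)))%:E *
    \prod_(i < m) ind (scale s j) i (tnth t i))%E.
have term0 s j t : (0 <= term s j t)%E.
  by rewrite mule_ge0 ?lee_fin ?expR_ge0// prode_ge0.
have mprod s j : measurable_fun setT
    (fun t : m.-tuple (Rn R n) => \prod_(i < m) ind (scale s j) i (tnth t i))%E.
  apply: emeasurable_prod => i; apply: (measurableT_comp (mind _ i (scale_gt0 s j))).
  exact: measurable_tnth.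
have mterm s j : measurable_fun setT (term s j) by exact: measurable_funeM.
pose S s t : \bar R := (\sum_(j <oo) term s j t)%E.
have S0 s t : (0 <= S s t)%E by exact: nneseries_ge0.
have mS s : measurable_fun setT (S s) by exact: ge0_emeasurable_sum.
have intS s : (\int[measure_power (leb n) m]_t S s t =
    dyadic_sum alpha (fun i y => (G i y)%:E) s x)%E.
  rewrite integral_nneseries//; apply: eq_eseriesr => j _.
  rewrite ge0_integralZl//; last by move=> t _; exact: prode_ge0.
  rewrite dyadic_termE ?scale_gt0// /theta opprB; congr (_ * _)%E.
  rewrite (integral_measure_power_prod (leb n)); first last.
  - by move=> i y; exact: ind0.
  - by move=> i; apply: mind; exact: scale_gt0.
  apply: eq_bigr => i _; rewrite [in RHS]integral_mkcond.
  apply: eq_integral => y _; rewrite /ind patchE indicE.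
  by case: ifP => _; rewrite ?mule1 ?mule0.
rewrite -!intS -ge0_integralD// -ge0_integralZl//;
  try solve [exact: emeasurable_funD|by move=> t _; rewrite adde_ge0].
have prod0 t : 0 <= \prod_(i < m) G i (tnth t i) by apply: prodr_ge0.
apply: ge0_le_lower_integral => t; first by rewrite lee_fin divr_ge0// powR_ge0.
set d := \sum_(i < m) _.
have d0 : 0 <= d by apply: sumr_ge0 => i _; exact: sqrtr_ge0.
move: d0; rewrite le_eqVlt => /orP[/eqP <-|d0].
  by rewrite powR0 ?gt_eqF// invr0 mulr0 mule_ge0 ?lee_fin ?expR_ge0 ?adde_ge0.
have [s [j /andP[hd dh]]] := exists_scale d0.
set h : R := scale s j in hd dh; have h0 : 0 < h by exact: scale_gt0.
apply: (@le_trans _ _ ((expR (theta * ln 2))%:E * term s j t)%E); last first.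
  apply: lee_wpmul2l; first by rewrite lee_fin expR_ge0.
  apply: (@le_trans _ _ (S s t)).
    apply: (@le_trans _ _ (\sum_(0 <= k < j.+1) term s k t)%E).
      by rewrite big_nat_recr//= leeDr// sume_ge0.
    by apply: nneseries_lim_ge => k _.
  by case: (s); rewrite ?leeDr ?leeDl.
rewrite /term -/h muleA -EFinM.
have -> : (\prod_(i < m) ind h i (tnth t i) = (\prod_(i < m) G i (tnth t i))%:E)%E.
  rewrite -prodEFin; apply: eq_bigr => i _; rewrite /ind indicE mem_set ?mule1//.
  apply: (euclid_dist_cube h0); rewrite mul1r; apply: le_trans dh.
  by rewrite /d (bigD1 i)//= lerDl; apply: sumr_ge0 => k _; exact: sqrtr_ge0.
rewrite -EFinM lee_fin mulrC ler_wpM2r//.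
apply: (@le_trans _ _ ((h / 2) `^ theta)^-1).
  rewrite lef_pV2 ?posrE ?powR_gt0 ?divr_gt0//.
  by apply: ge0_ler_powR; [exact: ltW|rewrite nnegrE ltW// divr_gt0|rewrite nnegrE ltW|].
rewrite powRE ?divr_gt0// -expRN ln_div ?posrE// -expRD ler_expR le_eqVlt.
by apply/orP; left; apply/eqP; ring.
Qed.

End dyadic_domination.

Section lower_integral_scale.
Import HBNNSimple.
Context d (T : measurableType d) (R : realType) (mu : {measure set T -> \bar R}).

Lemma ge0_lower_integralZl (k : R) (f : T -> \bar R) : 0 < k -> (forall x, (0 <= f x)%E) ->
  (\int[mu]_x (k%:E * f x) <= k%:E * \int[mu]_x f x)%E.
Proof.
move=> k0 f0; rewrite !ge0_integralTE//; last first.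
  by move=> x; rewrite mule_ge0// lee_fin ltW.
apply: ge_ereal_sup => _ [h /= hf <-].
have ki0 : 0 <= k^-1 by rewrite invr_ge0 ltW.
have -> : sintegral mu h = (k%:E * sintegral mu (scale_nnsfun h ki0))%E.
  rewrite -sintegralrM; congr (sintegral mu _); apply/funext => x.
  by rewrite /= mulrA mulfV ?mul1r// gt_eqF.
apply: lee_wpmul2l; first by rewrite lee_fin ltW.
apply: ereal_sup_ubound; exists (scale_nnsfun h ki0) => // x /=.
by rewrite EFinM lee_pdivrMl.
Qed.

End lower_integral_scale.

Section reduction.
Context {R : realType} {n m : nat}.
Implicit Types (x y : Rn R n) (h : R).

Lemma prodeZ (I : Type) (s : seq I) (k : I -> R) (A : I -> \bar R) :
  (\prod_(i <- s) ((k i)%:E * A i) = (\prod_(i <- s) k i)%:E * \prod_(i <- s) A i)%E.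
Proof.
elim: s => [|i s ih]; first by rewrite !big_nil mul1e.
by rewrite !big_cons ih /= EFinM muleACA.
Qed.

Lemma ae_le_dyadic_sum (alpha : R) (g g' : 'I_m -> Rn R n -> \bar R) s x :
  (forall i y, 0 <= g i y)%E -> (forall i y, 0 <= g' i y)%E ->
  (forall i, {ae leb n, forall y, (g i y <= g' i y)%E}) ->
  (dyadic_sum alpha g s x <= dyadic_sum alpha g' s x)%E.
Proof.
move=> g0 g'0 gg'; apply: lee_nneseries => j _.
  by move=> _; apply: dyadic_term_ge0 => //; exact: scale_gt0.
apply: lee_wpmul2l; first by rewrite lee_fin expR_ge0.
apply: lee_prode => i; first by apply: cube_average_ge0 => //; exact: scale_gt0.
by apply: ae_le_cube_average => //; exact: scale_gt0.
Qed.

Lemma dyadic_sumZ (alpha : R) (k : 'I_m -> R) (g : 'I_m -> Rn R n -> \bar R) s x :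
  (forall i, 0 <= k i) -> (forall i y, 0 <= g i y)%E ->
  (forall i, measurable_fun setT (g i)) ->
  dyadic_sum alpha (fun i y => (k i)%:E * g i y)%E s x =
  ((\prod_(i < m) k i)%:E * dyadic_sum alpha g s x)%E.
Proof.
move=> k0 g0 mg; rewrite /dyadic_sum -nneseriesZl; last first.
  by move=> j _; apply: dyadic_term_ge0 => //; exact: scale_gt0.
apply: eq_eseriesr => j _; rewrite /dyadic_term muleCA -prodeZ; congr (_ * _)%E.
apply: eq_bigr => i _; rewrite cube_averageZ//; first exact: scale_gt0.
by rewrite lee_fin.
Qed.

Lemma commutator_le_half_sums (alpha : R) (T : multi_operator R n m) :
  (0 < n)%N -> 0 < alpha / n%:R < m%:R ->
  T = fractional_maximal m alpha \/ T = fractional_integral m alpha ->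
  exists2 C : R, 0 < C & forall (b0 f0 b F : 'I_m -> Rn R n -> R),
    (forall i, measurable_fun setT (b i)) -> (forall i, measurable_fun setT (F i)) ->
    (forall i y, 0 <= F i y) ->
    (forall i, {ae leb n, forall y, b0 i y = b i y}) ->
    (forall i, {ae leb n, forall y, `|f0 i y| = F i y}) ->
    {ae leb n, forall x, (`|iterated_commutator T b0 f0 x| <=
      C%:E * (half_sum alpha F b false x + half_sum alpha F b true x))%E}.
Proof.
move=> n0 /andP[an0 anm] hT; have nR : 0 < n%:R :> R by rewrite ltr0n.
suff [C C0 H] : exists2 C : R, 0 <= C & forall (b0 f0 b F : 'I_m -> Rn R n -> R) x,
    (forall i, measurable_fun setT (b i)) -> (forall i, measurable_fun setT (F i)) ->
    (forall i y, 0 <= F i y) ->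
    (forall i, {ae leb n, forall y, b0 i y = b i y}) ->
    (forall i, {ae leb n, forall y, `|f0 i y| = F i y}) ->
    (forall i, b0 i x = b i x) ->
    (`|iterated_commutator T b0 f0 x| <=
      C%:E * (half_sum alpha F b false x + half_sum alpha F b true x))%E.
  exists (C + 1); first by rewrite ltr_wpDl.
  move=> b0 f0 b F mb mF F0 bb ff.
  have bx : {ae leb n, forall x, forall i, b0 i x = b i x} by exact: filter_forall.
  apply: filterS bx => x bx; apply: (le_trans (H b0 f0 b F x mb mF F0 bb ff bx)).
  apply: lee_wpmul2r; last by rewrite lee_fin lerDl.
  by apply: adde_ge0; exact: half_sum_ge0.
have aeG b0 f0 (b F : 'I_m -> Rn R n -> R) x i : {ae leb n, forall y, b0 i y = b i y} ->
    {ae leb n, forall y, `|f0 i y| = F i y} -> b0 i x = b i x ->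
    {ae leb n, forall y, `|(b0 i x - b0 i y) * f0 i y| = `|b i x - b i y| * F i y}.
  by move=> bb ff bx; apply: filterS2 bb ff => y -> <-; rewrite bx normrM.
case: hT => ->.
- have th0 : 0 <= m%:R - alpha / n%:R by rewrite subr_ge0 ltW.
  have [C C0 H] := @fractional_maximal_le_dyadic R n m alpha th0 n0.
  exists C => // b0 f0 b F x mb mF F0 bb ff bx.
  rewrite /iterated_commutator gee0_abs; last first.
    apply: ereal_sup_ge; eexists; first by exists 1 => /=.
    by rewrite mule_ge0 ?lee_fin ?invr_ge0 ?powR_ge0// prode_ge0// => i _; exact: integral_ge0.
  apply: (le_trans (H _ x)); apply: lee_wpmul2l; first by rewrite lee_fin.
  have key s : (dyadic_sum alpha (fun i y => `|(b0 i x - b0 i y) * f0 i y|%:E) s x <=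
      half_sum alpha F b s x)%E.
    apply: ae_le_dyadic_sum => [i y|i y|i]; rewrite ?lee_fin ?mulr_ge0//.
    by apply: filterS (aeG b0 f0 b F x i (bb i) (ff i) (bx i)) => y ->.
  exact: leeD.
have an : 0 < m%:R * n%:R - alpha by rewrite subr_gt0 -ltr_pdivrMr.
have [C C0 H] := @fractional_kernel_le_dyadic R n m alpha an.
exists C => // b0 f0 b F x mb mF F0 bb ff bx.
pose G i y := `|b i x - b i y| * F i y.
have mG i : measurable_fun setT (G i).
  apply: measurable_funM => //; apply: measurableT_comp => //.
  exact: measurable_funB.
have G0 i y : 0 <= G i y by rewrite mulr_ge0.
apply: le_trans (H G x mG G0); apply: (le_trans (abse_lower_integral _ _)).
have den0 t : 0 <= (\sum_(i < m) euclid_dist x (tnth t i)) `^ (m%:R * n%:R - alpha).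
  exact: powR_ge0.
apply: ge0_ae_le_lower_integral => [t|t|].
- by [].
- by rewrite lee_fin divr_ge0// prodr_ge0.
have aeGi : {ae leb n, forall y, forall i, `|(b0 i x - b0 i y) * f0 i y| = G i y}.
  by apply: filter_forall => i; exact: aeG.
apply: filterS (ae_measure_power m aeGi) => t Ht.
rewrite abse_EFin lee_fin normrM normfV (ger0_norm (den0 t)) ler_wpM2r ?invr_ge0//.
by rewrite normr_prod; under eq_bigr do rewrite Ht.
Qed.

End reduction.

Section norms.
Context {R : realType} {n m : nat}.

Lemma prod_shift_le (I : Type) (s : seq I) (L : I -> R) : (forall i, 0 <= L i) ->
  exists2 M : R, 0 <= M & forall d, 0 <= d <= 1 ->
    \prod_(i <- s) (L i + d) <= \prod_(i <- s) L i + d * M.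
Proof.
move=> L0; elim: s => [|i s [M M0 HM]].
  by exists 0 => // d _; rewrite !big_nil mulr0 addr0.
have P0 : 0 <= \prod_(j <- s) L j by exact: prodr_ge0.
exists (L i * M + \prod_(j <- s) L j + M) => [|d d01]; first by rewrite !addr_ge0 ?mulr_ge0.
have /andP[d0 d1] := d01; rewrite !big_cons.
apply: (le_trans (ler_wpM2l (addr_ge0 (L0 i) d0) (HM d d01))).
set P := \prod_(j <- s) L j in P0 *; have Li := L0 i.
have : d * (d * M) <= d * M by rewrite ler_wpM2l// ler_piMl.
nra.
Qed.

Lemma le_prod_limit (y : \bar R) (K : R) (L : 'I_m -> R) : 0 <= K -> (forall i, 0 <= L i) ->
  (forall d, 0 < d -> (y <= (K * \prod_(i < m) (L i + d))%:E)%E) ->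
  (y <= (K * \prod_(i < m) L i)%:E)%E.
Proof.
move=> K0 L0 H; have [M M0 HM] := prod_shift_le (index_enum 'I_m) L0.
apply/lee_addgt0Pr => e e0; pose d := Num.min 1 (e / (K * M + 1)).
have k0 : 0 < K * M + 1 by rewrite ltr_wpDl ?mulr_ge0.
have d0 : 0 < d by rewrite lt_min ltr01 divr_gt0.
have d1 : 0 <= d <= 1 by rewrite ltW//= ge_min lexx.
apply: (le_trans (H d d0)); rewrite -EFinD lee_fin.
apply: (le_trans (ler_wpM2l K0 (HM d d1))); rewrite mulrDr lerD2l.
have : d <= e / (K * M + 1) by rewrite ge_min lexx orbT.
rewrite ler_pdivlMr// => de; apply: le_trans de.
by rewrite mulrCA ler_wpM2l ?(ltW d0)// lerDl.
Qed.

Lemma Lvar_norm_ge0 (p : Rn R n -> R) (f : Rn R n -> \bar R) : (0 <= Lvar_norm p f)%E.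
Proof. by apply: le_ereal_inf_tmp => _ [l [l0 _] <-]; rewrite lee_fin ltW. Qed.

Lemma Lvar_norm_adherent (p : Rn R n -> R) (f : Rn R n -> \bar R) (d : R) : 0 < d ->
  (Lvar_norm p f < +oo)%E -> exists l : R, [/\ 0 < l, l <= fine (Lvar_norm p f) + d &
    (\int[leb n]_x (poweR (`|f x| * (l^-1)%:E) (p x)) <= 1)%E].
Proof.
move=> d0 fin; have fn : Lvar_norm p f \is a fin_num.
  by rewrite ge0_fin_numE ?Lvar_norm_ge0.
have [_ [l [l0 Hl] <-] lt] := lb_ereal_inf_adherent d0 fn.
exists l; split=> //; rewrite -lee_fin EFinD fineK// ltW//.
Qed.

Lemma BMO_norm_ge0 (b : Rn R n -> R) : (0 <= BMO_norm b)%E.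
Proof.
apply: ereal_sup_ge; eexists; first by exists ([tuple (0 : R) | i < n], 1) => /=.
rewrite mule_ge0 ?lee_fin ?invr_ge0 ?fine_ge0//; last exact: integral_ge0.
Qed.

End norms.

(** * The operator norm *)

Lemma commutator_Lvar_bound (R : realType) (n m : nat) (p_ : 'I_m -> Rn R n -> R)
    (q : Rn R n -> R) (alpha : R) (T : multi_operator R n m) : (0 < n)%N ->
  (forall i, log_Holder (p_ i) /\ exponent_P (p_ i)) -> exponent_P0 q ->
  (forall x, alpha / n%:R = \sum_(i < m) 1 / p_ i x - 1 / q x) ->
  0 < alpha / n%:R < m%:R ->
  T = fractional_maximal m alpha \/ T = fractional_integral m alpha ->
  exists2 C : R, 0 < C & forall (b0 f0 : 'I_m -> Rn R n -> R) (A l : 'I_m -> R),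
    (forall i, lebesgue_measurable (b0 i)) -> (forall i, lebesgue_measurable (f0 i)) ->
    (forall i, 0 < A i) -> (forall i, (BMO_norm (b0 i) <= (A i)%:E)%E) ->
    (forall i, 0 < l i) ->
    (forall i, (\int[leb n]_x poweR (`|(EFin \o f0 i) x| * (l i)^-1%:E) (p_ i x) <= 1)%E) ->
    (Lvar_norm q (iterated_commutator T b0 f0) <=
      (C * \prod_(i < m) A i * \prod_(i < m) l i)%:E)%E.
Proof.
move=> n0 hp hq hpq han hT.
have [a [q1 [q2 [C' [qinf [pinf [a1 q10 C'0 qinf12 [loc inf pinf_ge hqinf ag]]]]]]]] :=
  exponent_parameters n0 hp hq hpq.
have alpha0 : 0 < alpha.
  by move: han => /andP[+ _]; rewrite pmulr_lgt0// invr_gt0 ltr0n.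
have [C0 C00 HC0] := integral_half_sums_bound n0 alpha0 q10 a1 C'0 hpq loc inf pinf_ge
  qinf12 hqinf ag.
have [CT CT0 HCT] := commutator_le_half_sums n0 han hT.
have /choice[pt hpt] i : exists g, measurable_fun setT g /\
    {ae leb n, forall x, p_ i x = g x}.
  by have [_ [[[g mg pg] _] _ _]] := hp i; exists g.
pose w : R := (4 * n + 3)%:R ^+ n.
have w0 : 0 < w by rewrite exprn_gt0// ltr0n addn_gt0 orbT.
pose C1 := Num.max 1 C0; pose C2 := expR (q1^-1 * ln C1).
have C1_ge1 : 1 <= C1 by rewrite le_max lexx.
have C10 : 0 < C1 by exact: lt_le_trans C1_ge1.
have lnC1 : 0 <= ln C1 by exact: ln_ge0.
have C20 : 0 < C2 by exact: expR_gt0.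
exists (CT * w ^+ m * C2); first by rewrite !mulr_gt0// exprn_gt0.
move=> b0 f0 A l mb0 mf0 A0 bA l0 fl.
have /choice[b hb] i : exists g, measurable_fun setT g /\
    {ae leb n, forall x, b0 i x = g x} by have [g mg bg] := mb0 i; exists g.
have /choice[g hg] i : exists g, measurable_fun setT g /\
    {ae leb n, forall x, f0 i x = g x} by have [g mg fg] := mf0 i; exists g.
pose F i y := `|g i y|; pose k i := w * A i.
have k0 i : 0 < k i by rewrite mulr_gt0.
pose b' i y := b i y / k i; pose F' i y := F i y / l i.
have /choice[c hc] i := bmo_cube_oscillation (bA i).
pose c' i h x := c i h x / k i.
have mb i : measurable_fun setT (b i) := (hb i).1.
have mF i : measurable_fun setT (F i) by apply: measurableT_comp => //; exact: (hg i).1.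
have mb' i : measurable_fun setT (b' i) by exact: measurable_funM.
have mF' i : measurable_fun setT (F' i) by exact: measurable_funM.
have F0 i y : 0 <= F i y by exact: normr_ge0.
have F'0 i y : 0 <= F' i y by rewrite divr_ge0// ltW.
pose S x : \bar R := (half_sum alpha F' b' false x + half_sum alpha F' b' true x)%E.
have intS : (\int[leb n]_x poweR (S x) (q x) <= C0%:E)%E.
  apply: (HC0 pt F' b' c') => //.
  - by move=> i; exact: (hpt i).1.
  - by apply: filter_forall => i; exact: (hpt i).2.
  - move=> i; apply: le_trans (fl i); apply: ge0_ae_le_lower_integral.
    + by move=> y; rewrite lee_fin powR_ge0.
    + by move=> y; exact: poweR_ge0.
    apply: filterS2 (hpt i).2 (hg i).2 => y py fy.
    rewrite -[X in (_ <= X)%E]/(poweR ((`|f0 i y| / l i)%:E) (p_ i y)).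
    by rewrite poweR_EFin py fy.
  - move=> i h h0 x y xy; congr (_%:E).
    by rewrite /c'; have [] := (hc i).1 h h0 x y xy => ->.
  - move=> i h x h0.
    have ki : 0 <= (k i)^-1 by rewrite invr_ge0 ltW.
    have mbc : measurable_fun setT (fun y => `|b i y - c i h x|%:E).
      by apply/measurable_EFinP; apply: measurableT_comp => //; exact: measurable_funB.
    have -> : (fun y => `|b' i y - c' i h x|%:E) =
        (fun y => (k i)^-1%:E * `|b i y - c i h x|%:E)%E.
      apply/funext => y; rewrite -EFinM /b' /c' -mulrBl normrM (ger0_norm ki).
      by rewrite mulrC.
    rewrite cube_averageZ// lee_pdivrMl// mule1.
    apply: le_trans ((hc i).2 h x h0); apply: ae_le_cube_average => //.
    by apply: filterS (hb i).2 => y ->.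
have halfE s x : half_sum alpha F b s x =
    ((\prod_(i < m) (k i * l i))%:E * half_sum alpha F' b' s x)%E.
  rewrite -[LHS]/(dyadic_sum alpha (fun i y => (`|b i x - b i y| * F i y)%:E) s x).
  rewrite -[half_sum alpha F' b' s x]/(dyadic_sum alpha
    (fun i y => (`|b' i x - b' i y| * F' i y)%:E) s x) -dyadic_sumZ.
  - congr (dyadic_sum alpha _ s x); apply/funext => i; apply/funext => y.
    rewrite -EFinM /b' /F' -mulrBl normrM normfV (gtr0_norm (k0 i)); congr (_%:E).
    by field; rewrite !gt_eqF.
  - by move=> i; rewrite ltW// mulr_gt0.
  - by move=> i y; rewrite lee_fin mulr_ge0.
  - move=> i; apply/measurable_EFinP; apply: measurable_funM => //.
    by apply: measurableT_comp => //; exact: measurable_funB.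
have hs0 s x : (0 <= half_sum alpha F' b' s x)%E by exact: half_sum_ge0.
have S0 x : (0 <= S x)%E by exact: adde_ge0.
have PA : 0 < \prod_(i < m) A i by exact: prodr_gt0.
have Pl : 0 < \prod_(i < m) l i by exact: prodr_gt0.
set lam := (CT * w ^+ m * C2 * \prod_(i < m) A i * \prod_(i < m) l i).
have lam0 : 0 < lam by rewrite !mulr_gt0// exprn_gt0.
apply: ereal_inf_lbound; exists lam => //; split=> //.
apply: (@le_trans _ _ (\int[leb n]_x (C1^-1%:E * poweR (S x) (q x)))%E).
  apply: ge0_ae_le_lower_integral.
  - by move=> x; exact: poweR_ge0.
  - by move=> x; rewrite mule_ge0 ?poweR_ge0// lee_fin invr_ge0 ltW.
  apply: filterS2 ag (HCT b0 f0 b F mb mF F0 (fun i => (hb i).2) _); last first.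
    by move=> i; apply: filterS (hg i).2 => y ->.
  move=> x [_ /andP[q1x q2x]] Hx; have qx0 : 0 < q x by exact: lt_le_trans q1x.
  apply: (@le_trans _ _ (poweR (C2^-1%:E * S x) (q x))).
    have Tx0 : (0 <= `|iterated_commutator T b0 f0 x| * (lam^-1)%:E)%E.
      by apply: mule_ge0; rewrite ?abse_ge0// lee_fin invr_ge0 ltW.
    have Sx0 : (0 <= C2^-1%:E * S x)%E.
      by apply: mule_ge0 => //; rewrite lee_fin invr_ge0 ltW.
    apply: gt0_ler_poweR; rewrite ?(ltW qx0)// ?in_itv/= ?leey ?Tx0 ?Sx0//.
    rewrite muleC lee_pdivrMl//; apply: (le_trans Hx); rewrite !halfE -ge0_muleDr//.
    rewrite -/(S x) !muleA -!EFinM le_eqVlt; apply/orP; left; apply/eqP.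
    congr (_%:E * _)%E; rewrite /lam big_split/= /k big_split/= prodr_const card_ord.
    by field; rewrite gt_eqF.
  rewrite poweRM//; last by rewrite lee_fin invr_ge0 ltW.
  apply: lee_wpmul2r; first exact: poweR_ge0.
  rewrite poweR_EFin lee_fin powRE ?invr_gt0// lnV ?posrE// expRK.
  rewrite -[in leRHS](@lnK R C1)// -expRN ler_expR mulrN lerN2 mulrA ler_peMl//.
  by rewrite ler_pdivlMr// mul1r.
apply: (le_trans (ge0_lower_integralZl (leb n) _ _)); rewrite ?invr_gt0//.
  by move=> x; exact: poweR_ge0.
rewrite lee_pdivrMl// mule1; apply: (le_trans intS).
by rewrite lee_fin le_max lexx orbT.
Qed.

Theorem theorem2p5 (R : realType) (n m : nat) (hn : (1 <= n)%N) (hm : (1 <= m)%N)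
    (p_ : 'I_m -> Rn R n -> R)
    (hp_ : forall i, log_Holder (p_ i) /\ exponent_P (p_ i))
    (p : Rn R n -> R) (hp : forall x, 1 / p x = \sum_(i < m) 1 / p_ i x)
    (alpha : R) (q : Rn R n -> R) (hq : exponent_P0 q)
    (halpha : forall x, alpha / n%:R = 1 / p x - 1 / q x)
    (halpha0 : 0 < alpha / n%:R < m%:R)
    (T : multi_operator R n m)
    (hT : T = fractional_maximal m alpha \/ T = fractional_integral m alpha) :
  exists2 C : R, 0 < C &
    forall b : 'I_m -> Rn R n -> R, (forall i, in_BMO (b i)) ->
      (operator_norm p_ q (iterated_commutator T b) <=
        C%:E * \prod_(i < m) BMO_norm (b i))%E.
Proof.
have hpq x : alpha / n%:R = \sum_(i < m) 1 / p_ i x - 1 / q x by rewrite (halpha x) hp.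
have [C C0 HC] := commutator_Lvar_bound hn hp_ hq hpq halpha0 hT.
exists C => // b hb.
have N0 i : 0 <= fine (BMO_norm (b i)) by exact/fine_ge0/BMO_norm_ge0.
have NE i : BMO_norm (b i) = (fine (BMO_norm (b i)))%:E.
  by rewrite fineK// ge0_fin_numE ?BMO_norm_ge0//; have [] := hb i.
under eq_bigr do rewrite NE.
rewrite prodEFin -EFinM; apply: le_prod_limit => // [|e e0]; first exact: ltW.
set A := fun i => fine (BMO_norm (b i)) + e.
have A0 i : 0 < A i by rewrite ltr_wpDl.
have PA : 0 <= C * \prod_(i < m) A i.
  by rewrite mulr_ge0 ?(ltW C0)// prodr_ge0// => i _; exact: ltW.
apply: ereal_inf_lbound; exists (C * \prod_(i < m) A i) => //; split=> // f hf.
have L0 i : 0 <= fine (Lvar_norm (p_ i) (EFin \o f i)) by exact/fine_ge0/Lvar_norm_ge0.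
have LE i : Lvar_norm (p_ i) (EFin \o f i) = (fine (Lvar_norm (p_ i) (EFin \o f i)))%:E.
  by rewrite fineK// ge0_fin_numE ?Lvar_norm_ge0//; exact: (hf i).2.
have -> : (\prod_(i < m) Lvar_norm (p_ i) (EFin \o f i) =
    (\prod_(i < m) fine (Lvar_norm (p_ i) (EFin \o f i)))%:E)%E.
  by rewrite -prodEFin; apply: eq_bigr => i _; exact: LE.
rewrite -EFinM; apply: le_prod_limit => // d d0.
have /choice[l hl] i := Lvar_norm_adherent d0 (hf i).2.
apply: (le_trans (HC b f A l _ _ A0 _ _ _)).
- by move=> i; have [] := hb i.
- by move=> i; exact: (hf i).1.
- by move=> i; rewrite NE lee_fin lerDl ltW.
- by move=> i; have [] := hl i.
- by move=> i; have [] := hl i.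
rewrite lee_fin ler_wpM2l//; apply: ler_prod => i _.
by have [l0 ll _] := hl i; rewrite ltW.
Qed.
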